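(* Let $\theta$ be a non-constant inner function, let $\varphi,\psi\in L^\infty(\mathbb{T})$, and let $T=A_\varphi+B_\psi$, where $A_\varphi$ is the truncated Toeplitz operator and $B_\psi$ the truncated Hankel operator on $\mathcal{K}_\theta$ with symbols $\varphi$ and $\psi$. Then $D_HD_T(T)$ is a finite-rank operator of rank at most $4$. More precisely, suppose $u_1,v_1,u_2,v_2\in\mathcal{K}_\theta$ satisfy $$A_\varphi-S_\theta A_\varphi S_\theta^*=u_1\otimes k_0^\theta+k_0^\theta\otimes v_1,\qquad B_\psi-S_\theta^*B_\psi S_\theta^*=u_2\otimes k_0^\theta+\widetilde{k}_0^\theta\otimes v_2.$$ Then $$\begin{aligned}D_HD_T(T)&=k_0^\theta\otimes\big[v_1+\overline{\theta(0)}\,S_\theta v_2+S_\theta^2B_\psi^*k_0^\theta\big]\\&\quad+\widetilde{k}_0^\theta\otimes\big[\theta(0)\,S_\theta v_1+v_2-S_\theta^2B_\psi^*\widetilde{k}_0^\theta\big]\\&\quad+(u_1+u_2)\otimes k_0^\theta-\big(S_\theta^*u_1+S_\theta u_2\big)\otimes S_\theta k_0^\theta.\end{aligned}$$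
   Context: $\mathbb{T}$ is the unit circle with normalized Lebesgue measure, $L^2=L^2(\mathbb{T})$, $H^2\subset L^2$ is the Hardy space (functions with vanishing negative Fourier coefficients), $H^2_-=L^2\ominus H^2$, and $P_{H^2_-}$ is the orthogonal projection onto $H^2_-$. An inner function $\theta$ is a bounded analytic function on the unit disk with $|\theta|=1$ a.e. on $\mathbb{T}$. The model space is $\mathcal{K}_\theta=H^2\ominus\theta H^2$ and $P_{\mathcal{K}_\theta}:L^2\to\mathcal{K}_\theta$ is the orthogonal projection. The compressed shift is $S_\theta f=P_{\mathcal{K}_\theta}(zf)$, $f\in\mathcal{K}_\theta$. Put $k_0^\theta(z)=1-\overline{\theta(0)}\theta(z)$ and $\widetilde{k}_0^\theta(z)=\frac{\theta(z)-\theta(0)}{z}$, both in $\mathcal{K}_\theta$. $(p\otimes q)f=\langle f,q\rangle p$ (inner product linear in the first variable). For $\varphi\in L^\infty(\mathbb{T})$ the truncated Toeplitz operator is $A_\varphi f=P_{\mathcal{K}_\theta}(\varphi f)$, $f\in\mathcal{K}_\theta$, and the truncated Hankel operator is $B_\varphi f=P_{\mathcal{K}_\theta}JP_{H^2_-}(\varphi f)$, $f\in\mathcal{K}_\theta$, where $J:L^2\to L^2$ is the unitary $(Jf)(z)=\bar z f(\bar z)$. For bounded operators $X$ on $\mathcal{K}_\theta$: $D_T(X)=X-S_\theta XS_\theta^*$, $D_H(X)=X-S_\theta^*XS_\theta^*$, and $D_HD_T=D_H\circ D_T$. It is known (Sarason; Gu–Ma) that vectors $u_1,v_1,u_2,v_2\in\mathcal{K}_\theta$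 as in the claim always exist. *)

(* Defs.v *)
From HB Require Import structures.
From mathcomp Require Import all_boot all_order all_algebra.
From mathcomp Require Import complex.
From mathcomp Require Import all_classical all_reals all_analysis.

Set Implicit Arguments.
Unset Strict Implicit.
Unset Printing Implicit Defensive.
Import Order.TTheory GRing.Theory Num.Theory.
Import numFieldNormedType.Exports.

Local Open Scope classical_set_scope.
Local Open Scope complex_scope.
Local Open Scope ring_scope.

(* Functions on the unit circle are represented by functions C -> C, of which
   only the values at the points [cis t], -pi <= t <= pi, are ever used.
   Elements of L^2 are such functions (Borel measurable in t), to be identified
   when they are equal almost everywhere, [eqm f g].  Operators are maps
   between functions; those chosen by [xget] below depend only on the a.e.
   class of their argument, and are determined up to a.e. equality. *)

Section Circle.
Variable R : realType.
Local Notation C := (R[i]).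
Local Notation fct := (C -> C).
Implicit Types (f g h : fct) (M : set fct) (X : fct -> fct).

Definition cis (t : R) : C := cos t +i* sin t.

Definition arc : set R := `[- pi, pi].

Definition eqm f g : Prop :=
  f \o cis = g \o cis %[ae (@lebesgue_measure R) in arc].

Definition measurable_circle f : Prop :=
  measurable_fun arc (fun t => complex.Re (f (cis t))) /\
  measurable_fun arc (fun t => complex.Im (f (cis t))).

Definition L2 : set fct := [set f | measurable_circle f /\
  (\int[lebesgue_measure]_(t in arc)
      ((complex.Re `|f (cis t)|) ^+ 2)%:E < +oo)%E].

Definition Linfty : set fct := [set f | measurable_circle f /\
  exists M : R,
    \forall t \ae (@lebesgue_measure R), arc t -> `|f (cis t)| <= M%:C].

Definition circle_int f : C :=
  ((2 * pi)^-1 * \int[lebesgue_measure]_(t in arc) complex.Re (f (cis t))) +i*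
  ((2 * pi)^-1 * \int[lebesgue_measure]_(t in arc) complex.Im (f (cis t))).

Definition dot f g : C := circle_int (fun z => f z * (g z)^*).

Definition norm2 f : R := Num.sqrt (complex.Re (dot f f)).

Definition fourier f (n : int) : C := circle_int (fun z => f z * z ^ (- n)).

Definition H2 : set fct :=
  [set f | L2 f /\ forall n : int, n < 0 -> fourier f n = 0].

Definition orth M : set fct :=
  [set f | L2 f /\ forall g, M g -> dot f g = 0].

Definition H2minus : set fct := orth H2.

Definition proj M f : fct := xget \0 [set g | M g /\ orth M (f \- g)].

Definition adjoint M X g : fct :=
  xget \0 [set h | M h /\ forall f, M f -> dot (X f) g = dot f h].

Definition tensor (p q : fct) f : fct := dot f q \*o p.

(* Equality of operators on M. *)
Definition eqop M X (Y : fct -> fct) : Prop := forall f, M f -> eqm (X f) (Y f).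

Definition bounded_op M X : Prop :=
  [/\ forall f, M f -> M (X f),
      forall f g, M f -> M g -> eqm f g -> eqm (X f) (X g),
      forall (a : C) f g, M f -> M g ->
        eqm (X ((a \*o f) \+ g)) ((a \*o X f) \+ X g)
    & exists B : R, forall f, M f -> norm2 (X f) <= B * norm2 f].

(* The range of X on M contains no n + 1 linearly independent vectors. *)
Definition rank_le (n : nat) M X : Prop :=
  forall g : 'I_n.+1 -> fct, (forall i, M (g i)) ->
  exists2 c : 'I_n.+1 -> C, (exists i, c i != 0) &
    eqm (fun z => \sum_i c i * X (g i) z) \0.

Definition flipJ f : fct := fun z => z^* * f (z^*).

Section Model.
Variable theta : fct.

Definition bdry : fct :=
  fun z => lim ((theta (r%:C * z) : C^o) @[r --> (1 : R)^'-]).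

(* For almost every z on the circle the radial limit of theta at z exists
   (as Fatou's theorem asserts) and has modulus 1. *)
Definition inner_function : Prop :=
  [/\ forall z : C, `|z| < 1 -> derivable (theta : C^o -> C^o) z 1,
      exists B : R, forall z : C, `|z| < 1 -> `|theta z| <= B%:C
    & \forall t \ae (@lebesgue_measure R), arc t ->
        cvg ((theta (r%:C * cis t) : C^o) @[r --> (1 : R)^'-]) /\
        `|bdry (cis t)| = 1].

Definition nonconstant : Prop :=
  exists z w : C, [/\ `|z| < 1, `|w| < 1 & theta z != theta w].

Definition model_space : set fct :=
  [set f | H2 f /\ orth [set bdry \* h | h in H2] f].

Definition cshift f : fct := proj model_space (fun z => z * f z).

Definition cshift_adj : fct -> fct := adjoint model_space cshift.

Definition k0 : fct := fun z => 1 - (theta 0)^* * bdry z.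

Definition k0t : fct := fun z => (bdry z - theta 0) / z.

Definition toeplitz (phi : fct) f : fct := proj model_space (phi \* f).

Definition hankel (phi : fct) f : fct :=
  proj model_space (flipJ (proj H2minus (phi \* f))).

Definition DT X : fct -> fct := fun f => X f \- cshift (X (cshift_adj f)).

Definition DH X : fct -> fct := fun f => X f \- cshift_adj (X (cshift_adj f)).

End Model.
End Circle.

(* Main.v *)
Require Import Defs.
From HB Require Import structures.
From mathcomp Require Import all_boot all_order all_algebra.
From mathcomp Require Import complex.
From mathcomp Require Import all_classical all_reals all_analysis.
From mathcomp Require Import measurable_realfun ring lra zify.

(** Write S for the compressed shift, k and kt for k0 and k0t, and b for the
    boundary function of theta.  The formula is pure algebra once four relations
    for S are known:

      S S^* = 1 - k (x) k,       S^* S = 1 - kt (x) kt,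
      S^* k = - (theta 0)^* kt,  S kt = - theta 0 k.

    Indeed D_H D_T X - D_T D_H X = (S^* S - S S^* ) X S^*^2, so that
      D_H D_T (A + B) = D_H (D_T A) + D_T (D_H B) + (k (x) k - kt (x) kt) B S^*^2,
    and it remains to insert the two displacement equations and to move S and
    S^* across the tensors.  Operators are compared through the scalars
    <X f, g> with f and g in the model space, because S^* and B^* are only
    specified by such scalars ([displacement_formula]).  The four tensors bound
    the rank, provided that vectors u1, v1, u2, v2 exist at all; this is
    computed in [toeplitz_displacement] and [hankel_displacement].

    The relations for S follow from the explicit descriptions
    S f = z f - <z f, b> b and S^* f = (f - mean f) / z, and these from two
    properties of b: it is unimodular almost everywhere, and
    mean (b h) = theta 0 * mean h for every h in H^2 ([circle_int_bdry]).  The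
    second one is where the analyticity of theta enters.  On a circle of radius
    r < 1 the function theta is continuous, the Cauchy theorem
    (from Goursat's theorem for polar rectangles, [goursat] and
    [circle_int_radius]) makes its negative Fourier coefficients vanish, and
    its uniformly bounded Fejer means converge to it, which gives the identity
    for the dilates ([circle_int_dilate]).  Then r tends to 1 under dominated
    convergence.

    Projections and adjoints are obtained by choice, hence carry information
    only after existence is shown; existence of orthogonal projections rests on
    the completeness of L^2 ([riesz_fischer], [exists_proj]). *)

Set Implicit Arguments.
Unset Strict Implicit.
Unset Printing Implicit Defensive.
Import Order.TTheory GRing.Theory Num.Theory.
Import numFieldNormedType.Exports.

Local Open Scope classical_set_scope.
Local Open Scope complex_scope.
Local Open Scope ring_scope.

(** * Integrable and square-integrable functions on the arc *)

Section RealIntegrals.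
Variable R : realType.
Local Notation mu := (@lebesgue_measure R).
Local Notation arc := (@Defs.arc R).
Implicit Types u v w : R -> R.

Definition itg u := mu.-integrable arc (EFin \o u).
Definition aint u : R := \int[mu]_(t in arc) u t.
Definition sq_itg u := measurable_fun arc u /\ itg (fun t => u t ^+ 2).

Lemma measurable_arc : measurable (arc : set (measurableTypeR R)).
Proof. exact: measurable_itv. Qed.
Hint Resolve measurable_arc : core.

Lemma ae_imp (P Q : R -> Prop) : (forall t, P t -> Q t) ->
  (\forall t \ae mu, P t) -> \forall t \ae mu, Q t.
Proof. exact: (@filterS _ _ (ae_filter_ringOfSetsType mu)). Qed.

Lemma ae_imp2 (P Q S : R -> Prop) : (forall t, P t -> Q t -> S t) ->
  (\forall t \ae mu, P t) -> (\forall t \ae mu, Q t) -> \forall t \ae mu, S t.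
Proof. exact: (@filterS2 _ _ (ae_filter_ringOfSetsType mu)). Qed.

Lemma arc_measure : mu arc = (2 * pi)%:E.
Proof.
rewrite /Defs.arc lebesgue_measure_itv /= lte_fin.
have p := pi_gt0 R; rewrite ifT; last lra.
by rewrite -EFinD; congr EFin; lra.
Qed.

Lemma arc_measure_lty : (mu arc < +oo)%E.
Proof. by rewrite arc_measure ltry. Qed.

Lemma itg_measurable u : itg u -> measurable_fun arc u.
Proof. by move=> /integrableP[/measurable_EFinP]. Qed.

Lemma itgD u v : itg u -> itg v -> itg (fun t => u t + v t).
Proof. by move=> iu iv; have := integrableD measurable_arc iu iv. Qed.

Lemma itgZ a u : itg u -> itg (fun t => a * u t).
Proof. by move=> iu; have := integrableZl measurable_arc a iu. Qed.

Lemma itgN u : itg u -> itg (fun t => - u t).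
Proof. by move=> /(itgZ (-1)); under eq_fun do rewrite mulN1r. Qed.

Lemma itgB u v : itg u -> itg v -> itg (fun t => u t - v t).
Proof. by move=> iu /itgN; exact: itgD. Qed.

Lemma le_itg u v : measurable_fun arc u ->
  (forall t, arc t -> `|u t| <= v t) -> itg v -> itg u.
Proof.
move=> mu' uv iv; apply: le_integrable iv => //; first exact/measurable_EFinP.
by move=> t At /=; rewrite lee_fin (le_trans (uv _ At))// ler_norm.
Qed.

Lemma itg_bounded u M : measurable_fun arc u ->
  (forall t, arc t -> `|u t| <= M) -> itg u.
Proof.
move=> mu' uM; apply: (@le_itg _ (cst M)) => //.
apply: measurable_bounded_integrable => //; first exact: arc_measure_lty.
exists `|M|; split => // x Mx t _ /=; exact: ltW.
Qed.

Lemma aintD u v : itg u -> itg v -> aint (fun t => u t + v t) = aint u + aint v.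
Proof. by move=> iu iv; rewrite /aint RintegralD. Qed.

Lemma aintZ a u : itg u -> aint (fun t => a * u t) = a * aint u.
Proof. by move=> iu; rewrite /aint RintegralZl. Qed.

Lemma aintN u : itg u -> aint (fun t => - u t) = - aint u.
Proof. by move=> iu; under eq_fun do rewrite -mulN1r; rewrite aintZ// mulN1r. Qed.

Lemma aintB u v : itg u -> itg v -> aint (fun t => u t - v t) = aint u - aint v.
Proof. by move=> iu iv; rewrite aintD ?aintN//; exact: itgN. Qed.

Lemma eq_aint u v : (forall t, arc t -> u t = v t) -> aint u = aint v.
Proof. by move=> uv; apply: eq_Rintegral => t /set_mem; exact: uv. Qed.

Lemma aint_ge0 u : (forall t, arc t -> 0 <= u t) -> 0 <= aint u.
Proof. by move=> u0; exact: Rintegral_ge0. Qed.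

Lemma le_aint u v : itg u -> itg v -> (forall t, arc t -> u t <= v t) ->
  aint u <= aint v.
Proof. by move=> iu iv uv; exact: le_Rintegral. Qed.

Lemma aint_cst a : aint (cst a) = a * (2 * pi).
Proof.
rewrite /aint Rintegral_cst//; congr (_ * _).
by have /(congr1 fine) := arc_measure.
Qed.

Lemma ae_aint u v : measurable_fun arc u -> measurable_fun arc v ->
  u = v %[ae mu in arc] -> aint u = aint v.
Proof.
move=> mu' mv uv; congr fine; apply: ae_eq_integral => //;
  try exact/measurable_EFinP.
by apply: ae_imp uv => t h At; rewrite /= h.
Qed.

Lemma aint_eq0 u : itg u -> (forall t, arc t -> 0 <= u t) -> aint u = 0 ->
  u = cst 0 %[ae mu in arc].
Proof.
move=> iu u0 u00.
have : ae_eq mu arc (EFin \o u) (cst 0%E).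
  apply/(ae_eq_integral_abs mu) => //.
    by move/integrableP: (iu) => [].
  under eq_integral => t /set_mem At do rewrite /= ger0_norm ?u0//.
  have : (\int[mu]_(t in arc) (u t)%:E)%E \is a fin_num by exact: integrable_fin_num.
  by move/fineK <-; rewrite -[fine _]/(aint u) u00.
by apply: ae_imp => t h At; have := h At; case.
Qed.

(** The unitary J involves z |-> z^*, which is t |-> - t on the arc; the
    lemmas on reflection make J self-adjoint. *)
Lemma arcN t : arc (- t) <-> arc t.
Proof. rewrite /Defs.arc /= !in_itv /=; split=> /andP[]; lra. Qed.

Lemma measurable_arcN u : measurable_fun arc u ->
  measurable_fun arc (fun t => u (- t)).
Proof.
move=> mu'; apply: (@measurable_comp _ _ _ _ _ _ arc u arc -%R measurable_arc
  _ mu' (@oppr_measurable R arc)).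
by move=> _ [t At <-]; exact/arcN.
Qed.

Lemma ge0_aintN u : measurable_fun arc u -> (forall t, arc t -> 0 <= u t) ->
  (\int[mu]_(t in arc) (u (- t))%:E = \int[mu]_(t in arc) (u t)%:E)%E.
Proof.
move=> mu' u0.
have H := @ge0_integral_pushforward _ _ _ _ R (-%R : measurableTypeR R -> measurableTypeR R)
  (@oppr_measurable R setT) mu arc (EFin \o u) measurable_arc.
have AN : -%R @^-1` arc = arc by apply/seteqP; split => t /=; rewrite arcN.
transitivity (\int[pushforward mu (-%R : measurableTypeR R -> measurableTypeR R)]_(t in arc) (EFin \o u) t)%E; last first.
  by apply: eq_measure_integral => A mA _; exact: lebesgue_measureN.
rewrite H; first by rewrite AN.
- exact/measurable_EFinP.
- by move=> t /set_mem At; rewrite lee_fin u0.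
Qed.

Lemma itg_arcN u : itg u -> itg (fun t => u (- t)).
Proof.
move=> iu; have mu' := itg_measurable iu; apply/integrableP; split.
  apply/measurable_EFinP; exact: measurable_arcN.
have := @ge0_aintN (fun t => `|u t|) (measurableT_comp (@normr_measurable R setT) mu')
  (fun t _ => normr_ge0 _).
by move=> /= ->; move/integrableP: iu => [].
Qed.

Lemma aint_arcN u : itg u -> aint (fun t => u (- t)) = aint u.
Proof.
move=> iu; have mu' := itg_measurable iu.
have pos v : measurable_fun arc v -> (forall t, arc t -> 0 <= v t) ->
    aint (fun t => v (- t)) = aint v.
  by move=> mv v0; congr fine; exact: ge0_aintN.
have iA : itg (fun t => `|u t|).
  by have := integrable_norm iu.
have iuA := itgD iu iA.
have split_u v : itg v -> itg (fun t => `|v t|) ->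
    aint v = aint (fun t => v t + `|v t|) - aint (fun t => `|v t|).
  move=> iv iAv; rewrite -(aintB (itgD iv iAv) iAv).
  by apply: eq_aint => t _; rewrite addrK.
rewrite (split_u u)// (split_u (fun t => u (- t))) ?(itg_arcN iu) ?(itg_arcN iA)//.
have uN t : 0 <= u t + `|u t| by have := ler_norm (- u t); rewrite normrN; lra.
congr (_ - _); [apply: (pos (fun t => u t + `|u t|))|apply: (pos (fun t => `|u t|))] => //;
  exact: itg_measurable.
Qed.

Lemma sq_itgM u v : sq_itg u -> sq_itg v -> itg (fun t => u t * v t).
Proof.
move=> [mu' iu] [mv iv].
apply: (le_itg _ _ (itgD iu iv)) => [|t _]; first exact: measurable_funM.
rewrite normrM -(real_normK (num_real (u t))) -(real_normK (num_real (v t))).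
by have := sqr_ge0 (`|u t| - `|v t|); nra.
Qed.

Lemma sq_itgD u v : sq_itg u -> sq_itg v -> sq_itg (fun t => u t + v t).
Proof.
move=> su sv; split; first by apply: measurable_funD; [case: su|case: sv].
have -> : (fun t => (u t + v t) ^+ 2) =
    (fun t => u t ^+ 2 + (2 * (u t * v t) + v t ^+ 2)).
  by apply/funext => t; ring.
by apply: itgD; [case: su|apply: itgD; [exact/itgZ/sq_itgM|case: sv]].
Qed.

Lemma sq_itgZ a u : sq_itg u -> sq_itg (fun t => a * u t).
Proof.
move=> [mu' iu]; split; first exact: measurable_funM.
by under eq_fun do rewrite exprMn; exact: itgZ.
Qed.

Lemma sq_itgN u : sq_itg u -> sq_itg (fun t => - u t).
Proof. by move=> /(sq_itgZ (-1)); under eq_fun do rewrite mulN1r. Qed.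

Lemma sq_itg_bounded u M : measurable_fun arc u ->
  (forall t, arc t -> `|u t| <= M) -> sq_itg u.
Proof.
move=> mu' uM; split=> //; apply: (@itg_bounded _ (M ^+ 2)).
  exact: measurable_funX.
by move=> t At; rewrite normrX lerXn2r ?nnegrE// ?uM// (le_trans _ (uM t At)).
Qed.

Lemma sq_itg_mul_ae (m : R -> R) u (M : R) : measurable_fun arc m ->
  (\forall t \ae mu, arc t -> `|m t| <= M) ->
  sq_itg u -> sq_itg (fun t => m t * u t).
Proof.
move=> mm mM [mu' iu].
have mmu : measurable_fun arc (fun t => m t * u t) by exact: measurable_funM.
split=> //; apply/integrableP; split; first by apply/measurable_EFinP; exact: measurable_funX.
apply: (@le_lt_trans _ _ (\int[mu]_(t in arc) (M ^+ 2 * u t ^+ 2)%:E)%E); last first.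
  have /integrableP[_] := itgZ (M ^+ 2) iu; apply: le_lt_trans.
  rewrite le_eqVlt; apply/orP; left; apply/eqP; apply: eq_integral => t _ /=.
  by rewrite ger0_norm// mulr_ge0// sqr_ge0.
apply: ae_ge0_le_integral => //.
- by apply/measurable_EFinP; apply: measurableT_comp => //; exact: measurable_funX.
- by move=> t _; rewrite lee_fin mulr_ge0// sqr_ge0.
- by apply/measurable_EFinP; apply: measurable_funM => //; exact: measurable_funX.
apply: ae_imp mM => t h At; rewrite lee_fin normrX normrM exprMn.
rewrite ler_pM// ?sqr_ge0//; last by rewrite real_normK// num_real.
by rewrite lerXn2r ?nnegrE// ?h// (le_trans _ (h At)).
Qed.

Lemma sq_itg_arcN u : sq_itg u -> sq_itg (fun t => u (- t)).
Proof. by move=> [mu' iu]; split; [exact: measurable_arcN|exact: (itg_arcN iu)]. Qed.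

End RealIntegrals.

(** * Means over the circle and the inner product of L^2 *)

Section Circle.
Variable R : realType.
Local Notation mu := (@lebesgue_measure R).
Local Notation arc := (@Defs.arc R).
Local Notation C := (R[i]).
Local Notation fct := (C -> C).
Implicit Types (f g h : fct) (x y : C).

Lemma conjE x : Num.conj x = complex.Re x -i* complex.Im x.
Proof. by case: x. Qed.

Lemma conjM x y : Num.conj (x * y) = Num.conj x * Num.conj y.
Proof. exact: rmorphM. Qed.

Lemma conjR (a : R) : Num.conj (a%:C) = a%:C :> C.
Proof. by rewrite conjE /= oppr0. Qed.

Lemma ReD x y : complex.Re (x + y) = complex.Re x + complex.Re y.
Proof. by case: x y => ? ? []. Qed.

Lemma ImD x y : complex.Im (x + y) = complex.Im x + complex.Im y.
Proof. by case: x y => ? ? []. Qed.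

Lemma ReN x : complex.Re (- x) = - complex.Re x. Proof. by case: x. Qed.
Lemma ImN x : complex.Im (- x) = - complex.Im x. Proof. by case: x. Qed.

Lemma ReM x y :
  complex.Re (x * y) = complex.Re x * complex.Re y - complex.Im x * complex.Im y.
Proof. by case: x y => ? ? []. Qed.

Lemma ImM x y :
  complex.Im (x * y) = complex.Re x * complex.Im y + complex.Im x * complex.Re y.
Proof. by case: x y => ? ? []. Qed.

Lemma ReJ x : complex.Re (Num.conj x) = complex.Re x. Proof. by case: x. Qed.
Lemma ImJ x : complex.Im (Num.conj x) = - complex.Im x. Proof. by case: x. Qed.

Lemma complex_eq x y :
  complex.Re x = complex.Re y -> complex.Im x = complex.Im y -> x = y.
Proof. by case: x y => a b [c d] /= -> ->. Qed.

Lemma Re_norm_sqr x :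
  (complex.Re `|x|) ^+ 2 = complex.Re x ^+ 2 + complex.Im x ^+ 2.
Proof. by rewrite normc_def /= sqr_sqrtr// addr_ge0 ?sqr_ge0. Qed.

Definition rpart f (t : R) := complex.Re (f (cis t)).
Definition ipart f (t : R) := complex.Im (f (cis t)).
Definition citg f := itg (rpart f) /\ itg (ipart f).

(** |f|^2 is the sum of the squares of the two parts, so L^2 over the complex
    numbers is two copies of real L^2. *)
Lemma L2E f : L2 f <-> sq_itg (rpart f) /\ sq_itg (ipart f).
Proof.
split=> [[[mr mi] /= fin]|[[mr ir] [mi ii]]].
  have mm : measurable_fun arc (fun t => rpart f t ^+ 2 + ipart f t ^+ 2).
    by apply: measurable_funD; exact: measurable_funX.
  have i2 : itg (fun t => rpart f t ^+ 2 + ipart f t ^+ 2).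
    apply/integrableP; split; first exact/measurable_EFinP.
    apply: le_lt_trans fin; rewrite le_eqVlt; apply/orP; left; apply/eqP.
    apply: eq_integral => t _ /=; rewrite Re_norm_sqr ger0_norm//.
    by rewrite addr_ge0 ?sqr_ge0.
  split; split=> //; apply: (le_itg _ _ i2); try exact: measurable_funX.
    by move=> t _; rewrite ger0_norm ?sqr_ge0// lerDl sqr_ge0.
  by move=> t _; rewrite ger0_norm ?sqr_ge0// lerDr sqr_ge0.
split; first by split.
have /integrableP[_] := itgD ir ii; apply: le_lt_trans => /=.
rewrite le_eqVlt; apply/orP; left; apply/eqP.
apply: eq_integral => t _ /=; rewrite Re_norm_sqr ger0_norm//.
by rewrite addr_ge0 ?sqr_ge0.
Qed.

Lemma measurable_circleM f g :
  measurable_circle f -> measurable_circle g -> measurable_circle (f \* g).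
Proof.
move=> [fr fi] [gr gi]; split => /=.
  under eq_fun do rewrite ReM.
  by apply: measurable_funB; exact: measurable_funM.
under eq_fun do rewrite ImM.
by apply: measurable_funD; exact: measurable_funM.
Qed.

Lemma measurable_circleJ f :
  measurable_circle f -> measurable_circle (fun z => Num.conj (f z)).
Proof.
move=> [fr fi]; split => /=; first by under eq_fun do rewrite ReJ.
by under eq_fun do rewrite ImJ; exact: measurableT_comp.
Qed.

Lemma measurable_circle_cst (c : C) : measurable_circle (cst c).
Proof. by split; exact: measurable_cst. Qed.

Lemma citg_measurable f : citg f -> measurable_circle f.
Proof. by move=> [? ?]; split; exact: itg_measurable. Qed.

Lemma citgD f g : citg f -> citg g -> citg (f \+ g).
Proof.
move=> [fr fi] [gr gi]; split.
  by rewrite /rpart /=; under eq_fun do rewrite ReD; exact: itgD.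
by rewrite /ipart /=; under eq_fun do rewrite ImD; exact: itgD.
Qed.

Lemma citgZ (a : C) f : citg f -> citg (a \*o f).
Proof.
move=> [fr fi]; split.
  by rewrite /rpart /=; under eq_fun do rewrite ReM; apply: itgB; exact: itgZ.
by rewrite /ipart /=; under eq_fun do rewrite ImM; apply: itgD; exact: itgZ.
Qed.

Lemma circle_intE f : circle_int f =
  ((2 * pi)^-1 * aint (rpart f)) +i* ((2 * pi)^-1 * aint (ipart f)).
Proof. by []. Qed.

Lemma circle_intD f g : citg f -> citg g ->
  circle_int (f \+ g) = circle_int f + circle_int g.
Proof.
move=> [fr fi] [gr gi]; rewrite !circle_intE.
rewrite (@eq_aint _ (rpart _) (fun t => rpart f t + rpart g t)); last first.
  by move=> t _; rewrite /rpart /= ReD.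
rewrite (@eq_aint _ (ipart _) (fun t => ipart f t + ipart g t)); last first.
  by move=> t _; rewrite /ipart /= ImD.
by rewrite !aintD//; simpc; rewrite !mulrDr.
Qed.

Lemma circle_intZ (a : C) f : citg f ->
  circle_int (a \*o f) = a * circle_int f.
Proof.
move=> [fr fi]; case: a => b c; rewrite !circle_intE.
rewrite (@eq_aint _ (rpart _) (fun t => b * rpart f t - c * ipart f t)); last first.
  by move=> t _; rewrite /rpart /= ReM.
rewrite (@eq_aint _ (ipart _) (fun t => b * ipart f t + c * rpart f t)); last first.
  by move=> t _; rewrite /ipart /= ImM.
rewrite aintB ?aintD ?aintZ//; try exact: itgZ.
by apply: complex_eq => /=; ring.
Qed.

Lemma circle_intJ f : citg f ->
  circle_int (fun z => Num.conj (f z)) = Num.conj (circle_int f).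
Proof.
move=> [fr fi]; rewrite conjE !circle_intE /=.
rewrite (@eq_aint _ (rpart _) (rpart f)); last by move=> t _; rewrite /rpart /= ReJ.
rewrite (@eq_aint _ (ipart _) (fun t => - ipart f t)); last first.
  by move=> t _; rewrite /ipart /= ImJ.
by rewrite aintN// mulrN.
Qed.

Lemma eq_circle_int f g : (forall t, arc t -> f (cis t) = g (cis t)) ->
  circle_int f = circle_int g.
Proof.
by move=> fg; rewrite !circle_intE; congr (_ * _ +i* (_ * _));
  apply: eq_aint => t At; rewrite /rpart /ipart fg.
Qed.

Lemma eqm_circle_int f g : measurable_circle f -> measurable_circle g ->
  eqm f g -> circle_int f = circle_int g.
Proof.
move=> [fr fi] [gr gi] fg; rewrite !circle_intE.
by congr (_ * _ +i* (_ * _)); apply: ae_aint => //; apply: ae_imp fg => t h At;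
  have /= := h At; rewrite /rpart /ipart => ->.
Qed.

Lemma eqm_refl f : eqm f f.
Proof. exact: (aeW mu). Qed.

Lemma eqm_sym f g : eqm f g -> eqm g f.
Proof. by apply: ae_imp => t h /h. Qed.

Lemma eqm_trans f g h : eqm f g -> eqm g h -> eqm f h.
Proof. by apply: ae_imp2 => t fg gh At; rewrite fg// gh. Qed.

Lemma eq_eqm f g : (forall t, arc t -> f (cis t) = g (cis t)) -> eqm f g.
Proof. by move=> fg; apply: (aeW mu) => t; exact: fg. Qed.

Lemma eqmD f g f' g' : eqm f f' -> eqm g g' -> eqm (f \+ g) (f' \+ g').
Proof. by apply: ae_imp2 => t h k At; have /= := h At; have /= := k At => -> ->. Qed.

Lemma eqmM f g f' g' : eqm f f' -> eqm g g' -> eqm (f \* g) (f' \* g').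
Proof. by apply: ae_imp2 => t h k At; have /= := h At; have /= := k At => -> ->. Qed.

Lemma eqmJ f f' : eqm f f' ->
  eqm (fun z => Num.conj (f z)) (fun z => Num.conj (f' z)).
Proof. by apply: ae_imp => t h At; have /= := h At => ->. Qed.

Lemma L2D f g : L2 f -> L2 g -> L2 (f \+ g).
Proof.
move=> /L2E[fr fi] /L2E[gr gi]; apply/L2E; split.
  by rewrite /rpart /=; under eq_fun do rewrite ReD; exact: sq_itgD.
by rewrite /ipart /=; under eq_fun do rewrite ImD; exact: sq_itgD.
Qed.

Lemma Linfty_part (phi : fct) : Linfty phi ->
  [/\ measurable_circle phi, exists M : R, \forall t \ae mu, arc t -> `|rpart phi t| <= M
    & exists M : R, \forall t \ae mu, arc t -> `|ipart phi t| <= M].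
Proof.
move=> [mphi [M bM]]; have MM x : `|x| <= M%:C%C ->
    `|complex.Re x| <= M /\ `|complex.Im x| <= M.
  rewrite normc_def lecR => xM.
  by split; apply: le_trans xM; rewrite -sqrtr_sqr ler_wsqrtr// ?lerDl ?lerDr sqr_ge0.
by split=> //; exists M; apply: ae_imp bM => t h /h /MM[].
Qed.

Lemma L2_mul (phi : fct) f : Linfty phi -> L2 f -> L2 (phi \* f).
Proof.
move=> /Linfty_part[[pr pi_] [M bM] [N bN]] /L2E[fr fi]; apply/L2E; split.
  rewrite /rpart /=; under eq_fun do rewrite ReM.
  apply: sq_itgD; first exact: (sq_itg_mul_ae pr bM fr).
  exact/sq_itgN/(sq_itg_mul_ae pi_ bN fi).
rewrite /ipart /=; under eq_fun do rewrite ImM.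
apply: sq_itgD; first exact: (sq_itg_mul_ae pr bM fi).
exact: (sq_itg_mul_ae pi_ bN fr).
Qed.

Lemma L2Z (a : C) f : L2 f -> L2 (a \*o f).
Proof.
move=> f2; apply: (@L2_mul (cst a)) => //; split; first exact: measurable_circle_cst.
have E : `|a| = (complex.Re `|a|)%:C%C by rewrite normc_def.
by exists (complex.Re `|a|); apply: (aeW mu) => t _; rewrite -E.
Qed.

Lemma L2N f : L2 f -> L2 (\- f).
Proof.
have -> : \- f = (-1 : C) \*o f by apply/funext => z /=; rewrite mulN1r.
exact: L2Z.
Qed.

Lemma L2B f g : L2 f -> L2 g -> L2 (f \- g).
Proof. by move=> f2 /L2N; exact: L2D. Qed.

Lemma L2J f : L2 f -> L2 (fun z => Num.conj (f z)).
Proof.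
move=> /L2E[fr fi]; apply/L2E; split; first by rewrite /rpart; under eq_fun do rewrite ReJ.
by rewrite /ipart; under eq_fun do rewrite ImJ; exact: sq_itgN.
Qed.

Lemma citgM f g : L2 f -> L2 g -> citg (f \* g).
Proof.
move=> /L2E[fr fi] /L2E[gr gi]; split.
  by rewrite /rpart /=; under eq_fun do rewrite ReM; apply: itgB; exact: sq_itgM.
by rewrite /ipart /=; under eq_fun do rewrite ImM; apply: itgD; exact: sq_itgM.
Qed.

Lemma citg_dot f g : L2 f -> L2 g -> citg (fun z => f z * Num.conj (g z)).
Proof. by move=> f2 /L2J; exact: citgM. Qed.

Lemma dotDl f g h : L2 f -> L2 g -> L2 h -> dot (f \+ g) h = dot f h + dot g h.
Proof.
move=> f2 g2 h2; rewrite /dot -circle_intD; try exact: citg_dot.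
by apply: eq_circle_int => t _ /=; rewrite mulrDl.
Qed.

Lemma dotZl (a : C) f h : L2 f -> L2 h -> dot (a \*o f) h = a * dot f h.
Proof.
move=> f2 h2; rewrite /dot -circle_intZ; last exact: citg_dot.
by apply: eq_circle_int => t _ /=; rewrite mulrA.
Qed.

Lemma dotC f g : L2 f -> L2 g -> dot g f = Num.conj (dot f g).
Proof.
move=> f2 g2; rewrite /dot -circle_intJ; last exact: citg_dot.
by apply: eq_circle_int => t _ /=; rewrite rmorphM/= conjCK mulrC.
Qed.

Lemma dotNl f h : L2 f -> L2 h -> dot (\- f) h = - dot f h.
Proof.
move=> f2 h2; rewrite -mulN1r -dotZl//.
by apply: eq_circle_int => t _ /=; rewrite mulN1r.
Qed.

Lemma dotBl f g h : L2 f -> L2 g -> L2 h -> dot (f \- g) h = dot f h - dot g h.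
Proof. by move=> f2 g2 h2; rewrite (dotDl f2 (L2N g2) h2) dotNl. Qed.

Lemma dotDr f g h : L2 f -> L2 g -> L2 h -> dot f (g \+ h) = dot f g + dot f h.
Proof.
move=> f2 g2 h2; rewrite (dotC (L2D g2 h2) f2) dotDl// rmorphD/=.
by rewrite -!dotC.
Qed.

Lemma dotBr f g h : L2 f -> L2 g -> L2 h -> dot f (g \- h) = dot f g - dot f h.
Proof.
move=> f2 g2 h2; rewrite (dotC (L2B g2 h2) f2) dotBl// rmorphB/=.
by rewrite -!dotC.
Qed.

Lemma dotZr (a : C) f h : L2 f -> L2 h -> dot f (a \*o h) = Num.conj a * dot f h.
Proof. by move=> f2 h2; rewrite (dotC (L2Z a h2) f2) dotZl// rmorphM/= -dotC. Qed.

Lemma dot_eqm f f' g g' : L2 f -> L2 f' -> L2 g -> L2 g' ->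
  eqm f f' -> eqm g g' -> dot f g = dot f' g'.
Proof.
move=> f2 f2' g2 g2' ff gg; apply: eqm_circle_int.
- by apply: citg_measurable; exact: citg_dot.
- by apply: citg_measurable; exact: citg_dot.
- exact: (eqmM ff (eqmJ gg)).
Qed.

Lemma dot_self f : L2 f ->
  dot f f = ((2 * pi)^-1 * aint (fun t => rpart f t ^+ 2 + ipart f t ^+ 2))%:C%C.
Proof.
move=> f2; rewrite /dot circle_intE; apply: complex_eq => /=.
  by congr (_ * _); apply: eq_aint => t _; rewrite /rpart ReM ReJ ImJ /ipart; ring.
rewrite (@eq_aint _ _ (cst 0)) ?aint_cst ?mul0r ?mulr0// => t _.
by rewrite /ipart ImM ReJ ImJ; rewrite /cst; ring.
Qed.

Lemma dot_ge0 f : L2 f -> 0 <= dot f f.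
Proof.
move=> f2; rewrite dot_self// lecR mulr_ge0// ?invr_ge0 ?mulr_ge0 ?pi_ge0//.
by apply: aint_ge0 => t _; rewrite addr_ge0 ?sqr_ge0.
Qed.

Lemma dot_eq0 f : L2 f -> dot f f = 0 -> eqm f (cst 0).
Proof.
move=> f2; rewrite dot_self// => -[] /eqP.
rewrite mulf_eq0 invr_eq0 (gt_eqF (_ : 0 < 2 * pi)) ?mulr_gt0 ?pi_gt0//= => /eqP f0.
have /L2E[[_ ir] [_ ii]] := f2.
have := aint_eq0 (itgD ir ii) (fun t _ => addr_ge0 (sqr_ge0 _) (sqr_ge0 _)) f0.
apply: ae_imp => t h At; have /eqP := h At; rewrite paddr_eq0 ?sqr_ge0// !sqrf_eq0.
by move=> /andP[/eqP fr /eqP fi]; apply: complex_eq.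
Qed.

Lemma eqm_dot f g : L2 f -> L2 g -> dot (f \- g) (f \- g) = 0 -> eqm f g.
Proof.
move=> f2 g2 /(dot_eq0 (L2B f2 g2)).
by apply: ae_imp => t h At; have /= := h At => /subr0_eq.
Qed.

Lemma dot_mul (phi f g : fct) :
  dot (phi \* f) g = dot f ((fun z => Num.conj (phi z)) \* g).
Proof. by apply: eq_circle_int => t _ /=; rewrite rmorphM/= conjCK mulrCA mulrA. Qed.

Lemma cisN t : cis (- t) = Num.conj (cis t) :> C.
Proof. by rewrite conjE /cis cosN sinN. Qed.

Lemma cis_norm t : cis t * Num.conj (cis t) = 1 :> C.
Proof.
by rewrite conjE; apply: complex_eq; rewrite ?ReM ?ImM /=; [rewrite mulrN opprK -!expr2 cos2Dsin2|ring].
Qed.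

Lemma cisV t : (cis t)^-1 = Num.conj (cis t) :> C.
Proof.
have h := cis_norm t; apply: (mulfI (_ : cis t != 0)); last rewrite h divff//;
by apply: contra_eq_neq h => ->; rewrite mul0r eq_sym oner_eq0.
Qed.

Lemma norm_cis t : `|cis t| = 1 :> C.
Proof. by rewrite normc_def /= cos2Dsin2 sqrtr1. Qed.

Lemma circle_int_arcN f : citg f -> circle_int (fun z => f (Num.conj z)) = circle_int f.
Proof.
move=> [fr fi]; rewrite !circle_intE -(aint_arcN fr) -(aint_arcN fi).
by congr (_ * _ +i* (_ * _)); apply: eq_aint => t _; rewrite /rpart /ipart cisN.
Qed.

Lemma Linfty_bounded f (M : R) : measurable_circle f ->
  (forall t, arc t -> `|f (cis t)| <= M%:C%C) -> Linfty f.
Proof. by move=> mf fM; split=> //; exists M; exact: (aeW mu). Qed.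

Lemma measurable_circle_id : measurable_circle (fun z : C => z).
Proof.
split; apply: measurable_funTS; apply: continuous_measurable_fun.
  exact: continuous_cos.
exact: continuous_sin.
Qed.

Lemma Linfty_id : Linfty (fun z : C => z).
Proof.
apply: (@Linfty_bounded _ 1); first exact: measurable_circle_id.
by move=> t _; rewrite norm_cis.
Qed.

Lemma LinftyJ f : Linfty f -> Linfty (fun z => Num.conj (f z)).
Proof.
move=> [mf [M fM]]; split; first exact: measurable_circleJ.
by exists M; apply: ae_imp fM => t h /h; rewrite norm_conjC.
Qed.

Lemma L2_cst (c : C) : L2 (cst c).
Proof.
apply/L2E; split.
  by apply: (@sq_itg_bounded _ _ `|complex.Re c|) => //; exact: measurable_cst.
by apply: (@sq_itg_bounded _ _ `|complex.Im c|) => //; exact: measurable_cst.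
Qed.

Lemma Linfty_L2 f : Linfty f -> L2 f.
Proof.
move=> /L2_mul /(_ (L2_cst 1)).
by have -> : f \* cst 1 = f by apply/funext => z /=; rewrite mulr1.
Qed.

Lemma L2_flipJ f : L2 f -> L2 (flipJ f).
Proof.
move=> f2; apply: (@L2_mul (fun z => Num.conj z) (fun z => f (Num.conj z))).
  exact: LinftyJ Linfty_id.
move/L2E: f2 => [fr fi]; apply/L2E; split; rewrite /rpart /ipart;
  under eq_fun do rewrite -cisN.
  exact: (sq_itg_arcN fr).
exact: (sq_itg_arcN fi).
Qed.

(** J is self-adjoint: substitute z^* for z in the mean. *)
Lemma dot_flipJ f g : L2 f -> L2 g -> dot (flipJ f) g = dot f (flipJ g).
Proof.
move=> f2 g2; rewrite /dot -circle_int_arcN; last exact/citg_dot/g2/L2_flipJ.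
by apply: eq_circle_int => t _; rewrite /flipJ !rmorphM/= !conjCK; ring.
Qed.

End Circle.

(** * Completeness of real L^2 *)

Section RieszFischer.
Variable R : realType.
Local Notation mu := (@lebesgue_measure R).
Local Notation arc := (@Defs.arc R).
Hint Resolve measurable_arc : core.

Lemma sq_itgB (u v : R -> R) : sq_itg u -> sq_itg v -> sq_itg (fun t => u t - v t).
Proof. by move=> su sv; apply: sq_itgD su (sq_itgN sv). Qed.

Lemma summable_increments_cvg (u : nat -> R) :
  (\sum_(0 <= k <oo) (`|u k.+1 - u k|)%:E < +oo)%E -> cvgn u.
Proof.
move=> fin.
have cs : cvgn (series (telescope u)).
  apply: normed_cvg.
  apply: nondecreasing_is_cvgn.
    by apply: nondecreasing_series => n _ _; exact: normr_ge0.
  exists (fine (\sum_(0 <= k <oo) (`|u k.+1 - u k|)%:E)%E) => _ [n _ <-].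
  rewrite -lee_fin fineK; last first.
    by rewrite ge0_fin_numE//; apply: nneseries_ge0 => k _ _; rewrite lee_fin.
  rewrite /series /= -sumEFin; apply: nneseries_lim_ge => k _ _.
  by rewrite lee_fin.
have -> : u = (fun n => series (telescope u) n + u 0%N).
  by apply/funext => n; rewrite telescopeK subrK.
by apply: is_cvgD => //; exact: is_cvg_cst.
Qed.

Lemma limn_einf_ub (a : nat -> \bar R) n B :
  (forall m, (n <= m)%N -> (a m <= B)%E) -> (limn_einf a <= B)%E.
Proof.
move=> aB; rewrite limn_einf_lim; apply: lime_le; first exact: is_cvg_einfs.
apply: nearW => k; rewrite /einfs /=.
apply: (@le_trans _ _ (a (maxn n k))); last by apply: aB; exact: leq_maxl.
by apply: ereal_inf_lbound; exists (maxn n k) => //=; exact: leq_maxr.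
Qed.

(** By Young's inequality, with the weights 2^n balancing the quadratic decay
    4^-n, the increments are summable in L^1, hence almost everywhere; Fatou's
    lemma carries the Cauchy estimates to the limit.  The limit is taken
    through limn_esup, which is defined and measurable without knowing where
    the sequence converges. *)
Lemma riesz_fischer (u : nat -> R -> R) (K : R) : (forall n, sq_itg (u n)) ->
  (forall n m, (n <= m)%N -> aint (fun t => (u m t - u n t) ^+ 2) <= K / 4 ^+ n) ->
  let v t := fine (limn_esup (fun n => (u n t)%:E)) in
  sq_itg v /\ forall n, aint (fun t => (v t - u n t) ^+ 2) <= K / 4 ^+ n.
Proof.
move=> su cu v.
have mu_ n : measurable_fun arc (u n) by case: (su n).
pose e n t := `|u n.+1 t - u n t|.
have me n : measurable_fun arc (e n).
  by apply: measurableT_comp => //; exact: measurable_funB.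
have sB n m := sq_itgB (su n) (su m).
have i2 n : itg (fun t => 2^-1 * (2 ^+ n * (u n.+1 t - u n t) ^+ 2 + (2 ^+ n)^-1)).
  apply/itgZ/itgD; first by apply: itgZ; have [] := sB n.+1 n.
  exact: (@itg_bounded _ (cst (2 ^+ n)^-1) `|(2 ^+ n)^-1|).
have young n t : e n t <= 2^-1 * (2 ^+ n * (u n.+1 t - u n t) ^+ 2 + (2 ^+ n)^-1).
  rewrite -(real_normK (num_real (u n.+1 t - u n t))) -/(e n t).
  have p2 : 0 < (2 : R) ^+ n by rewrite exprn_gt0.
  rewrite -subr_ge0 (_ : _ - _ = 2^-1 * ((2 ^+ n)^-1 * (2 ^+ n * e n t - 1) ^+ 2)).
    apply: mulr_ge0; first by rewrite invr_ge0.
    by apply: mulr_ge0; [rewrite invr_ge0 ltW|exact: sqr_ge0].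
  by field; rewrite gt_eqF.
have ie n : itg (e n).
  by apply: (le_itg (me n) _ (i2 n)) => t _; rewrite /e normr_id; exact: young.
pose K' := K + 2 * pi.
have be n : aint (e n) <= K' / (2 ^+ n.+1).
  apply: (le_trans (le_aint (ie n) (i2 n) (fun t _ => young n t))).
  have iA : itg (fun t => 2 ^+ n * (u n.+1 t - u n t) ^+ 2).
    by apply: itgZ; have [] := sB n.+1 n.
  have iC : itg (fun t : R => (2 ^+ n)^-1) by exact: (@itg_bounded _ (cst (2 ^+ n)^-1) `|(2 ^+ n)^-1|).
  rewrite aintZ; last exact: itgD.
  rewrite aintD// aintZ; last by have [] := sB n.+1 n.
  rewrite (aint_cst (2 ^+ n)^-1).
  have c4 : (4 : R) ^+ n = 2 ^+ n * 2 ^+ n by rewrite -exprMn; congr (_ ^+ _); ring.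
  have p2 : 0 < (2 : R) ^+ n by rewrite exprn_gt0.
  have := cu n n.+1 (leqnSn n).
  rewrite -(ler_pM2l p2) => h.
  have -> : K' / 2 ^+ n.+1 = 2^-1 * (2 ^+ n * (K / 4 ^+ n) + (2 ^+ n)^-1 * (2 * pi)).
    by rewrite c4 exprS /K'; field; rewrite gt_eqF.
  by rewrite ler_wpM2l// lerD2r.
have K0 : 0 <= K'.
  have : 0 <= K' / 2 ^+ 1 by apply: le_trans (be 0%N); apply: aint_ge0 => t _; exact: normr_ge0.
  by rewrite pmulr_lge0.
have aee : \forall t \ae mu, arc t -> cvgn (fun n => u n t).
  have fin : (\int[mu]_(t in arc) (\sum_(0 <= k <oo) (e k t)%:E) < +oo)%E.
    rewrite integral_nneseries//; last first.
    - by move=> n t _; rewrite lee_fin normr_ge0.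
    - by move=> n; apply/measurable_EFinP; exact: me.
    apply: (@le_lt_trans _ _ K'%:E); last exact: ltry.
    apply: le_trans (epsilon_trick0 xpredT K0).
    apply: lee_nneseries => [n _ _|n _].
      by apply: integral_ge0 => t _; rewrite lee_fin normr_ge0.
    rewrite -(fineK (integrable_fin_num (@measurable_arc R) (ie n))) lee_fin natrX.
    exact: be.
  have meas : measurable_fun arc (fun t => \sum_(0 <= k <oo) (e k t)%:E)%E.
    apply: ge0_emeasurable_sum => //.
    - by move=> n t _ _; rewrite lee_fin normr_ge0.
    - by move=> n _; apply/measurable_EFinP; exact: me.
  have : mu.-integrable arc (fun t => \sum_(0 <= k <oo) (e k t)%:E)%E.
    apply/integrableP; split=> //; apply: le_lt_trans fin.
    rewrite le_eqVlt; apply/orP; left; apply/eqP; apply: eq_integral => t _.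
    by rewrite gee0_abs//; apply: nneseries_ge0 => k _ _; rewrite lee_fin normr_ge0.
  move=> /(integrable_ae (@measurable_arc R)); apply: ae_imp => t h At.
  apply: summable_increments_cvg; have := h At; rewrite ge0_fin_numE//.
  by apply: nneseries_ge0 => k _ _; rewrite lee_fin normr_ge0.
have mv : measurable_fun arc v.
  apply: (@measurableT_comp _ _ _ _ _ _ fine); first exact: fine_measurable.
  by apply: measurable_fun_limn_esup => n; apply/measurable_EFinP; exact: mu_.
have uv : \forall t \ae mu, arc t -> u n t @[n --> \oo] --> v t.
  apply: ae_imp aee => t h At; have c := h At.
  have l : (u n t)%:E @[n --> \oo] --> (limn (fun n => u n t))%:E.
    by apply/fine_cvgP; split; [exact: nearW|].
  by rewrite /v (cvg_limn_einf_sup l).2.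
have mvu n : measurable_fun arc (fun t => (v t - u n t) ^+ 2).
  by apply: measurable_funX; apply: measurable_funB => //; exact: mu_.
have muu m n : measurable_fun arc (fun t => (u m t - u n t) ^+ 2).
  by apply: measurable_funX; apply: measurable_funB; exact: mu_.
have fatou_v n : (\int[mu]_(t in arc) ((v t - u n t) ^+ 2)%:E <= (K / 4 ^+ n)%:E)%E.
  apply: (@le_trans _ _ (\int[mu]_(t in arc)
      limn_einf (fun m => ((u m t - u n t) ^+ 2)%:E))%E).
    rewrite le_eqVlt; apply/orP; left; apply/eqP; apply: ae_eq_integral => //.
    - by apply/measurable_EFinP; exact: mvu.
    - have H m : measurable_fun arc (fun t => ((u m t - u n t) ^+ 2)%:E).
        by apply/measurable_EFinP; exact: muu.
      apply: (eq_measurable_fun (fun t => - limn_esup (fun m => - ((u m t - u n t) ^+ 2)%:E))%E).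
        by [].
      apply: measurableT_comp => //; apply: measurable_fun_limn_esup => m.
      by apply: measurableT_comp => //; exact: H.
    apply: ae_imp uv => t h At.
    have l : ((u m t - u n t) ^+ 2)%:E @[m --> \oo] --> ((v t - u n t) ^+ 2)%:E.
      apply/fine_cvgP; split; first exact: nearW.
      rewrite expr2; under eq_fun do rewrite /= expr2.
      by apply: cvgM; (apply: cvgB; [exact: h|exact: cvg_cst]).
    by rewrite (cvg_limn_einf_sup l).1.
  apply: le_trans (fatou mu (@measurable_arc R) _ _) _.
  - by move=> m; apply/measurable_EFinP; exact: muu.
  - by move=> m t _; rewrite lee_fin sqr_ge0.
  apply: (@limn_einf_ub _ n) => m nm.
  have [_ i_mn] := sB m n.
  by rewrite -(fineK (integrable_fin_num (@measurable_arc R) i_mn)) lee_fin; exact: cu.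
have svu n : sq_itg (fun t => v t - u n t).
  split; first by apply: measurable_funB => //; exact: mu_.
  apply/integrableP; split.
    by apply/measurable_EFinP; exact: mvu.
  apply: (@le_lt_trans _ _ (K / 4 ^+ n)%:E); last exact: ltry.
  apply: le_trans (fatou_v n); rewrite le_eqVlt; apply/orP; left; apply/eqP.
  by apply: eq_integral => t _ /=; rewrite ger0_norm// sqr_ge0.
split.
  (* v itself is square-integrable because v - u 0 is. *)
  have -> : v = (fun t => (v t - u 0%N t) + u 0%N t) by apply/funext => t; rewrite subrK.
  exact: sq_itgD.
move=> n; have [_ i_n] := svu n; have := fatou_v n.
by rewrite -(fineK (integrable_fin_num (@measurable_arc R) i_n)) lee_fin.
Qed.

End RieszFischer.

(** * Orthogonal projections in L^2 *)

Section Projection.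
Variable R : realType.
Local Notation C := (R[i]).
Local Notation fct := (C -> C).
Implicit Types (f g h a b : fct) (M N : set fct).

Definition normsq f : R := complex.Re (dot f f).
Definition abssq (w : C) : R := complex.Re w ^+ 2 + complex.Im w ^+ 2.

Lemma abssq_ge0 w : 0 <= abssq w.
Proof. by rewrite addr_ge0 ?sqr_ge0. Qed.

Lemma abssq_eq0 w : abssq w = 0 -> w = 0.
Proof.
by move=> /eqP; rewrite paddr_eq0 ?sqr_ge0// !sqrf_eq0 => /andP[/eqP ? /eqP ?];
  exact: complex_eq.
Qed.

Lemma mul_conj_abssq w : w * Num.conj w = (abssq w)%:C.
Proof. by rewrite conjE; case: w => u v; rewrite /abssq; apply: complex_eq; rewrite ?ReM ?ImM /=; ring. Qed.

Lemma normsqE f : L2 f -> dot f f = (normsq f)%:C.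
Proof. by move=> f2; rewrite /normsq dot_self. Qed.

Lemma normsq_aint f : L2 f ->
  normsq f = (2 * pi)^-1 * aint (fun t => rpart f t ^+ 2 + ipart f t ^+ 2).
Proof. by move=> f2; rewrite /normsq dot_self. Qed.

Lemma normsq_ge0 f : L2 f -> 0 <= normsq f.
Proof. by move=> f2; have := dot_ge0 f2; rewrite normsqE// lecR. Qed.

Lemma eq_normsq f g : (forall z, f z = g z) -> normsq f = normsq g.
Proof. by move=> /funext ->. Qed.

Lemma normsq_sub_proj a b (t : R) : L2 a -> L2 b ->
  normsq (a \- ((t%:C * dot a b) \*o b)) =
    normsq a - 2 * t * abssq (dot a b) + t ^+ 2 * abssq (dot a b) * normsq b.
Proof.
move=> a2 b2; set w := dot a b; set c := t%:C * w.
have cb2 := L2Z c b2; have acb2 := L2B a2 cb2.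
have -> : normsq (a \- (c \*o b)) = complex.Re (dot a a - Num.conj c * w - c * Num.conj w
    + (c * Num.conj c) * dot b b).
  rewrite /normsq dotBl// !dotBr// !dotZl// !dotZr// (dotC a2 b2) -/w.
  by congr complex.Re; ring.
have cJ : Num.conj c = t%:C * Num.conj w by rewrite conjM conjR.
rewrite !normsqE// cJ /c.
have -> : t%:C * Num.conj w * w = (t * abssq w)%:C.
  by rewrite -mulrA [_ * w]mulrC mul_conj_abssq rmorphM.
have -> : t%:C * w * Num.conj w = (t * abssq w)%:C.
  by rewrite -mulrA mul_conj_abssq rmorphM.
have -> : t%:C * w * (t%:C * Num.conj w) * (normsq b)%:C = (t ^+ 2 * abssq w * normsq b)%:C.
  by rewrite [RHS]rmorphM/= [X in _ = X * _]rmorphM/= -mul_conj_abssq rmorphXn/=; ring.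
by rewrite ReD !ReD !ReN /=; ring.
Qed.

(** A vector that is within e of being the shortest one in a + C b is almost
    orthogonal to b.  Testing with c = dot a b / (normsq b + 1) rather than with
    the optimal c = dot a b / normsq b avoids a case distinction on b = 0, and
    any constant factor is good enough for passing to limits. *)
Lemma dot_le_near_min a b (e : R) : L2 a -> L2 b ->
  (forall c : C, normsq a - e <= normsq (a \- (c \*o b))) ->
  abssq (dot a b) <= e * (normsq b + 1).
Proof.
move=> a2 b2 amin.
have b0 := normsq_ge0 b2; have b1 : 0 < normsq b + 1 by lra.
have := amin ((normsq b + 1)^-1%:C * dot a b); rewrite normsq_sub_proj//.
set t := (normsq b + 1)^-1; set s := abssq _ => h.
have t0 : 0 < t by rewrite invr_gt0.
have tb : t * normsq b <= 1.
  by rewrite /t mulrC ler_pdivrMr// mul1r; lra.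
have s0 : 0 <= s by exact: abssq_ge0.
have : t * s <= e by have : t * s * (t * normsq b) <= t * s * 1; [apply: ler_wpM2l => //; apply: mulr_ge0 => //; exact: ltW|nra].
by rewrite /t mulrC ler_pdivrMr.
Qed.

(** The case e = normsq a of the previous lemma; its constant is normsq b + 1
    instead of normsq b, which suffices for continuity of the inner product. *)
Lemma cauchy_schwarz_weak a b : L2 a -> L2 b -> abssq (dot a b) <= normsq a * (normsq b + 1).
Proof.
move=> a2 b2; apply: dot_le_near_min => // c; rewrite subrr.
by apply: normsq_ge0; apply: L2B => //; exact: L2Z.
Qed.

Lemma parallelogram a b : L2 a -> L2 b ->
  normsq (a \+ b) + normsq (a \- b) = 2 * normsq a + 2 * normsq b.
Proof.
move=> a2 b2; have sab := L2D a2 b2; have dab := L2B a2 b2.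
rewrite /normsq -!ReD (dotDl a2 b2 sab) (dotBl a2 b2 dab) (dotDr a2 a2 b2) (dotDr b2 a2 b2).
rewrite (dotBr a2 a2 b2) (dotBr b2 a2 b2).
rewrite (_ : _ + _ = dot a a + dot a a + (dot b b + dot b b)); last by ring.
by rewrite !ReD; ring.
Qed.

Lemma normsqZ (c : C) f : L2 f -> normsq (c \*o f) = abssq c * normsq f.
Proof.
move=> f2; have cf2 := L2Z c f2; rewrite /normsq dotZl// dotZr// mulrA mul_conj_abssq.
by rewrite ReM /= mul0r subr0.
Qed.

Lemma normsqD_le a b : L2 a -> L2 b -> normsq (a \+ b) <= 2 * normsq a + 2 * normsq b.
Proof.
by move=> a2 b2; rewrite -parallelogram// lerDl; exact/normsq_ge0/L2B.
Qed.

Lemma L2_complete (g : nat -> fct) (K : R) : (forall n, L2 (g n)) ->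
  (forall n m, (n <= m)%N -> normsq (g m \- g n) <= K / 4 ^+ n) ->
  exists2 v, L2 v & forall n, normsq (v \- g n) <= (2 * K) / 4 ^+ n.
Proof.
move=> g2 cg.
have gr n : sq_itg (rpart (g n)) by have /L2E[] := g2 n.
have gi n : sq_itg (ipart (g n)) by have /L2E[] := g2 n.
have p0 : 0 < 2 * pi :> R by rewrite mulr_gt0 ?pi_gt0.
have normsqB f h : L2 f -> L2 h -> normsq (f \- h) = (2 * pi)^-1 *
    (aint (fun t => (rpart f t - rpart h t) ^+ 2) + aint (fun t => (ipart f t - ipart h t) ^+ 2)).
  move=> f2 h2; have fh2 := L2B f2 h2.
  have /L2E[fr fi] := f2; have /L2E[hr hi] := h2.
  rewrite normsq_aint// -aintD; last by have [] := sq_itgB fi hi.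
    congr (_ * _); apply: eq_aint => t _.
    by rewrite /rpart /ipart /= ReD ImD ReN ImN.
  by have [] := sq_itgB fr hr.
have bnd n m : (n <= m)%N ->
    aint (fun t => (rpart (g m) t - rpart (g n) t) ^+ 2) <= (2 * pi * K) / 4 ^+ n /\
    aint (fun t => (ipart (g m) t - ipart (g n) t) ^+ 2) <= (2 * pi * K) / 4 ^+ n.
  move=> /cg; rewrite normsqB// mulrC ler_pdivrMr// mulrAC [K * _]mulrC => h.
  split; apply: le_trans h; rewrite ?lerDl ?lerDr; apply: aint_ge0 => t _; exact: sqr_ge0.
have /= [vr2 hr] := riesz_fischer gr (fun n m nm => (bnd n m nm).1).
have /= [vi2 hi] := riesz_fischer gi (fun n m nm => (bnd n m nm).2).

pose v z := fine (limn_esup (fun n => (complex.Re (g n z))%:E)) +i*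
            fine (limn_esup (fun n => (complex.Im (g n z))%:E)).
have v2 : L2 v by apply/L2E; split.
exists v => // n; rewrite normsqB// mulrC ler_pdivrMr//.
have hr_ : aint (fun t => (rpart v t - rpart (g n) t) ^+ 2) <= 2 * pi * K / 4 ^+ n := hr n.
have hi_ : aint (fun t => (ipart v t - ipart (g n) t) ^+ 2) <= 2 * pi * K / 4 ^+ n := hi n.
apply: (le_trans (lerD hr_ hi_)).
by rewrite le_eqVlt; apply/orP; left; apply/eqP; ring.
Qed.

Lemma orth_L2 M f : orth M f -> L2 f.
Proof. by case. Qed.

Lemma L2_0 : L2 (\0 : fct).
Proof. exact: (L2_cst (0 : C)). Qed.

Lemma dot0l f : L2 f -> dot \0 f = 0.
Proof.
move=> f2; have -> : (\0 : fct) = (0 : C) \*o (\0 : fct).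
  by apply/funext => z /=; rewrite mul0r.
by rewrite (dotZl 0 L2_0 f2) mul0r.
Qed.

Section Orth.
Variable N : set fct.
Hypothesis N2 : N `<=` @L2 R.

Lemma orth0 : orth N \0.
Proof. by split; [exact: L2_0|move=> g /N2; exact: dot0l]. Qed.

Lemma orthD f g : orth N f -> orth N g -> orth N (f \+ g).
Proof.
move=> [f2 fN] [g2 gN]; split; first exact: L2D.
by move=> h Nh; rewrite dotDl ?fN ?gN ?addr0//; exact: N2.
Qed.

Lemma orthZ (c : C) f : orth N f -> orth N (c \*o f).
Proof.
move=> [f2 fN]; split; first exact: L2Z.
by move=> h Nh; rewrite dotZl ?fN ?mulr0//; exact: N2.
Qed.

Lemma orthB f g : orth N f -> orth N g -> orth N (f \- g).
Proof.
move=> [f2 fN] [g2 gN]; split; first exact: L2B.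
by move=> h Nh; rewrite dotBl ?fN ?gN ?subr0//; exact: N2.
Qed.

(** The projection is the limit of a minimising sequence, which is Cauchy by
    the parallelogram law; [dot_le_near_min] turns near-minimality into
    orthogonality in the limit. *)
Lemma exists_proj f : L2 f -> exists g, orth N g /\ orth (orth N) (f \- g).
Proof.
move=> f2.
(* The tolerance 4^-n at step n is the rate that [L2_complete] asks for. *)
pose A := [set normsq (f \- g) | g in orth N].
have A0 : A !=set0 by exists (normsq (f \- \0)), \0 => //; exact: orth0.
have lbA : lbound A 0 by move=> _ [g [g2 _] <-]; exact/normsq_ge0/L2B.
have infA : has_inf A by split=> //; exists 0.
have dlb g : orth N g -> inf A <= normsq (f \- g).
  by move=> Ng; apply: ge_inf; [exists 0|exists g].
have /choice[g gP] : forall n, exists g, orth N g /\ normsq (f \- g) <= inf A + (4 ^+ n)^-1.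
  move=> n; have e0 : 0 < (4 ^+ n)^-1 :> R by rewrite invr_gt0 exprn_gt0.
  by have [_ [h Nh <-] lt] := inf_adherent e0 infA; exists h; split=> //; exact: ltW.
have gN n := (gP n).1; have gm n := (gP n).2.
have g2 n : L2 (g n) by case: (gN n).
have fg2 n : L2 (f \- g n) by exact: L2B.
have cg n m : (n <= m)%N -> normsq (g m \- g n) <= 4 / 4 ^+ n.
  move=> nm.
  have := parallelogram (fg2 n) (fg2 m).
  rewrite (@eq_normsq ((f \- g n) \- (f \- g m)) (g m \- g n)); last first.
    by move=> z /=; ring.
  rewrite (@eq_normsq ((f \- g n) \+ (f \- g m))
      (2%:C \*o (f \- (2^-1%:C \*o (g n \+ g m))))); last first.
    move=> z /=; rewrite (_ : 2%:C = 2)//; last by rewrite -[2 in RHS](rmorph_nat (real_complex R)).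
    have -> : (2^-1%:C : C) = 2^-1.
      by rewrite -[in RHS](rmorph_nat (real_complex R) 2) -fmorphV.
    by field.
  have Nh : orth N (2^-1%:C \*o (g n \+ g m)) by apply: orthZ; exact: orthD.
  rewrite normsqZ; last by apply: L2B => //; case: Nh.
  have := dlb _ Nh; have := gm n; have := gm m; rewrite /abssq /=.
  have : (4 ^+ m)^-1 <= (4 ^+ n)^-1 :> R.
    by rewrite lef_pV2 ?posrE ?exprn_gt0// ler_weXn2l// ler1n.
  by nra.
have [v v2 gv] := L2_complete g2 cg.
have lim0 (x B : R) : 0 <= x -> (forall n, x <= B / 4 ^+ n) -> x = 0.
  move=> x0 xB; apply/eqP; rewrite eq_le x0 andbT.
  apply/ler_addgt0Pr => e e0; rewrite add0r.
  have B0 : 0 <= B by have := le_trans x0 (xB 0%N); rewrite expr0 divr1.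
  pose n := Num.truncn (B / e).
  apply: le_trans (xB n) _; rewrite ler_pdivrMr ?exprn_gt0//.
  have n4 : n.+1%:R <= 4 ^+ n :> R.
    by rewrite -natrX ler_nat; elim: (n) => // k IH; rewrite expnS;
      apply: leq_ltn_trans IH _; rewrite -[X in (X < _)%N]mul1n ltn_pmul2r ?expn_gt0.
  have : B / e <= n.+1%:R by apply/ltW/truncnS_gt.
  rewrite ler_pdivrMr// => h; apply: le_trans h _.
  by rewrite mulrC ler_pM2l.
have small h (w : nat -> C) : L2 h -> forall x : C,
    (forall n, x = w n + dot (v \- g n) h) ->
    (forall n, abssq (w n) <= (4 ^+ n)^-1 * (normsq h + 1)) -> x = 0.
  move=> h2 x xw wb; apply: abssq_eq0; apply: (lim0 _ (2 * (normsq h + 1) + 2 * (2 * 4) * (normsq h + 1))).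
    exact: abssq_ge0.
  move=> n; have vg2 := L2B v2 (g2 n).
  have h0 := normsq_ge0 h2; have p0 : 0 < (4 ^+ n)^-1 :> R by rewrite invr_gt0 exprn_gt0.
  have cs := cauchy_schwarz_weak vg2 h2.
  have cs' : abssq (dot (v \- g n) h) <= (2 * 4) / 4 ^+ n * (normsq h + 1).
    by apply: le_trans cs _; apply: ler_wpM2r; [lra|exact: gv].
  have := wb n; move: cs'; rewrite (xw n); move: (dot _ _) (w n) => [a b] [c d].
  rewrite /abssq /=; set y := (4 ^+ n)^-1; set q := normsq h + 1 => h1 h3.
  have : (c + a) ^+ 2 + (d + b) ^+ 2 <= 2 * (c ^+ 2 + d ^+ 2) + 2 * (a ^+ 2 + b ^+ 2).
    by have := sqr_ge0 (c - a); have := sqr_ge0 (d - b); nra.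
  lra.
have Nv : orth N v.
  split=> // h Nh; have h2 := N2 Nh.
  apply: (small h (fun=> 0)) => // n.
    by rewrite add0r dotBl// (gN n).2// subr0.
  by rewrite /abssq /= expr0n addr0 mulr_ge0// ?invr_ge0 ?exprn_ge0//; have := normsq_ge0 h2; lra.
exists v; split=> //; split; first exact: L2B.
move=> h Nh; have h2 := orth_L2 Nh.
apply/oppr_inj; rewrite oppr0.
apply: (small h (fun n => - dot (f \- g n) h)) => // n.
  by rewrite !dotBl//; ring.
have -> : abssq (- dot (f \- g n) h) = abssq (dot (f \- g n) h).
  by rewrite /abssq ReN ImN !sqrrN.
apply: dot_le_near_min => // c.
have -> : normsq ((f \- g n) \- (c \*o h)) = normsq (f \- (g n \+ (c \*o h))).
  by apply: eq_normsq => z /=; ring.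
have := dlb _ (orthD (gN n) (orthZ c Nh)); have := gm n; lra.
Qed.

Lemma projP f : L2 f -> orth N (Defs.proj (orth N) f) /\ orth (orth N) (f \- Defs.proj (orth N) f).
Proof.
move=> /exists_proj[g gP]; rewrite /Defs.proj.
by case: xgetP => [h _ //|no]; case: (no g gP).
Qed.

End Orth.
End Projection.

(** * The Cauchy-Goursat theorem for rectangles *)

Section Goursat.
Variable R : realType.
Local Notation mu := (@lebesgue_measure R).
Implicit Types (P Q : R -> R -> R) (f g : R -> R) (a b c d s t x y : R).

Definition segint a b f : R := \int[mu]_(t in `[a, b]) f t.

Definition cont_on a b f := forall x, a <= x <= b -> {for x, continuous f}.

Lemma cont_on_within a b f : cont_on a b f -> {within `[a, b], continuous f}.
Proof.
move=> cf; apply: (@continuous_in_subspaceT _ _ `[a, b]%classic) => x.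
by rewrite inE /= in_itv /= => /cf.
Qed.

Lemma cont_on_integrable a b f : cont_on a b f -> mu.-integrable `[a, b] (EFin \o f).
Proof.
move=> /cont_on_within cf; apply: continuous_compact_integrable => //.
exact: segment_compact.
Qed.

Lemma cont_onB a b f g : cont_on a b f -> cont_on a b g -> cont_on a b (fun t => f t - g t).
Proof. by move=> cf cg x ab; apply: cvgB; [exact: cf|exact: cg]. Qed.

Lemma cont_on_sub a b a' b' f : a <= a' -> b' <= b -> cont_on a b f -> cont_on a' b' f.
Proof. by move=> aa bb cf x /andP[? ?]; apply: cf; lra. Qed.

Lemma segintB a b f g : cont_on a b f -> cont_on a b g ->
  segint a b (fun t => f t - g t) = segint a b f - segint a b g.
Proof. by move=> cf cg; rewrite /segint RintegralB//; exact: cont_on_integrable. Qed.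

Lemma segint_cst a b (k : R) : a <= b -> segint a b (fun=> k) = k * (b - a).
Proof.
move=> ab; rewrite /segint Rintegral_cst//; congr (_ * _).
have := @lebesgue_measure_itv R `[a, b]; rewrite /= lte_fin => /(congr1 fine) ->.
by case: (ltP a b) => h /=; lra.
Qed.

Lemma segint_le a b f k : a <= b -> cont_on a b f ->
  (forall t, a <= t <= b -> `|f t| <= k) -> `|segint a b f| <= k * (b - a).
Proof.
move=> ab cf fk.
have fi := cont_on_integrable cf.
have mi : measurable (`[a, b] : set (measurableTypeR R)) by exact: measurable_itv.
have ck : mu.-integrable `[a, b] (EFin \o cst k).
  by apply: cont_on_integrable => x _; exact: cvg_cst.
rewrite -segint_cst//.
apply: (@le_trans _ _ (\int[mu]_(t in `[a, b]) `|f t|)); first exact: le_normr_Rintegral.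
have nf : mu.-integrable `[a, b] (EFin \o (fun t => `|f t|)) by exact: (integrable_norm fi).
apply: le_Rintegral => // t; rewrite /= in_itv /=; exact: fk.
Qed.

Lemma segint_split a b c f : a <= c <= b -> cont_on a b f ->
  segint a b f = segint a c f + segint c b f.
Proof.
move=> /andP[ac cb] cf; have fi := cont_on_integrable cf.
have := @Rintegral_itvB R f (BLeft a) (BRight b) c fi.
rewrite !bnd_simp => /(_ ac cb) H; rewrite /segint.
have -> : \int[mu]_(t in `[c, b]) f t = \int[mu]_(t in `]c, b]) f t.
  symmetry; apply: Rintegral_itv_obnd_cbnd.
  apply: (integrableS _ _ _ fi) => //.
  by apply: subset_itv; rewrite bnd_simp.
by rewrite -H; ring.
Qed.

(** The integral of P ds + Q dt around the boundary of [a, b] x [c, d]. *)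
Definition circulation P Q a b c d : R :=
  segint c d (fun t => Q b t - Q a t) - segint a b (fun s => P s d - P s c).

(** P and Q are differentiable at the point, and the common m is both dP/dt
    and dQ/ds: the form P ds + Q dt is closed there.  Only first-order
    expansions are asked for, since a holomorphic function is not known
    beforehand to have a continuous derivative. *)
Definition closed_at P Q s0 t0 := exists l m n : R,
  forall e, 0 < e -> exists2 r, 0 < r & forall s t, `|s - s0| < r -> `|t - t0| < r ->
   `|P s t - P s0 t0 - l * (s - s0) - m * (t - t0)| <= e * (`|s - s0| + `|t - t0|) /\
   `|Q s t - Q s0 t0 - m * (s - s0) - n * (t - t0)| <= e * (`|s - s0| + `|t - t0|).

Lemma lipschitz_cont f x (k : R) : (exists2 r, 0 < r &
  forall y, `|y - x| < r -> `|f y - f x| <= k * `|y - x|) -> {for x, continuous f}.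
Proof.
move=> [r r0 fk]; apply/cvgrPdist_le => e e0.
have k0 : 0 < `|k| + 1 by rewrite ltr_wpDl.
have ek : 0 < e / (`|k| + 1) by exact: divr_gt0.
near=> y; rewrite distrC.
have yr : `|y - x| < r.
  by near: y; exists r => //= y; rewrite /ball_ /= distrC.
apply: le_trans (fk _ yr) _.
have ye : `|y - x| < e / (`|k| + 1).
  by near: y; exists (e / (`|k| + 1)) => //= y; rewrite /ball_ /= distrC.
move: ye; rewrite ltr_pdivlMr// => ye.
have := ler_norm k; have := normr_ge0 (y - x); nra.
Unshelve. all: by end_near. Qed.

Lemma closed_at_cont P Q s0 t0 : closed_at P Q s0 t0 ->
  {for s0, continuous (P^~ t0)} /\ {for t0, continuous (Q s0)}.
Proof.
move=> [l [m [n /(_ 1 ltr01)[r r0 h]]]].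
have r00 x : `|x - x| < r by rewrite subrr normr0.
split.
  apply: (@lipschitz_cont _ _ (`|l| + 1)); exists r => // s sr.
  have [+ _] := h s t0 sr (r00 t0); rewrite subrr normr0 addr0 mulr0 subr0 mul1r => h1.
  have -> : P s t0 - P s0 t0 = (P s t0 - P s0 t0 - l * (s - s0)) + l * (s - s0) by ring.
  by apply: le_trans (ler_normD _ _) _; rewrite normrM; lra.
apply: (@lipschitz_cont _ _ (`|n| + 1)); exists r => // t tr.
have [_ +] := h s0 t (r00 s0) tr; rewrite subrr normr0 add0r mulr0 subr0 mul1r => h1.
have -> : Q s0 t - Q s0 t0 = (Q s0 t - Q s0 t0 - n * (t - t0)) + n * (t - t0) by ring.
by apply: le_trans (ler_normD _ _) _; rewrite normrM; lra.
Qed.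

Section Rectangle.
Variables (P Q : R -> R -> R) (a b c d : R).
Hypothesis ab : a <= b.
Hypothesis cd : c <= d.
Hypothesis closedPQ : forall s t, a <= s <= b -> c <= t <= d -> closed_at P Q s t.

Lemma cont_P t : c <= t <= d -> cont_on a b (P^~ t).
Proof. by move=> ct s sb; have [] := closed_at_cont (closedPQ sb ct). Qed.

Lemma cont_Q s : a <= s <= b -> cont_on c d (Q s).
Proof. by move=> sb t ct; have [] := closed_at_cont (closedPQ sb ct). Qed.

Lemma circulation_split a' b' c' d' x y :
  a <= a' -> a' <= x -> x <= b' -> b' <= b ->
  c <= c' -> c' <= y -> y <= d' -> d' <= d ->
  circulation P Q a' b' c' d' =
    circulation P Q a' x c' y + circulation P Q x b' c' y +
    circulation P Q a' x y d' + circulation P Q x b' y d'.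
Proof.
move=> aa ax xb bb cc cy yd dd; rewrite /circulation.
have Qc s l h : a <= s <= b -> c <= l -> h <= d -> cont_on l h (Q s).
  by move=> sb cl hd; apply: (cont_on_sub cl hd); exact: cont_Q.
have Pc t l h : c <= t <= d -> a <= l -> h <= b -> cont_on l h (P^~ t).
  by move=> sb cl hd; apply: (cont_on_sub cl hd); exact: cont_P.
have QB s s' l h : a <= s <= b -> a <= s' <= b -> c <= l -> h <= d ->
    segint l h (fun t => Q s t - Q s' t) = segint l h (Q s) - segint l h (Q s').
  by move=> ? ? ? ?; rewrite segintB//; exact: Qc.
have PB t t' l h : c <= t <= d -> c <= t' <= d -> a <= l -> h <= b ->
    segint l h (fun s => P s t - P s t') = segint l h (P^~ t) - segint l h (P^~ t').
  by move=> ? ? ? ?; rewrite segintB//; exact: Pc.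
have Qs s : a <= s <= b -> segint c' d' (Q s) = segint c' y (Q s) + segint y d' (Q s).
  by move=> sb; apply: segint_split; [lra|apply: Qc => //; lra].
have Ps t : c <= t <= d -> segint a' b' (P^~ t) = segint a' x (P^~ t) + segint x b' (P^~ t).
  by move=> sb; apply: segint_split; [lra|apply: Pc => //; lra].
rewrite !QB ?PB; try lra.
by rewrite !Qs ?Ps; lra.
Qed.

(** The terms m (b' - a') and m (d' - c') of the first-order expansions at
    (s0, t0) both integrate to m times the area and cancel, as the form is
    closed; what remains is small compared with the squared side length h. *)
Lemma circulation_small s0 t0 : a <= s0 <= b -> c <= t0 <= d ->
  forall e, 0 < e -> exists2 r, 0 < r & forall a' b' c' d' (h : R), 
  a <= a' -> a' <= s0 -> s0 <= b' -> b' <= b -> c <= c' -> c' <= t0 -> t0 <= d' -> d' <= d ->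
  b' - a' <= h -> d' - c' <= h -> h < r ->
  `|circulation P Q a' b' c' d'| <= e * h ^+ 2.
Proof.
move=> sb td e e0; have [l [m [n cl]]] := closedPQ sb td.
have [|r r0 {}cl] := cl (e / 8); first by rewrite divr_gt0.
exists r => // a' b' c' d' h aa as0 s0b bb cc ct t0d dd bah dch hr.
have near_s s : a' <= s <= b' -> `|s - s0| <= h by move=> ?; rewrite ler_norml; lra.
have near_t t : c' <= t <= d' -> `|t - t0| <= h by move=> ?; rewrite ler_norml; lra.
have main s t : a' <= s <= b' -> c' <= t <= d' ->
   `|P s t - P s0 t0 - l * (s - s0) - m * (t - t0)| <= e / 4 * h /\
   `|Q s t - Q s0 t0 - m * (s - s0) - n * (t - t0)| <= e / 4 * h.
  move=> /near_s sh /near_t th; have [||h1 h2] := cl s t; try lra.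
  have : e / 8 * (`|s - s0| + `|t - t0|) <= e / 4 * h by nra.
  by move=> h3; split; [apply: le_trans h1 _|apply: le_trans h2 _].
have h0 : 0 <= h by lra.
have cQ : cont_on c' d' (fun t => Q b' t - Q a' t).
  by apply: cont_onB; apply: (cont_on_sub cc dd); apply: cont_Q; lra.
have cP : cont_on a' b' (fun s => P s d' - P s c').
  by apply: cont_onB; apply: (cont_on_sub aa bb); apply: cont_P; lra.
have ck x y k : cont_on x y (fun=> k) by move=> ? _; exact: cvg_cst.
have -> : circulation P Q a' b' c' d' =
    segint c' d' (fun t => (Q b' t - Q a' t) - m * (b' - a')) -
    segint a' b' (fun s => (P s d' - P s c') - m * (d' - c')).
  rewrite (segintB cQ (ck _ _ _)) (segintB cP (ck _ _ _)) !segint_cst; try lra.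
  by rewrite /circulation; ring.
have iQ : `|segint c' d' (fun t => (Q b' t - Q a' t) - m * (b' - a'))| <= (e / 2 * h) * (d' - c').
  apply: segint_le; [lra|exact: cont_onB|move=> t td'].
  have [_ h1] := main b' t ltac:(lra) td'.
  have [_ h2] := main a' t ltac:(lra) td'.
  by move: h1 h2; rewrite !ler_norml; lra.
have iP : `|segint a' b' (fun s => (P s d' - P s c') - m * (d' - c'))| <= (e / 2 * h) * (b' - a').
  apply: segint_le; [lra|exact: cont_onB|move=> s sb'].
  have [h1 _] := main s d' sb' ltac:(lra).
  have [h2 _] := main s c' sb' ltac:(lra).
  by move: h1 h2; rewrite !ler_norml; lra.
apply: le_trans (ler_normB _ _) _.
have : e / 2 * h * (d' - c') <= e / 2 * h * h by apply: ler_wpM2l => //; apply: mulr_ge0 => //; lra.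
have : e / 2 * h * (b' - a') <= e / 2 * h * h by apply: ler_wpM2l => //; apply: mulr_ge0 => //; lra.
rewrite expr2; lra.
Qed.

(** If the circulation C were nonzero, repeated halving of both sides would give
    nested rectangles with circulation at least |C| / 4^n, while at their common
    point [circulation_small] makes it less than |C| / 4^n. *)
Lemma goursat : circulation P Q a b c d = 0.
Proof.
apply/eqP; apply: contraT => C0.
set C := circulation P Q a b c d in C0.
have C_gt0 : 0 < `|C| by rewrite normr_gt0.
pose L := b - a; pose H := d - c.
pose w n : R := (2 ^+ n)^-1.
have w0 n : 0 < w n by rewrite invr_gt0 exprn_gt0.
have wS n : w n = 2 * w n.+1 by rewrite /w exprS; field; rewrite expf_neq0.
pose good n (p : R * R) := [/\ a <= p.1, p.1 + L * w n <= b, c <= p.2, p.2 + H * w n <= d &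
  `|C| <= 4 ^+ n * `|circulation P Q p.1 (p.1 + L * w n) p.2 (p.2 + H * w n)| ].
pose next n (p q : R * R) := [/\ p.1 <= q.1, q.1 + L * w n.+1 <= p.1 + L * w n,
  p.2 <= q.2 & q.2 + H * w n.+1 <= p.2 + H * w n].
have L0 : 0 <= L by rewrite /L subr_ge0.
have H0 : 0 <= H by rewrite /H subr_ge0.
have /choice[step stepP] : forall np : nat * (R * R), exists q, good np.1 np.2 ->
    good np.1.+1 q /\ next np.1 np.2 q.
  move=> [n [x y]] /=; have [gn|ng] := pselect (good n (x, y)); last by exists (x, y) => /ng.
  have [ax xb cy yd] := gn; rewrite /= in ax xb cy yd *.
  have Lw : 0 <= L * w n.+1 by rewrite mulr_ge0// ltW.
  have Hw : 0 <= H * w n.+1 by rewrite mulr_ge0// ltW.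
  have Lw2 : L * w n = 2 * (L * w n.+1) by rewrite (wS n); ring.
  have Hw2 : H * w n = 2 * (H * w n.+1) by rewrite (wS n); ring.
  rewrite Lw2 Hw2 in xb yd *; set l := L * w n.+1 in Lw xb Lw2 *; set h := H * w n.+1 in Hw yd Hw2 *.
  rewrite (@circulation_split _ _ _ _ (x + l) (y + h)); try lra.
  have e1 : x + 2 * l = x + l + l by ring.
  have e2 : y + 2 * h = y + h + h by ring.
  rewrite e1 e2.
  set c1 := circulation _ _ _ _ _ _; set c2 := circulation _ _ _ _ _ _.
  set c3 := circulation _ _ _ _ _ _; set c4 := circulation _ _ _ _ _ _ => Cb.
  have p4 : 0 < (4 : R) ^+ n by rewrite exprn_gt0.
  have tri : `|c1 + c2 + c3 + c4| <= `|c1| + `|c2| + `|c3| + `|c4|.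
    by do 3 (apply: le_trans (ler_normD _ _) _; rewrite lerD2r).
  have : `|C| <= 4 ^+ n * (`|c1| + `|c2| + `|c3| + `|c4|).
    by apply: le_trans Cb _; rewrite ler_pM2l.
  move=> {}Cb.
  have quarter x' y' : x <= x' <= x + l -> y <= y' <= y + h ->
      `|C| <= 4 ^+ n.+1 * `|circulation P Q x' (x' + l) y' (y' + h)| ->
      exists q, good n (x, y) -> good n.+1 q /\ next n (x, y) q.
    by move=> /andP[x1 x2] /andP[y1 y2] Cq; exists (x', y') => _; split; split => //=;
      rewrite -/l -/h; lra.
  have [h1|h1] := leP (`|C|) (4 ^+ n.+1 * `|c1|).
    by apply: quarter h1; rewrite !(lexx, lerDl, Lw, Hw).
  have [h2|h2] := leP (`|C|) (4 ^+ n.+1 * `|c2|).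
    by apply: quarter h2; rewrite !(lexx, lerDl, Lw, Hw).
  have [h3|h3] := leP (`|C|) (4 ^+ n.+1 * `|c3|).
    by apply: quarter h3; rewrite !(lexx, lerDl, Lw, Hw).
  have [h4|h4] := leP (`|C|) (4 ^+ n.+1 * `|c4|).
    by apply: quarter h4; rewrite !(lexx, lerDl, Lw, Hw).
  by move: h1 h2 h3 h4; rewrite exprS; lra.
pose z := fix z n := if n is k.+1 then step (k, z k) else (a, c).
have zg n : good n (z n).
  elim: n => [|n IH]; last by have [] := stepP (n, z n) IH.
  by split => //=; rewrite /w /L /H expr0 invr1 ?mulr1 ?mul1r; (try lra);
    rewrite !subrKC.
have zn n : next n (z n) (z n.+1) by have [] := stepP (n, z n) (zg n).
have mono n k : [/\ (z n).1 <= (z (n + k)%N).1, (z (n + k)%N).1 + L * w (n + k)%N <= (z n).1 + L * w n,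
    (z n).2 <= (z (n + k)%N).2 & (z (n + k)%N).2 + H * w (n + k)%N <= (z n).2 + H * w n].
  elim: k => [|k [i1 i2 i3 i4]]; first by rewrite addn0.
  rewrite addnS; have [j1 j2 j3 j4] := zn (n + k)%N.
  by split; [apply: le_trans j1|apply: le_trans i2|apply: le_trans j3|apply: le_trans i4].
have Lw n : 0 <= L * w n by rewrite mulr_ge0// ltW.
have Hw n : 0 <= H * w n by rewrite mulr_ge0// ltW.
have cross n m : (z m).1 <= (z n).1 + L * w n /\ (z m).2 <= (z n).2 + H * w n.
  have [nm|/ltnW mn] := leqP n m.
    have [_ + _ +] := mono n (m - n)%N; rewrite subnKC// => i j.
    by have := Lw m; have := Hw m; lra.
  have [+ _ + _] := mono m (n - m)%N; rewrite subnKC// => i j.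
  by have := Lw n; have := Hw n; lra.
pose s0 := sup (range (fun n => (z n).1)); pose t0 := sup (range (fun n => (z n).2)).
have s0P n : (z n).1 <= s0 <= (z n).1 + L * w n.
  apply/andP; split.
    apply: ub_le_sup; last by exists n.
    by exists ((z 0%N).1 + L * w 0%N) => _ [m _ <-]; exact: (cross 0%N m).1.
  apply: ge_sup; first by exists (z 0%N).1, 0%N.
  by move=> _ [m _ <-]; exact: (cross n m).1.
have t0P n : (z n).2 <= t0 <= (z n).2 + H * w n.
  apply/andP; split.
    apply: ub_le_sup; last by exists n.
    by exists ((z 0%N).2 + H * w 0%N) => _ [m _ <-]; exact: (cross 0%N m).2.
  apply: ge_sup; first by exists (z 0%N).2, 0%N.
  by move=> _ [m _ <-]; exact: (cross n m).2.
have sab : a <= s0 <= b by have [g1 g2 g3 g4 _] := zg 0%N; have := s0P 0%N; lra.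
have tcd : c <= t0 <= d by have [g1 g2 g3 g4 _] := zg 0%N; have := t0P 0%N; lra.
(* The summand 1 keeps M positive for a degenerate rectangle. *)
pose M := L + H + 1.
have M0 : 0 < M by rewrite /M; lra.
have e0 : 0 < `|C| / (2 * M ^+ 2) by rewrite divr_gt0// mulr_gt0// exprn_gt0.
have [r r0 small] := circulation_small sab tcd e0.
have [n nr] : exists n, M * w n < r.
  pose n := Num.truncn (M / r); exists n.
  rewrite /w ltr_pdivrMr ?exprn_gt0//.
  have n2 : n.+1%:R <= 2 ^+ n :> R by rewrite -natrX ler_nat ltn_expl.
  have : M / r < n.+1%:R by exact: truncnS_gt.
  by rewrite ltr_pdivrMr// => h; apply: lt_le_trans h _; rewrite mulrC ler_pM2l.
have [g1 g2 g3 g4 gC] := zg n.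
have wM : 0 < w n by [].
have := small (z n).1 ((z n).1 + L * w n) (z n).2 ((z n).2 + H * w n) (M * w n).
have /andP[s1 s2] := s0P n; have /andP[t1 t2] := t0P n.
move=> /(_ g1 s1 s2 g2 g3 t1 t2 g4) /=.
have b1 : L * w n <= M * w n by apply: ler_wpM2r; [exact: ltW|rewrite /M; lra].
have b2 : H * w n <= M * w n by apply: ler_wpM2r; [exact: ltW|rewrite /M; lra].
move=> /(_ ltac:(lra) ltac:(lra) nr) bound.
have p4 : 0 < (4 : R) ^+ n by rewrite exprn_gt0.
have : `|C| <= `|C| / 2.
  apply: le_trans gC _.
  apply: (@le_trans _ _ (4 ^+ n * (`|C| / (2 * M ^+ 2) * (M * w n) ^+ 2))).
    by rewrite ler_pM2l.
  have e4 : (4 : R) ^+ n = 2 ^+ n * 2 ^+ n by rewrite -exprMn; congr (_ ^+ _); ring.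
  rewrite le_eqVlt; apply/orP; left; apply/eqP; rewrite e4 /w; field.
  by rewrite expf_neq0//= gt_eqF.
by lra.
Qed.

End Rectangle.
End Goursat.

(** * First-order expansions of holomorphic functions and of exp *)

Section DerivApprox.
Variables (K : numFieldType).

Lemma derive_approx (f : K^o -> K^o) (x : K^o) : derivable f x 1 ->
  forall e : K, 0 < e -> exists2 r : K, 0 < r &
    forall h : K, `|h| < r -> `|f (h + x) - f x - h * 'D_1 f x| <= e * `|h|.
Proof.
move=> df e e0.
have /cvgrPdist_le/(_ e e0) : h^-1 *: (f (h *: 1 + x) - f x) @[h --> 0^'] --> 'D_1 f x by exact: df.
rewrite near_withinE => /nbhs_normP[r /= r0 rP]; exists r => // h hr.
have [->|h0] := eqVneq h 0; first by rewrite add0r subrr mul0r subr0 normr0 mulr0.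
have := rP h; rewrite /ball_ /= sub0r normrN => /(_ hr h0).
rewrite {1}/GRing.scale /= [h *: 1](mulr1 h).
rewrite -(ler_pM2r (_ : 0 < `|h|)) ?normr_gt0// -normrM distrC => H; apply: le_trans H.
by rewrite distrC -[leRHS]normrN; rewrite le_eqVlt; apply/orP; left; apply/eqP; congr `|_|; field.
Qed.

End DerivApprox.

Section ComplexAbs.
Variable R : realType.
Local Notation C := (R[i]).
Implicit Types x y : C.

Definition cabs x : R := complex.Re `|x|.

Lemma cabsE x : `|x| = (cabs x)%:C. Proof. by rewrite /cabs normc_def. Qed.

Lemma cabs_ge0 x : 0 <= cabs x. Proof. rewrite -lecR -cabsE; exact: normr_ge0. Qed.

Lemma cabsM x y : cabs (x * y) = cabs x * cabs y.
Proof. by apply: complexI; rewrite -cabsE normrM !cabsE rmorphM. Qed.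

Lemma cabsD x y : cabs (x + y) <= cabs x + cabs y.
Proof. by rewrite -lecR rmorphD/= -!cabsE ler_normD. Qed.

Lemma cabsN x : cabs (- x) = cabs x.
Proof. by rewrite /cabs normrN. Qed.

Lemma cabsB x y : cabs (x - y) <= cabs x + cabs y.
Proof. by rewrite (le_trans (cabsD _ _))// cabsN. Qed.

Lemma cabs_conj x : cabs (Num.conj x) = cabs x.
Proof. by rewrite /cabs norm_conjC. Qed.

Lemma cabs0 : cabs 0 = 0. Proof. by rewrite /cabs normr0. Qed.
Lemma cabs1 : cabs 1 = 1. Proof. by rewrite /cabs normr1. Qed.

Lemma cabsX x n : cabs (x ^+ n) = cabs x ^+ n.
Proof. by elim: n => [|n IH]; rewrite ?expr0 ?cabs1// !exprS cabsM IH. Qed.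

Lemma cabs_eq0 x : cabs x = 0 -> x = 0.
Proof. by move=> x0; apply/eqP; rewrite -normr_eq0 cabsE x0. Qed.

Lemma cabsR (a : R) : cabs a%:C = `|a|.
Proof. by rewrite /cabs normc_def /= expr0n/= addr0 sqrtr_sqr. Qed.

Lemma cabs_sqr x : cabs x ^+ 2 = abssq x.
Proof. by rewrite /cabs Re_norm_sqr. Qed.

Lemma Re_le_cabs x : `|complex.Re x| <= cabs x.
Proof.
rewrite -ler_sqr ?nnegrE ?cabs_ge0// real_normK ?num_real// cabs_sqr.
by rewrite lerDl sqr_ge0.
Qed.

Lemma Im_le_cabs x : `|complex.Im x| <= cabs x.
Proof.
rewrite -ler_sqr ?nnegrE ?cabs_ge0// real_normK ?num_real// cabs_sqr.
by rewrite lerDr sqr_ge0.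
Qed.

Lemma cabs_le_sum x : cabs x <= `|complex.Re x| + `|complex.Im x|.
Proof.
rewrite -ler_sqr ?nnegrE ?cabs_ge0 ?addr_ge0// cabs_sqr /abssq.
rewrite -(real_normK (num_real (complex.Re x))) -(real_normK (num_real (complex.Im x))).
have := normr_ge0 (complex.Re x); have := normr_ge0 (complex.Im x); nra.
Qed.

Lemma cabs_cis t : cabs (cis t : C) = 1.
Proof. by rewrite /cabs norm_cis. Qed.

Lemma cisD s t : cis (s + t) = cis s * cis t :> C.
Proof. by rewrite /cis cosD sinD; apply: complex_eq; rewrite ?ReM ?ImM /=; ring. Qed.

(** The derivative of the complex exponential at 0, from those of exp, cos and
    sin; it makes the polar chart below differentiable. *)
Lemma cexp_approx (e : R) : 0 < e -> exists2 r, 0 < r & forall s t : R, `|s| < r -> `|t| < r ->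
  cabs ((expR s)%:C * cis t - 1 - (s +i* t)) <= e * (`|s| + `|t|).
Proof.
move=> e0.
have [q q0 [q1 qe]] : exists2 q : R, 0 < q & q <= 1 /\ 6 * q <= e.
  by have [e6|e6] := leP (e / 6) 1; [exists (e / 6)|exists 1] => //; try lra; split; lra.
have [r1 r10 h1] := derive_approx (@derivable_expR R 0) q0.
have [r2 r20 h2] := derive_approx (@derivable_cos R 0) q0.
have [r3 r30 h3] := derive_approx (@derivable_sin R 0) q0.
pose r := Num.min (q / 2) (Num.min r1 (Num.min r2 r3)).
exists r => [|s t sr tr]; first by rewrite !lt_min r10 r20 r30 divr_gt0.
have [sq s1] : `|s| < q / 2 /\ `|s| < r1 by move: sr; rewrite !lt_min => /and4P[].
have [t2 t3] : `|t| < r2 /\ `|t| < r3 by move: tr; rewrite !lt_min => /and4P[].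
have {h1} := h1 s s1; have {h2} := h2 t t2; have {h3} := h3 t t3.
rewrite !derive_val expR0 cos0 sin0 !addr0 oppr0 !mulr0 !mulr1 !subr0 => h3 h2 h1; rewrite addr0 in h3.
have es : `|expR s - 1| <= q.
  have -> : expR s - 1 = (expR s - 1 - s) + s by ring.
  apply: le_trans (ler_normD _ _) _; have := normr_ge0 s; nra.
have e2 : 0 <= expR s <= 2.
  by rewrite expR_ge0/=; move: es; rewrite ler_norml; lra.
set E := expR s in h1 es e2 *.
have eR : `|E * cos t - 1 - s| <= 2 * q * `|t| + q * `|s|.
  have -> : E * cos t - 1 - s = E * (cos t - 1) + (E - 1 - s) by ring.
  apply: le_trans (ler_normD _ _) _; apply: lerD => //.
  rewrite normrM -mulrA; apply: ler_pM => //; rewrite ger0_norm; lra.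
have eI : `|E * sin t - t| <= 2 * q * `|t| + q * `|t|.
  have -> : E * sin t - t = E * (sin t - t) + (E - 1) * t by ring.
  apply: le_trans (ler_normD _ _) _; apply: lerD; last by rewrite normrM ler_wpM2r.
  rewrite normrM -mulrA; apply: ler_pM => //; rewrite ger0_norm; lra.
apply: le_trans (cabs_le_sum _) _.
have -> : complex.Re (E%:C * cis t - 1 - (s +i* t)) = E * cos t - 1 - s.
  by rewrite !ReD !ReN ReM /= mul0r subr0.
have -> : complex.Im (E%:C * cis t - 1 - (s +i* t)) = E * sin t - t.
  by rewrite !ImD !ImN ImM /= mul0r addr0 subr0.
have := normr_ge0 s; have := normr_ge0 t; nra.
Qed.

End ComplexAbs.

(** * The mean value property *)

Section MeanValue.
Variable R : realType.
Local Notation arc := (@Defs.arc R).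
Local Notation C := (R[i]).
Implicit Types (f g : C -> C).

(** Holomorphy in the open unit disk. *)
Definition holo f := forall z : C, `|z| < 1 -> derivable (f : C^o -> C^o) z 1.

Lemma pos_complex (r : C) : 0 < r -> exists2 p : R, 0 < p & r = p%:C.
Proof.
case: r => a b; rewrite ltcE /= => /andP[/eqP -> a0].
by exists a.
Qed.

Lemma holo_approx f z : holo f -> cabs z < 1 -> exists D : C, forall e : R, 0 < e ->
  exists2 r : R, 0 < r & forall y : C, cabs (y - z) < r ->
    cabs (f y - f z - (y - z) * D) <= e * cabs (y - z).
Proof.
move=> hf z1; have df : derivable (f : C^o -> C^o) z 1.
  by apply: hf; rewrite cabsE -[1]/(1%:C) ltcR.
exists ('D_1 (f : C^o -> C^o) z) => e e0.
have [|r r0 rP] := derive_approx df (_ : 0 < e%:C); first by rewrite ltcR.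
have [p p0 rp] := pos_complex r0; exists p => // y yz.
have := rP (y - z); rewrite rp cabsE ltcR => /(_ yz).
by rewrite subrK !cabsE -rmorphM lecR.
Qed.

(** In the chart s + i t |-> exp (s + i t) the circles around 0 are the segments
    s = constant, so a rectangle links two circles. *)
Definition polar f (s t : R) : C := f ((expR s)%:C * cis t).

Lemma cabs_polar s t : cabs ((expR s)%:C * cis t : C) = expR s.
Proof. by rewrite cabsM cabs_cis mulr1 cabsR ger0_norm// expR_ge0. Qed.

Lemma polar_approx f s0 t0 : holo f -> s0 < 0 -> exists w : C, forall e : R, 0 < e ->
  exists2 r : R, 0 < r & forall s t, `|s - s0| < r -> `|t - t0| < r ->
    cabs (polar f s t - polar f s0 t0 - w * ((s - s0) +i* (t - t0))) <=
      e * (`|s - s0| + `|t - t0|).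
Proof.
move=> hf s00; set z0 : C := (expR s0)%:C * cis t0.
have z01 : cabs z0 < 1 by rewrite cabs_polar expR_lt1.
have [D DP] := holo_approx hf z01.
exists (z0 * D) => e e0.
have D0 := cabs_ge0 D.
have [q q0 [q1 qe]] : exists2 q : R, 0 < q & q <= 1 /\ q * cabs D <= e / 2.
  have [e6|e6] := leP (e / (2 * (cabs D + 1))) 1.
    exists (e / (2 * (cabs D + 1))); first by rewrite divr_gt0//; lra.
    split=> //; rewrite mulrAC ler_pdivrMr; last by lra.
    by nra.
  exists 1 => //; split => //; rewrite mul1r.
  by move: e6; rewrite ltr_pdivlMr; lra.
have [p p0 pP] := DP (e / 4) ltac:(lra).
have [r1 r10 rP] := cexp_approx q0.
have [r r0 [rp rr1]] : exists2 r : R, 0 < r & r <= p / 4 /\ r <= r1.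
  have [h|h] := leP (p / 4) r1; [exists (p / 4)|exists r1] => //; try lra; split; lra.
exists r => // s t sr tr.
set sg := s - s0 in sr *; set ta := t - t0 in tr *.
set S := `|sg| + `|ta|.
have S0 : 0 <= S by rewrite /S addr_ge0.
have SS : S < 2 * r by rewrite /S; lra.
set z := (expR s)%:C * cis t : C.
have zE : z = z0 * ((expR sg)%:C * cis ta).
  rewrite /z (_ : s = s0 + sg); last by rewrite /sg; ring.
  rewrite (_ : t = t0 + ta); last by rewrite /ta; ring.
  by rewrite expRD cisD rmorphM /z0 /=; ring.
have := rP sg ta (lt_le_trans sr rr1) (lt_le_trans tr rr1).
set u := sg +i* ta; set E := (expR sg)%:C * cis ta; rewrite -/S => Eu.
have uS : cabs u <= S by exact: cabs_le_sum.
clearbody u.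
rewrite -/E in zE; clearbody E.
have zz : z - z0 = z0 * (E - 1) by rewrite zE; ring.
have E1 : cabs (E - 1) <= 2 * S.
  have -> : E - 1 = (E - 1 - u) + u by ring.
  by apply: le_trans (cabsD _ _) _; nra.
have z0p := cabs_ge0 z0.
have E1p := cabs_ge0 (E - 1).
have zS : cabs (z - z0) <= 2 * S by rewrite zz cabsM; nra.
have := pP z ltac:(lra) => fz.
rewrite /polar -/z -/z0.
have -> : f z - f z0 - z0 * D * u = (f z - f z0 - (z - z0) * D) + z0 * (D * (E - 1 - u)).
  by rewrite zz; ring.
apply: le_trans (cabsD _ _) _; rewrite (cabsM z0) cabsM.
have Eup := cabs_ge0 (E - 1 - u).
have h1 : cabs D * cabs (E - 1 - u) <= e / 2 * S.
  apply: le_trans (_ : cabs D * (q * S) <= _); first exact: ler_wpM2l.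
  by rewrite mulrA ler_wpM2r// mulrC.
have h2 : cabs z0 * (cabs D * cabs (E - 1 - u)) <= 1 * (e / 2 * S).
  by apply: ler_pM => //; [exact: mulr_ge0|exact: ltW].
have : e / 4 * cabs (z - z0) <= e / 4 * (2 * S) by apply: ler_wpM2l => //; lra.
rewrite -/S; clearbody S; lra.
Qed.

(** The Cauchy-Riemann equations: the real and the imaginary part of
    F d(s + i t), where F = polar f, are closed forms. *)
Lemma polar_closed f s0 t0 : holo f -> s0 < 0 ->
  closed_at (fun s t => complex.Im (polar f s t)) (fun s t => complex.Re (polar f s t)) s0 t0 /\
  closed_at (fun s t => complex.Re (polar f s t)) (fun s t => - complex.Im (polar f s t)) s0 t0.
Proof.
move=> hf s00; have [[a b] wP] := polar_approx t0 hf s00.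
split.
  exists b, a, (- b) => e e0; have [r r0 rP] := wP e e0; exists r => // s t sr tr.
  have := rP s t sr tr; set X := (X in cabs X) => h.
  split; [refine (le_trans _ (le_trans (Im_le_cabs X) h))|refine (le_trans _ (le_trans (Re_le_cabs X) h))];
  rewrite le_eqVlt; apply/orP; left; apply/eqP; congr `|_|; rewrite /X.
    by rewrite !ImD !ImN ImM /=; ring.
  by rewrite !ReD !ReN ReM /=; ring.
exists a, (- b), (- a) => e e0; have [r r0 rP] := wP e e0; exists r => // s t sr tr.
have := rP s t sr tr; set X := (X in cabs X) => h.
split; [refine (le_trans _ (le_trans (Re_le_cabs X) h))|refine (le_trans _ (le_trans (Im_le_cabs X) h)); rewrite -normrN];
rewrite le_eqVlt; apply/orP; left; apply/eqP; congr `|_|; rewrite /X.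
  by rewrite !ReD !ReN ReM /=; ring.
by rewrite !ImD !ImN ImM /=; ring.
Qed.

Lemma cis_pi : cis (- pi) = cis pi :> C.
Proof. by rewrite /cis cosN sinN sinpi oppr0. Qed.

(** The two sides t = - pi and t = pi of a polar rectangle carry the same values,
    so their contributions to the circulation cancel and Goursat's theorem
    equates the integrals over the two circles. *)
Lemma circle_int_radius f a b : holo f -> a <= b -> b < 0 ->
  circle_int (fun z => f ((expR a)%:C * z)) = circle_int (fun z => f ((expR b)%:C * z)).
Proof.
move=> hf ab b0; have p0 := pi_gt0 R.
have pp : - pi <= pi :> R by lra.
have per s : polar f s pi = polar f s (- pi) by rewrite /polar cis_pi.
have zero (P : R -> R -> R) : (forall s, P s pi = P s (- pi)) -> segint a b (fun s => P s pi - P s (- pi)) = 0.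
  move=> Pp; rewrite -[RHS](mul0r (b - a)) -segint_cst//; apply: eq_Rintegral => s _.
  by rewrite Pp subrr.
have c1 s t : a <= s <= b -> - pi <= t <= pi ->
    closed_at (fun s t => complex.Im (polar f s t)) (fun s t => complex.Re (polar f s t)) s t.
  move=> sb _; have s0 : s < 0 by lra.
  by have [] := polar_closed t hf s0.
have c2 s t : a <= s <= b -> - pi <= t <= pi ->
    closed_at (fun s t => complex.Re (polar f s t)) (fun s t => - complex.Im (polar f s t)) s t.
  move=> sb _; have s0 : s < 0 by lra.
  by have [] := polar_closed t hf s0.
have ab1 : a <= a <= b by lra.
have ab2 : a <= b <= b by lra.
have z1 : segint a b (fun s => complex.Im (polar f s pi) - complex.Im (polar f s (- pi))) = 0.
  by apply: (zero (fun s t => complex.Im (polar f s t))) => s; rewrite per.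
have z2 : segint a b (fun s => complex.Re (polar f s pi) - complex.Re (polar f s (- pi))) = 0.
  by apply: (zero (fun s t => complex.Re (polar f s t))) => s; rewrite per.
have := goursat ab pp c1; rewrite /circulation z1 subr0.
rewrite (segintB (cont_Q c1 ab2) (cont_Q c1 ab1)) => /eqP; rewrite subr_eq0 => /eqP e1.
have := goursat ab pp c2; rewrite /circulation z2 subr0.
rewrite (segintB (cont_Q c2 ab2) (cont_Q c2 ab1)) => /eqP; rewrite subr_eq0 => /eqP e2.
have r1 : aint (rpart (fun z => f ((expR a)%:C * z))) =
    aint (rpart (fun z => f ((expR b)%:C * z))) := esym e1.
have ck : cont_on (- pi) pi (fun=> 0 : R) by move=> ? _; exact: cvg_cst.
have opp s : a <= s <= b -> segint (- pi) pi (fun t => complex.Im (polar f s t)) =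
    - segint (- pi) pi (fun t => - complex.Im (polar f s t)).
  move=> sb; have h := segintB ck (cont_Q c2 sb).
  rewrite (segint_cst 0 pp) mul0r sub0r in h; rewrite -h.
  by apply: eq_Rintegral => t _ /=; rewrite sub0r opprK.
have r2 : aint (ipart (fun z => f ((expR a)%:C * z))) =
    aint (ipart (fun z => f ((expR b)%:C * z))) :=
  etrans (opp a ab1) (etrans (congr1 -%R (esym e2)) (esym (opp b ab2))).
by rewrite !circle_intE r1 r2.
Qed.

(** The factor 2 comes from bounding the two parts separately; it spares the
    sharp triangle inequality for integrals. *)
Lemma circle_int_le f (u : R -> R) : citg f -> itg u ->
  (forall t, arc t -> cabs (f (cis t)) <= u t) ->
  cabs (circle_int f) <= 2 * ((2 * pi)^-1 * aint u).
Proof.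
move=> [fr fi] iu fB; rewrite circle_intE; apply: le_trans (cabs_le_sum _) _ => /=.
have p0 : 0 < 2 * pi :> R by rewrite mulr_gt0 ?pi_gt0.
have bnd v : itg v -> (forall t, arc t -> `|v t| <= u t) ->
    `|(2 * pi)^-1 * aint v| <= (2 * pi)^-1 * aint u.
  move=> iv uB; rewrite normrM gtr0_norm ?invr_gt0// ler_pM2l ?invr_gt0//.
  rewrite ler_norml -aintN//; apply/andP; split; apply: le_aint => //; first exact: itgN.
    by move=> t /uB; rewrite ler_norml /= => /andP[].
  by move=> t /uB; rewrite ler_norml /= => /andP[].
rewrite [leRHS](_ : _ = (2 * pi)^-1 * aint u + (2 * pi)^-1 * aint u); last by ring.
apply: lerD; apply: bnd => // t At; apply: le_trans (fB t At).
  exact: Re_le_cabs.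
exact: Im_le_cabs.
Qed.

Lemma circle_int_le_cst f (B : R) : citg f ->
  (forall t, arc t -> cabs (f (cis t)) <= B) -> cabs (circle_int f) <= 2 * B.
Proof.
move=> iF fB; have iB : itg (fun=> B).
  by apply: (@itg_bounded _ _ `|B|) => //; exact: measurable_cst.
apply: le_trans (circle_int_le iF iB fB) _; rewrite (aint_cst B).
by rewrite [_ * (B * _)]mulrC mulfK// mulf_neq0// gt_eqF// pi_gt0.
Qed.

Lemma holo_continuous f z : holo f -> cabs z < 1 -> forall e : R, 0 < e ->
  exists2 r : R, 0 < r & forall y, cabs (y - z) < r -> cabs (f y - f z) <= e.
Proof.
move=> hf z1 e e0; have [D DP] := holo_approx hf z1.
have [r r0 rP] := DP 1 ltr01.
have D0 := cabs_ge0 D.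
have D1 : 0 < 1 + cabs D by lra.
have [q q0 [qr qe]] : exists2 q : R, 0 < q & q <= r /\ q * (1 + cabs D) <= e.
  have [h|h] := leP (e / (1 + cabs D)) r.
    by exists (e / (1 + cabs D)); [rewrite divr_gt0|split=> //; rewrite divfK ?gt_eqF].
  by exists r => //; split=> //; move: h; rewrite ltr_pdivlMr//; lra.
exists q => // y yz; have h := rP y (lt_le_trans yz qr).
have -> : f y - f z = (f y - f z - (y - z) * D) + (y - z) * D by ring.
apply: le_trans (cabsD _ _) _; rewrite cabsM.
have := cabs_ge0 (y - z); nra.
Qed.

Lemma cis_near (t e : R) : 0 < e -> exists2 d : R, 0 < d & forall s, `|s - t| < d ->
  cabs (cis s - cis t : C) < e.
Proof.
move=> e0; have [p p0 pP] := cexp_approx (@ltr01 R).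
have [q q0 [qp qe]] : exists2 q : R, 0 < q & q <= p /\ q <= e / 2.
  by have [h|h] := leP p (e / 2); [exists p|exists (e / 2)] => //; try lra; split; lra.
exists q => // s st.
have -> : cis s - cis t = cis t * ((expR 0)%:C * cis (s - t) - 1) :> C.
  by rewrite expR0 mul1r mulrBr mulr1 -cisD (addrC t) subrK.
rewrite cabsM cabs_cis mul1r.
have z0 : `|0 : R| < p by rewrite normr0.
have := pP 0 (s - t) z0 (lt_le_trans st qp); rewrite normr0 add0r mul1r => h.
set x := _ - 1 in h *; set y := 0 +i* (s - t) in h.
have xy : cabs x <= cabs (x - y) + cabs y by rewrite -{1}(subrK y x); exact: cabsD.
have yb : cabs y <= `|s - t| by apply: le_trans (cabs_le_sum _) _; rewrite /= normr0 add0r.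
by lra.
Qed.

Lemma holo_circle_near f (r t e : R) : holo f -> 0 <= r < 1 -> 0 < e ->
  exists2 d : R, 0 < d & forall s, `|s - t| < d ->
    cabs (f (r%:C * cis s) - f (r%:C * cis t)) <= e.
Proof.
move=> hf /andP[r0 r1] e0.
have rt : cabs (r%:C * cis t) < 1 by rewrite cabsM cabs_cis mulr1 cabsR ger0_norm.
have [q q0 qP] := holo_continuous hf rt e0.
have [d d0 dP] := cis_near t q0; exists d => // s st; apply: qP.
rewrite -mulrBr cabsM cabsR ger0_norm//; have := dP s st.
by have := cabs_ge0 (cis s - cis t : C); nra.
Qed.

Lemma holo_circle_cont f (r : R) : holo f -> 0 <= r < 1 ->
  continuous (rpart (fun z => f (r%:C * z))) /\ continuous (ipart (fun z => f (r%:C * z))).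
Proof.
move=> hf r01; split => t; apply/cvgrPdist_le => e e0;
  have [d d0 dP] := holo_circle_near t hf r01 e0.
  near=> s; rewrite distrC.
  have st : `|s - t| < d by near: s; exists d => // s; rewrite /ball_ /= distrC.
  apply: le_trans (dP s st); rewrite /rpart -ReN -ReD; exact: Re_le_cabs.
near=> s; rewrite distrC.
have st : `|s - t| < d by near: s; exists d => // s; rewrite /ball_ /= distrC.
apply: le_trans (dP s st); rewrite /ipart -ImN -ImD; exact: Im_le_cabs.
Unshelve. all: by end_near. Qed.

Lemma holo_circle_measurable f (r : R) : holo f -> 0 <= r < 1 ->
  measurable_circle (fun z => f (r%:C * z)).
Proof.
move=> hf r01; have [c1 c2] := holo_circle_cont hf r01.
by split; apply: measurable_funTS; exact: continuous_measurable_fun.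
Qed.

Lemma holo_circle_citg f (r : R) : holo f -> 0 <= r < 1 ->
  citg (fun z => f (r%:C * z)).
Proof.
move=> hf r01; have [c1 c2] := holo_circle_cont hf r01.
by split; apply: cont_on_integrable => x _; [exact: c1|exact: c2].
Qed.

Lemma circle_int_cst (c : C) : circle_int (cst c) = c.
Proof.
rewrite circle_intE (@eq_aint _ (rpart _) (cst (complex.Re c)))//.
rewrite (@eq_aint _ (ipart _) (cst (complex.Im c)))// !aint_cst.
have p0 : 2 * pi != 0 :> R by rewrite mulf_neq0// gt_eqF// pi_gt0.
by case: c => a b; apply: complex_eq; rewrite /= mulrC mulfK.
Qed.

Lemma citg_cst (c : C) : citg (cst c).
Proof.
have := citgM (L2_cst c) (L2_cst 1).
by have -> : cst c \* cst 1 = cst c :> (C -> C) by apply/funext => z /=; rewrite mulr1.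
Qed.

(** Shrink the radius to 0, where f is close to f 0. *)
Lemma mean_value f (r : R) : holo f -> 0 < r < 1 ->
  circle_int (fun z => f (r%:C * z)) = f 0.
Proof.
move=> hf /andP[r0 r1]; apply: subr0_eq; apply: cabs_eq0; apply/eqP.
rewrite eq_le cabs_ge0 andbT; apply/ler_addgt0Pr => e e0; rewrite add0r.
have c0 : cabs (0 : C) < 1 by rewrite cabs0.
have e2 : 0 < e / 2 by rewrite divr_gt0.
have [q q0 qP] := holo_continuous hf c0 e2.
have [p p0 [pr pq]] : exists2 p : R, 0 < p & p <= r /\ p < q.
  have [h|h] := leP r (q / 2); [exists r|exists (q / 2)] => //; try lra; split; lra.
have -> : circle_int (fun z => f (r%:C * z)) = circle_int (fun z => f (p%:C * z)).
  (* [circle_int_radius] measures radii by their logarithms. *)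
  have ab : ln p <= ln r by rewrite ler_ln ?posrE.
  have b0 : ln r < 0 by apply: ln_lt0; rewrite r0.
  have := circle_int_radius hf ab b0.
  by rewrite (lnK (r0 : r \is Num.pos)) (lnK (p0 : p \is Num.pos)).
have p1 : 0 <= p < 1 by rewrite ltW//= (le_lt_trans pr).
rewrite -{1}(circle_int_cst (f 0)).
have ic := citgD (holo_circle_citg hf p1) (citg_cst (- f 0)).
have -> : circle_int (fun z => f (p%:C * z)) - circle_int (cst (f 0)) =
    circle_int ((fun z => f (p%:C * z)) \+ cst (- f 0)).
  rewrite circle_intD; [|exact: holo_circle_citg|exact: citg_cst].
  by rewrite !circle_int_cst.
apply: le_trans (circle_int_le_cst ic (B := e / 2) _) _; last lra.
move=> t _ /=; apply: qP; rewrite subr0 cabsM cabs_cis mulr1 cabsR ger0_norm//.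
exact: ltW.
Qed.

End MeanValue.

(** * Limits under the inner product and orthogonality of the monomials *)

Section Fejer.
Variable R : realType.
Local Notation mu := (@lebesgue_measure R).
Local Notation arc := (@Defs.arc R).
Local Notation C := (R[i]).
Implicit Types (f g h : C -> C).
Hint Resolve measurable_arc : core.

(** Bounded pointwise convergence implies convergence in L^2, by dominated
    convergence, hence convergence of the inner products. *)
Lemma dot_lim_const (f : nat -> C -> C) g h (B : R) (c : C) :
  (forall n, L2 (f n)) -> L2 g -> L2 h ->
  (forall n t, arc t -> cabs (f n (cis t)) <= B) ->
  (\forall t \ae mu, arc t -> forall e : R, 0 < e -> exists N, forall n, (N <= n)%N ->
     cabs (f n (cis t) - g (cis t)) <= e) ->
  (forall n, dot (f n) h = c) -> dot g h = c.
Proof.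
move=> f2 g2 h2 fB fg fc.
pose w n t := rpart (f n \- g) t ^+ 2 + ipart (f n \- g) t ^+ 2.
have wE n t : w n t = cabs (f n (cis t) - g (cis t)) ^+ 2 by rewrite cabs_sqr.
have fg2 n : L2 (f n \- g) by exact: L2B.
have wi n : itg (w n) by have /L2E[[_ ?] [_ ?]] := fg2 n; exact: itgD.
have wB : \forall t \ae mu, arc t -> forall n, w n t <= (2 * B + 1) ^+ 2.
  apply: ae_imp fg => t ht At n; rewrite wE.
  have [N /(_ N (leqnn N)) NP]   := ht At 1 ltr01.
  have fN := fB N t At; have fn := fB n t At.
  have -> : f n (cis t) - g (cis t) = (f N (cis t) - g (cis t)) + (f n (cis t) - f N (cis t)) by ring.
  rewrite lerXn2r ?nnegrE ?cabs_ge0//.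
    by apply: le_trans (cabs_ge0 (f n (cis t))) _; have := cabs_ge0 (f n (cis t)); lra.
  apply: le_trans (cabsD _ _) _; have := cabsB (f n (cis t)) (f N (cis t)); lra.
have mw n : measurable_fun arc (fun t => (w n t)%:E).
  by apply/measurable_EFinP; exact: itg_measurable (wi n).
have w0 : \forall t \ae mu, arc t -> (w n t)%:E @[n --> \oo] --> (0 : \bar R)%E.
  apply: ae_imp fg => t ht At; apply/fine_cvgP; split; first exact: nearW.
  apply/cvgrPdist_le => e e0.
  have [|N NP]   := ht At (Num.sqrt e); first by rewrite sqrtr_gt0.
  exists N => // n /= Nn; rewrite sub0r normrN wE ger0_norm ?sqr_ge0//.
  by rewrite -(sqr_sqrtr (ltW e0)) lerXn2r ?nnegrE ?cabs_ge0 ?sqrtr_ge0//; exact: NP.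
have dB : \forall t \ae mu, forall n, arc t -> (`|(w n t)%:E| <= ((2 * B + 1) ^+ 2)%:E)%E.
  apply: ae_imp wB => t ht n At; rewrite /= lee_fin ger0_norm; first exact: ht.
  by rewrite wE sqr_ge0.
have iB : mu.-integrable arc (cst ((2 * B + 1) ^+ 2)%:E).
  by apply: (@itg_bounded _ (cst ((2 * B + 1) ^+ 2)) `|(2 * B + 1) ^+ 2|) => //; exact: measurable_cst.
have [_ _] := dominated_convergence (@measurable_arc R) mw (measurable_cst (0 : \bar R)%E) w0 iB dB.
rewrite integral0 => /fine_cvgP[_ cvg0].
apply: subr0_eq; apply: abssq_eq0; apply/eqP; rewrite eq_le abssq_ge0 andbT.
apply/ler_addgt0Pr => e e0; rewrite add0r.
have h0 := normsq_ge0 h2.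
have p0 : 0 < 2 * pi :> R by rewrite mulr_gt0 ?pi_gt0.
have d0 : 0 < (2 * pi) * (e / (normsq h + 1)) by rewrite mulr_gt0// divr_gt0//; lra.
have /cvgrPdist_le/(_ _ d0)[N _ /(_ N (leqnn N))] := cvg0.
rewrite /= sub0r normrN -[fine _]/(aint (w N)) => wN.
have -> : dot g h - c = - dot (f N \- g) h by rewrite dotBl// fc; ring.
have -> : abssq (- dot (f N \- g) h) = abssq (dot (f N \- g) h).
  by rewrite /abssq ReN ImN !sqrrN.
apply: le_trans (cauchy_schwarz_weak (fg2 N) h2) _; rewrite normsq_aint//.
rewrite -ler_pdivlMr; last lra.
rewrite mulrC ler_pdivrMr// [leRHS]mulrC.
by apply: le_trans wN; exact: ler_norm.
Qed.

Lemma circle_int_sum (I : Type) (s : seq I) (F : I -> C -> C) : (forall i, citg (F i)) ->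
  citg (fun z => \sum_(i <- s) F i z) /\
  circle_int (fun z => \sum_(i <- s) F i z) = \sum_(i <- s) circle_int (F i).
Proof.
move=> iF; elim: s => [|i s [si es]].
  have -> : (fun z : C => \sum_(i <- [::]) F i z) = cst 0.
    by apply/funext => z; rewrite big_nil.
  by rewrite big_nil circle_int_cst; split => //; exact: citg_cst.
have -> : (fun z : C => \sum_(j <- i :: s) F j z) = F i \+ (fun z => \sum_(j <- s) F j z).
  by apply/funext => z; rewrite big_cons.
by rewrite big_cons circle_intD// es; split=> //; exact: citgD.
Qed.

Lemma holo_expM f (k : nat) : holo f -> holo (fun z => z ^+ k * f z).
Proof.
move=> hf z z1; have df := hf z z1.
have dX : derivable (fun z : C^o => (z ^+ k : C^o)) z 1 by exact: exprn_derivable.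
exact: (derivableM dX df).
Qed.

Lemma holo_cst (c : C) : holo (cst c).
Proof. by move=> z _; exact: derivable_cst. Qed.

(** The mean value property for z^k f z. *)
Lemma circle_int_holoX f (r : R) (k : nat) : holo f -> 0 < r < 1 ->
  circle_int (fun w => f (r%:C * w) * w ^+ k) = (k == 0%N)%:R * f 0.
Proof.
move=> hf r01; have r0 : 0 < r by case/andP: r01.
have := mean_value (@holo_expM f k hf) r01; rewrite expr0n.
have hk : citg (fun w => (r%:C * w) ^+ k * f (r%:C * w)).
  by apply: (holo_circle_citg (@holo_expM f k hf)); case/andP: r01 => /ltW -> ->.
have rk0 : (r%:C : C) ^+ k != 0.
  by rewrite expf_neq0//; apply/eqP => -[] /eqP; rewrite gt_eqF.
have E : (fun w => f (r%:C * w) * w ^+ k) = ((r%:C ^+ k)^-1 \*o (fun w => (r%:C * w) ^+ k * f (r%:C * w))).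
  by apply/funext => w /=; rewrite exprMn; field.
rewrite E circle_intZ// => ->.
by case: k {hk E} rk0 => [|k] rk0 /=; rewrite ?expr0 ?invr1 ?mul1r ?mul0r ?mulr0.
Qed.

Lemma circle_int_exp (k : nat) : circle_int (fun w : C => w ^+ k) = (k == 0%N)%:R.
Proof.
have h : 0 < (2^-1 : R) < 1 by apply/andP; split; lra.
have := @circle_int_holoX (cst 1) _ k (@holo_cst 1) h; rewrite mulr1 => <-.
by apply: eq_circle_int => t _ /=; rewrite mul1r.
Qed.

Lemma cis_expM (t : R) (j l : nat) :
  (cis t : C) ^+ (j + l) * Num.conj (cis t) ^+ l = cis t ^+ j.
Proof. by rewrite exprD -mulrA -exprMn cis_norm expr1n mulr1. Qed.

Lemma citg_bounded f (B : R) : measurable_circle f -> (forall t, arc t -> cabs (f (cis t)) <= B) ->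
  citg f.
Proof.
move=> [mr mi] fB; split; apply: (@itg_bounded _ _ B) => // t At; apply: le_trans (fB t At).
  exact: Re_le_cabs.
exact: Im_le_cabs.
Qed.

Lemma measurable_circleX f n : measurable_circle f -> measurable_circle (fun z => f z ^+ n).
Proof.
move=> mf; elim: n => [|n IH]; first exact: (measurable_circle_cst 1).
have := measurable_circleM mf IH.
by congr measurable_circle; apply/funext => z /=; rewrite exprS.
Qed.

Lemma circle_int_ortho (j l : nat) :
  circle_int (fun w : C => w ^+ j * Num.conj w ^+ l) = (j == l)%:R.
Proof.
have pos k i : circle_int (fun w : C => w ^+ (k + i) * Num.conj w ^+ i) = (k == 0%N)%:R.
  by rewrite -circle_int_exp; apply: eq_circle_int => t _; rewrite cis_expM.
have [lj|/ltnW jl] := leqP l j.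
  rewrite -{1}(subnK lj) pos; congr (nat_of_bool _)%:R.
  by apply/eqP/eqP; lia.
have := pos (l - j)%N j; rewrite subnK// => H.
have ci : citg (fun w : C => w ^+ l * Num.conj w ^+ j).
  apply: (@citg_bounded _ 1).
    apply: measurable_circleM; first exact/measurable_circleX/measurable_circle_id.
    exact/measurable_circleX/measurable_circleJ/measurable_circle_id.
  by move=> t _; rewrite cabsM !cabsX cabs_conj cabs_cis !expr1n mulr1.
have := circle_intJ ci; rewrite H rmorph_nat.
rewrite (_ : (l - j == 0)%N = (j == l)); last by apply/eqP/eqP; lia.
move=> <-; apply: eq_circle_int => t _.
by rewrite conjM !rmorphXn /= conjCK mulrC.
Qed.

End Fejer.

(** * Fejer means of a dilate *)

Section FejerSum.
Variable R : realType.
Local Notation mu := (@lebesgue_measure R).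
Local Notation arc := (@Defs.arc R).
Local Notation C := (R[i]).
Implicit Types (f g h : C -> C).
Hint Resolve measurable_arc : core.

Definition fejer_kernel (n : nat) (u : C) : C :=
  n.+1%:R^-1 * \sum_(j < n.+1) \sum_(l < n.+1) u ^+ j * Num.conj u ^+ l.

(** The double sum is the squared modulus of a geometric sum, which shows that
    the kernel is nonnegative. *)
Lemma fejer_kernelE n u :
  fejer_kernel n u = (n.+1%:R^-1 * abssq (\sum_(j < n.+1) u ^+ j))%:C.
Proof.
rewrite rmorphM/= -mul_conj_abssq fmorphV rmorph_nat /fejer_kernel; congr (_ * _).
rewrite mulr_suml; apply: eq_bigr => j _; rewrite rmorph_sum mulr_sumr.
by apply: eq_bigr => l _; rewrite rmorphXn.
Qed.

Lemma fejer_kernel_cabs n u : cabs (fejer_kernel n u) = complex.Re (fejer_kernel n u).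
Proof.
by rewrite fejer_kernelE cabsR ger0_norm// mulr_ge0 ?invr_ge0 ?abssq_ge0.
Qed.

(** Away from u = 1 the kernel is small because the geometric sum satisfies
    (u - 1) * sum = u^(n+1) - 1, of modulus at most 2. *)
Lemma fejer_kernel_small n u (d : R) : cabs u = 1 -> 0 < d -> d <= cabs (u - 1) ->
  cabs (fejer_kernel n u) <= 4 / d ^+ 2 / n.+1%:R.
Proof.
move=> u1 d0 du; rewrite fejer_kernel_cabs fejer_kernelE /= mulrC.
rewrite ler_wpM2r ?invr_ge0// ler_pdivlMr ?exprn_gt0// -cabs_sqr -exprMn.
set S := \sum_(j < n.+1) u ^+ j.
have : cabs (u ^+ n.+1 - 1) <= 2.
  by apply: le_trans (cabsB _ _) _; rewrite cabsX u1 expr1n cabs1; lra.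
rewrite subrX1 cabsM -/S => h.
have Sp := cabs_ge0 S.
have -> : (4 : R) = 2 ^+ 2 by ring.
have k : cabs S * d <= 2 by apply: le_trans h; rewrite mulrC ler_wpM2r.
by apply: lerXn2r => //; rewrite nnegrE// mulr_ge0// ltW.
Qed.

Variable theta : C -> C.
Hypothesis holo_theta : holo theta.
Variable B : R.
Hypothesis theta_le : forall z, cabs z < 1 -> cabs (theta z) <= B.
Variable r : R.
Hypothesis r01 : 0 < r < 1.

Let tr z := theta (r%:C * z).
Let r0 : 0 < r. Proof. by case/andP: r01. Qed.
Let r1 : r < 1. Proof. by case/andP: r01. Qed.
Let r01' : 0 <= r < 1. Proof. by rewrite ltW. Qed.

Lemma dilate_le t : cabs (tr (cis t)) <= B.
Proof. by apply: theta_le; rewrite cabsM cabs_cis mulr1 cabsR ger0_norm// ltW. Qed.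

Lemma dilate_measurable : measurable_circle tr.
Proof. exact: holo_circle_measurable. Qed.

Lemma measurable_monomial (j l : nat) : measurable_circle (fun w : C => w ^+ j * Num.conj w ^+ l).
Proof.
apply: measurable_circleM; first exact/measurable_circleX/measurable_circle_id.
exact/measurable_circleX/measurable_circleJ/measurable_circle_id.
Qed.

Lemma cabs_monomial (j l : nat) t : cabs (cis t ^+ j * Num.conj (cis t) ^+ l : C) = 1.
Proof. by rewrite cabsM !cabsX cabs_conj cabs_cis !expr1n mulr1. Qed.

Let coef (j l : nat) := circle_int (fun w => tr w * (w ^+ j * Num.conj w ^+ l)).

Lemma citg_coef (j l : nat) : citg (fun w => tr w * (w ^+ j * Num.conj w ^+ l)).
Proof.
apply: (@citg_bounded _ _ B).
  exact: measurable_circleM dilate_measurable (measurable_monomial j l).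
by move=> t _; rewrite cabsM cabs_monomial mulr1 dilate_le.
Qed.

(** Here analyticity enters: the Fourier coefficients of negative index of the
    dilate vanish, and the one of index 0 is theta 0. *)
Lemma coef_lower (j l : nat) : (l <= j)%N -> coef j l = (j == l)%:R * theta 0.
Proof.
move=> lj; have := @circle_int_holoX _ theta r (j - l) holo_theta r01.
rewrite (_ : (j - l == 0)%N = (j == l)); last by apply/eqP/eqP; lia.
move=> <-; apply: eq_circle_int => t _; rewrite /tr.
by rewrite -{1}(subnK lj) cis_expM.
Qed.

Definition fejer_sum (n : nat) (z : C) : C :=
  n.+1%:R^-1 * \sum_(j < n.+1) \sum_(l < n.+1) coef j l * (z ^+ l * Num.conj z ^+ j).

Lemma double_sum_int (n : nat) (F : nat -> nat -> C -> C) : (forall j l, citg (F j l)) ->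
  citg (fun z => n.+1%:R^-1 * \sum_(j < n.+1) \sum_(l < n.+1) F j l z) /\
  circle_int (fun z => n.+1%:R^-1 * \sum_(j < n.+1) \sum_(l < n.+1) F j l z) =
    n.+1%:R^-1 * \sum_(j < n.+1) \sum_(l < n.+1) circle_int (F j l).
Proof.
move=> iF.
have inner j := @circle_int_sum R _ (index_enum 'I_n.+1) (fun (l : 'I_n.+1) => F j l) (fun l => iF j l).
have [i1 e1] := @circle_int_sum R _ (index_enum 'I_n.+1)
  (fun (j : 'I_n.+1) z => \sum_(l < n.+1) F j l z) (fun j => (inner j).1).
split; first exact: (citgZ (n.+1%:R^-1) i1).
rewrite (circle_intZ (n.+1%:R^-1) i1) e1; congr (_ * _).
by apply: eq_bigr => j _; exact: (inner j).2.
Qed.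

(** A Fejer mean is a trigonometric polynomial by definition; as a convolution
    with the kernel it is also an average of values of the function. *)
Lemma fejer_sumE n t : citg (fun w => tr w * fejer_kernel n (w * Num.conj (cis t))) /\
  fejer_sum n (cis t) = circle_int (fun w => tr w * fejer_kernel n (w * Num.conj (cis t))).
Proof.
have [i1 e1] := @double_sum_int n
  (fun j l => (cis t ^+ l * Num.conj (cis t) ^+ j) \*o (fun w => tr w * (w ^+ j * Num.conj w ^+ l)))
  (fun j l => citgZ _ (citg_coef j l)).
have E : (fun w => tr w * fejer_kernel n (w * Num.conj (cis t))) =
  (fun z => n.+1%:R^-1 * \sum_(j < n.+1) \sum_(l < n.+1)
    ((cis t ^+ l * Num.conj (cis t) ^+ j) \*o (fun w => tr w * (w ^+ j * Num.conj w ^+ l))) z).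
  apply/funext => w; rewrite /fejer_kernel mulrCA; congr (_ * _).
  rewrite mulr_sumr; apply: eq_bigr => j _; rewrite mulr_sumr; apply: eq_bigr => l _ /=.
  by rewrite conjM conjCK !exprMn; ring.
rewrite E; split=> //; rewrite e1 /fejer_sum; congr (_ * _).
apply: eq_bigr => j _; apply: eq_bigr => l _.
exact: (etrans (mulrC _ _) (esym (circle_intZ _ (citg_coef j l)))).
Qed.

Lemma fejer_kernel_int n t : citg (fun w => fejer_kernel n (w * Num.conj (cis t))) /\
  circle_int (fun w => fejer_kernel n (w * Num.conj (cis t))) = 1.
Proof.
have ci j l : citg (fun w : C => w ^+ j * Num.conj w ^+ l).
  apply: (@citg_bounded _ _ 1); first exact: measurable_monomial.
  by move=> s _; rewrite cabs_monomial.
have [i1 e1] := @double_sum_int n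
  (fun j l => (cis t ^+ l * Num.conj (cis t) ^+ j) \*o (fun w => w ^+ j * Num.conj w ^+ l))
  (fun j l => citgZ _ (ci j l)).
have E : (fun w => fejer_kernel n (w * Num.conj (cis t))) =
  (fun z => n.+1%:R^-1 * \sum_(j < n.+1) \sum_(l < n.+1)
    ((cis t ^+ l * Num.conj (cis t) ^+ j) \*o (fun w => w ^+ j * Num.conj w ^+ l)) z).
  apply/funext => w; rewrite /fejer_kernel; congr (_ * _).
  apply: eq_bigr => j _; apply: eq_bigr => l _ /=.
  by rewrite conjM conjCK !exprMn; ring.
rewrite E; split=> //; rewrite e1.
under eq_bigr => j _.
  under eq_bigr => l _ do rewrite (circle_intZ _ (ci j l)) circle_int_ortho.
  rewrite (bigD1 j)//= eqxx mulr1 -exprMn cis_norm expr1n big1 ?addr0; last first.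
    by move=> l /negPf lj; rewrite (_ : (j == l :> nat) = false) ?mulr0// eq_sym; exact: lj.
  over.
by rewrite sumr_const card_ord mulVf// pnatr_eq0.
Qed.

Lemma fejer_kernel_mass n t :
  (2 * pi)^-1 * aint (rpart (fun w => fejer_kernel n (w * Num.conj (cis t)))) = 1.
Proof. by have [_] := fejer_kernel_int n t; rewrite circle_intE => -[]. Qed.

Lemma fejer_sum_le n t : cabs (fejer_sum n (cis t)) <= 2 * B.
Proof.
have [iF ->] := fejer_sumE n t; have [[iK _] _] := fejer_kernel_int n t.
apply: le_trans (circle_int_le iF (itgZ B iK) _) _.
  move=> s _; rewrite cabsM fejer_kernel_cabs /rpart ler_wpM2r ?dilate_le//.
  by rewrite -fejer_kernel_cabs cabs_ge0.
by rewrite aintZ// [X in 2 * X]mulrCA fejer_kernel_mass mulr1.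
Qed.

(** The kernel has mass 1: near t the function varies by at most e / 4, and
    the rest of the circle contributes a multiple of 1 / (n + 1). *)
Lemma fejer_sum_cvg t (e : R) : 0 < e -> exists N, forall n, (N <= n)%N ->
  cabs (fejer_sum n (cis t) - tr (cis t)) <= e.
Proof.
move=> e0.
have B0 : 0 <= B by apply: le_trans (cabs_ge0 _) (dilate_le t).
have rt : cabs (r%:C * cis t) < 1 by rewrite cabsM cabs_cis mulr1 cabsR ger0_norm// ltW.
have e4 : 0 < e / 4 by lra.
have [d d0 dP] := holo_continuous holo_theta rt e4.
have [q q0 qE] : exists2 q : R, 0 <= q & q = 2 * B * (4 / d ^+ 2).
  by exists (2 * B * (4 / d ^+ 2)) => //; rewrite mulr_ge0 ?divr_ge0 ?sqr_ge0//; lra.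
exists (Num.truncn (4 * q / e)) => n Nn.
have nq : q / n.+1%:R <= e / 4.
  rewrite ler_pdivrMr ?ltr0n// mulrC.
  have : 4 * q / e < n.+1%:R.
    by apply: lt_le_trans (truncnS_gt _) _; rewrite ler_nat.
  by rewrite ltr_pdivrMr//; lra.
have [iF ->] := fejer_sumE n t; have [iK K1] := fejer_kernel_int n t.
have ic := citgD iF (citgZ (- tr (cis t)) iK).
have -> : circle_int (fun w => tr w * fejer_kernel n (w * Num.conj (cis t))) - tr (cis t) =
    circle_int ((fun w => tr w * fejer_kernel n (w * Num.conj (cis t))) \+
      (- tr (cis t) \*o (fun w => fejer_kernel n (w * Num.conj (cis t))))).
  rewrite (circle_intD iF (citgZ _ iK)) (circle_intZ _ iK) K1 mulr1//.
have ik : itg (fun=> q / n.+1%:R).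
  by apply: (@itg_bounded _ _ `|q / n.+1%:R|) => //; exact: measurable_cst.
have [iKr _] := iK.
apply: le_trans (circle_int_le ic (itgD (itgZ (e / 4) iKr) ik) _) _; last first.
  rewrite aintD//; last exact: itgZ.
  rewrite aintZ// (aint_cst (q / n.+1%:R)) mulrDr [X in X + _]mulrCA fejer_kernel_mass mulr1.
  rewrite [(2 * pi)^-1 * _]mulrC mulfK ?gt_eqF ?mulr_gt0 ?pi_gt0//.
  by move: (q / _) nq => x nq; lra.
move=> s _ /=; rewrite mulNr -mulrBl cabsM /rpart -fejer_kernel_cabs.
set k := cabs (fejer_kernel _ _).
have k0 : 0 <= k by exact: cabs_ge0.
have qn : 0 <= q / n.+1%:R by rewrite divr_ge0.
have [sd|sd] := ltP (cabs (cis s - cis t : C)) d.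
  have : cabs (tr (cis s) - tr (cis t)) <= e / 4.
    apply: dP; rewrite -mulrBr cabsM cabsR gtr0_norm//.
    by apply: le_lt_trans sd; rewrite ler_piMl ?cabs_ge0 ?ltW.
  by move: (q / _) qn => x qn; nra.
have h1 : cabs (tr (cis s) - tr (cis t)) <= 2 * B.
  by apply: le_trans (cabsB _ _) _; have := dilate_le s; have := dilate_le t; lra.
have h2 : k <= 4 / d ^+ 2 / n.+1%:R.
  apply: fejer_kernel_small => //; first by rewrite cabsM cabs_conj !cabs_cis mulr1.
  have -> : cis s * Num.conj (cis t) - 1 = (cis s - cis t) * Num.conj (cis t) :> C.
    by rewrite mulrBl cis_norm.
  by rewrite cabsM cabs_conj cabs_cis mulr1.
have : cabs (tr (cis s) - tr (cis t)) * k <= 2 * B * (4 / d ^+ 2 / n.+1%:R).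
  by apply: ler_pM => //; exact: cabs_ge0.
rewrite (mulrA (2 * B)) -qE; move: (q / _) nq qn => x nq qn; nra.
Qed.

Lemma measurable_fejer_sum n : measurable_circle (fejer_sum n).
Proof.
have ci j l : citg (coef j l \*o (fun w : C => w ^+ l * Num.conj w ^+ j)).
  apply: citgZ; apply: (@citg_bounded _ _ 1); first exact: measurable_monomial.
  by move=> s _; rewrite cabs_monomial.
exact: (citg_measurable (double_sum_int n ci).1).
Qed.

Lemma L2_bounded f (M : R) : measurable_circle f -> (forall t, arc t -> cabs (f (cis t)) <= M) ->
  L2 f.
Proof.
move=> mf fM; apply: Linfty_L2; apply: (@Linfty_bounded _ _ M) => // t At.
by rewrite cabsE lecR fM.
Qed.

Lemma L2_monomial (j l : nat) : L2 (fun w : C => w ^+ j * Num.conj w ^+ l).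
Proof.
apply: (@L2_bounded _ 1); first exact: measurable_monomial.
by move=> t _; rewrite cabs_monomial.
Qed.

Lemma dilate_L2 : L2 tr.
Proof. by apply: (@L2_bounded _ B); [exact: dilate_measurable|move=> t _; exact: dilate_le]. Qed.

(** Replace the dilate by its Fejer means.  In those only the terms
    z^(l - j) with j <= l survive, by [coef_lower]; against h, whose products
    with z^m have mean 0 for m > 0, only j = l is left. *)
Lemma circle_int_dilate h : L2 h -> (forall k : nat, (0 < k)%N -> circle_int (fun w => h w * w ^+ k) = 0) ->
  circle_int (fun w => tr w * h w) = theta 0 * circle_int h.
Proof.
move=> h2 hk.
have hJ := L2J h2.
have dotE f : dot f (fun z => Num.conj (h z)) = circle_int (fun w => f w * h w).
  by apply: eq_circle_int => t _; rewrite conjCK.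
rewrite -dotE; apply: (@dot_lim_const _ fejer_sum tr _ (2 * B)) => //.
- move=> n; apply: (@L2_bounded _ (2 * B)); first exact: measurable_fejer_sum.
  by move=> t _; exact: fejer_sum_le.
- exact: dilate_L2.
- by move=> n t _; exact: fejer_sum_le.
- by apply: (aeW mu) => t _ e e0; exact: fejer_sum_cvg.
move=> n; rewrite dotE.
have ci j l : citg (fun w => coef j l * (w ^+ l * Num.conj w ^+ j) * h w).
  have -> : (fun w => coef j l * (w ^+ l * Num.conj w ^+ j) * h w) =
      coef j l \*o ((fun w => w ^+ l * Num.conj w ^+ j) \* h).
    by apply/funext => w; exact/esym/mulrA.
  exact: (citgZ (coef j l) (citgM (L2_monomial l j) h2)).
have [_ e1] := double_sum_int n ci.
rewrite (@eq_circle_int _ _ (fun z => n.+1%:R^-1 * \sum_(j < n.+1) \sum_(l < n.+1)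
    (fun w => coef j l * (w ^+ l * Num.conj w ^+ j) * h w) z)); last first.
  move=> t _; rewrite /fejer_sum -mulrA; congr (_ * _); rewrite mulr_suml.
  by apply: eq_bigr => j _; rewrite mulr_suml.
rewrite e1.
have term j l : circle_int (fun w => coef j l * (w ^+ l * Num.conj w ^+ j) * h w) =
    (j == l)%:R * (theta 0 * circle_int h).
  have -> : circle_int (fun w => coef j l * (w ^+ l * Num.conj w ^+ j) * h w) =
      coef j l * circle_int (fun w => (w ^+ l * Num.conj w ^+ j) * h w).
    rewrite -circle_intZ; first by apply: eq_circle_int => t _; exact/esym/mulrA.
    exact: (citgM (L2_monomial l j) h2).
  have [lj|jl] := leqP l j.
    rewrite coef_lower//; have [<-|_] := eqVneq j l; last by rewrite !mul0r.
    rewrite !mul1r; congr (_ * _); apply: eq_circle_int => t _.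
    by rewrite -exprMn cis_norm expr1n mul1r.
  rewrite (_ : (j == l) = false); last by apply/eqP; lia.
  rewrite mul0r -[RHS](mulr0 (coef j l)); congr (_ * _).
  rewrite -(hk (l - j)%N); last by rewrite subn_gt0.
  apply: eq_circle_int => t _; rewrite [RHS]mulrC -(cis_expM t (l - j) j) subnK//.
  exact: ltnW.
under eq_bigr => j _.
  under eq_bigr => l _ do rewrite term.
  rewrite (bigD1 j)//= eqxx mul1r big1 ?addr0; last first.
    by move=> l /negPf lj; rewrite (_ : (j == l :> nat) = false) ?mul0r// eq_sym; exact: lj.
  over.
rewrite sumr_const card_ord -(mulr_natl (theta 0 * circle_int h) n.+1) mulKf//.
Qed.

End FejerSum.

(** * Measurability of the radial limit *)

Section Boundary.
Variable R : realType.
Local Notation arc := (@Defs.arc R).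
Local Notation C := (R[i]).
Variable theta : C -> C.
Hypothesis holo_theta : holo theta.

Let radial (t p : R) : C := theta (p%:C * cis t).

(** A countable base of left neighbourhoods of 1, as needed to write the set of
    angles with a radial limit by countable set operations. *)
Definition near_one (m : nat) (p : R) := 1 - m.+1%:R^-1 < p < 1.

Definition radial_limit t (l : C) := forall e : R, 0 < e -> exists m, forall p,
  near_one m p -> cabs (radial t p - l) <= e.

Lemma near_one_unit m p : near_one m p -> 0 < p < 1.
Proof.
move=> /andP[p0 ->]; rewrite andbT; apply: le_lt_trans p0.
by rewrite subr_ge0 invf_le1 ?ltr0n// ler1n.
Qed.

Lemma near_one_mono m n p : (m <= n)%N -> near_one n p -> near_one m p.
Proof.
move=> mn /andP[np p1]; apply/andP; split=> //; apply: le_lt_trans np.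
by rewrite lerD2l lerN2 lef_pV2 ?posrE ?ltr0n// ler_nat ltnS.
Qed.

Lemma small_inv (d : R) : 0 < d -> exists m, m.+1%:R^-1 < d.
Proof.
move=> d0; exists (Num.truncn d^-1); rewrite invf_plt ?posrE//.
exact: truncnS_gt.
Qed.

Lemma near_one_nonempty m : exists p, near_one m p.
Proof.
exists (1 - m.+2%:R^-1); apply/andP; split; last by rewrite gtrBl invr_gt0.
by rewrite ltrD2l ltrN2 ltf_pV2 ?posrE// ltr_nat.
Qed.

Lemma near_oneP (P : R -> Prop) :
  (\forall p \near (1 : R)^'-, P p) <-> exists m, forall p, near_one m p -> P p.
Proof.
split=> [|[m mP]].
  rewrite near_withinE => /nbhs_normP[d /= d0 dP].
  have [m md] := small_inv d0; exists m => p /andP[mp p1].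
  have pd : ball_ Num.norm 1 d p.
    by rewrite /ball_ /= gtr0_norm; move: (m.+1%:R^-1) md mp => x; lra.
  exact: (dP p pd p1).
near=> p; apply: mP; apply/andP; split.
  by near: p; apply: nbhs_left_gt; rewrite gtrBl invr_gt0.
by near: p; exact: nbhs_left_lt.
Unshelve. all: by end_near. Qed.

Lemma radial_limitP t (l : C) : radial_limit t l <->
  ((theta (r%:C * cis t) : C^o) @[r --> (1 : R)^'-] --> (l : C^o)).
Proof.
split=> [rl|/cvgrPdist_le cl].
  apply/cvgrPdist_le => e /pos_complex[e' e0 ->].
  have /near_oneP := rl e' e0; apply: filterS => p h.
  by rewrite distrC cabsE lecR.
move=> e e0; have e0' : 0 < e%:C :> C by rewrite ltcR.
have /near_oneP[m mP] := cl _ e0'; exists m => p /mP.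
by rewrite distrC cabsE lecR.
Qed.

Lemma bdry_radial_limit t (l : C) : radial_limit t l -> bdry theta (cis t) = l.
Proof.
by move=> /radial_limitP cl; apply: (@cvg_lim (C^o : normedModType C)).
Qed.

Definition rat_pt (i : nat) : R := ratr (odflt 0 (unpickle i) : rat).

Lemma rat_pt_dense a b : a < b -> exists i, a < rat_pt i < b.
Proof.
move=> /rat_in_itvoo[q]; rewrite in_itv /= => qab.
by exists (pickle q); rewrite /rat_pt pickleK.
Qed.

(** The Cauchy criterion for radial limits, restricted to rational radii so
    that it defines a Borel set of angles; continuity in the radius recovers
    the other radii. *)
Definition radial_cauchy t := forall k, exists m, forall i j,
  near_one m (rat_pt i) -> near_one m (rat_pt j) ->
  cabs (radial t (rat_pt i) - radial t (rat_pt j)) <= k.+1%:R^-1.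

Lemma radial_cont t p (e : R) : 0 <= p < 1 -> 0 < e -> exists2 d : R, 0 < d &
  forall q, `|q - p| < d -> cabs (radial t q - radial t p) <= e.
Proof.
move=> /andP[p0 p1] e0.
have pt : cabs (p%:C * cis t) < 1 by rewrite cabsM cabs_cis mulr1 cabsR ger0_norm.
have [d d0 dP] := holo_continuous holo_theta pt e0; exists d => // q qp.
by apply: dP; rewrite -mulrBl cabsM cabs_cis mulr1 -rmorphB cabsR.
Qed.

Lemma rat_pt_near t m p (e : R) : near_one m p -> 0 < e -> exists2 i,
  near_one m (rat_pt i) & cabs (radial t p - radial t (rat_pt i)) <= e.
Proof.
move=> mp e0; have /andP[p0 p1] := near_one_unit mp.
have p01 : 0 <= p < 1 by rewrite ltW.
have [d d0 dP] := radial_cont t p01 e0.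
have [i /andP[i1 i2]] : exists i, Num.max (1 - m.+1%:R^-1) (p - d) < rat_pt i < p.
  by apply: rat_pt_dense; rewrite gt_max; case/andP: mp => -> _ /=; lra.
move: i1; rewrite gt_max => /andP[i1 i3].
exists i; first by rewrite /near_one i1 (lt_trans i2).
by rewrite -cabsN opprB; apply: dP; rewrite ltr0_norm; lra.
Qed.

Lemma radial_cauchyP t : radial_cauchy t <-> exists l, radial_limit t l.
Proof.
split=> [rc|[l rl] k]; last first.
  have e0 : 0 < k.+1%:R^-1 / 2 :> R by rewrite divr_gt0.
  have [m mP] := rl _ e0; exists m => i j mi mj.
  have -> : radial t (rat_pt i) - radial t (rat_pt j) =
    (radial t (rat_pt i) - l) - (radial t (rat_pt j) - l) by ring.
  apply: le_trans (cabsB _ _) _; have := mP _ mi; have := mP _ mj.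
  by move: (k.+1%:R^-1) => x; lra.
have rc' (e : R) : 0 < e -> exists m, forall p q, near_one m p -> near_one m q ->
    cabs (radial t p - radial t q) <= e.
  move=> e0; have e3 : 0 < e / 3 by rewrite divr_gt0.
  have [k ke] := small_inv e3; have [m mP] := rc k; exists m => p q mp mq.
  have [i mi pi_] := rat_pt_near t mp e3; have [j mj qj] := rat_pt_near t mq e3.
  have -> : radial t p - radial t q = (radial t p - radial t (rat_pt i)) +
     (radial t (rat_pt i) - radial t (rat_pt j)) - (radial t q - radial t (rat_pt j)) by ring.
  apply: le_trans (cabsB _ _) _; have := cabsD (radial t p - radial t (rat_pt i)) (radial t (rat_pt i) - radial t (rat_pt j)).
  by have := mP i j mi mj; move: (k.+1%:R^-1) ke {mP} => x; lra.
have comp (P : C -> R) : (forall x y, `|P x - P y| <= cabs (x - y)) ->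
    exists a : R, forall e : R, 0 < e -> exists m, forall p, near_one m p -> `|P (radial t p) - a| <= e.
  move=> PP.
  have : cvg (P (radial t p) @[p --> (1 : R)^'-]).
    apply/cauchy_cvgP/cauchy_exP => e e0.
    have e2 : 0 < e / 2 by rewrite divr_gt0.
    have [m mP] := rc' _ e2; have [p0 mp0] := near_one_nonempty m.
    exists (P (radial t p0)); apply/near_oneP; exists m => p mp.
    rewrite /ball /=; apply: le_lt_trans (PP _ _) _.
    by apply: le_lt_trans (mP _ _ mp0 mp) _; lra.
  move=> /cvg_ex[a /cvgrPdist_le ca]; exists a => e e0.
  by have /near_oneP[m mP] := ca e e0; exists m => p /mP; rewrite distrC.
have [|a aP] := comp (@complex.Re R).
  by move=> x y; rewrite -ReN -ReD; exact: Re_le_cabs.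
have [|b bP] := comp (@complex.Im R).
  by move=> x y; rewrite -ImN -ImD; exact: Im_le_cabs.
exists (a +i* b) => e e0; have e2 : 0 < e / 2 by rewrite divr_gt0.
have [m1 m1P] := aP _ e2; have [m2 m2P] := bP _ e2.
exists (maxn m1 m2) => p mp.
apply: le_trans (cabs_le_sum _) _; rewrite ReD ImD ReN ImN /=.
have := m1P p (near_one_mono (leq_maxl _ _) mp).
have := m2P p (near_one_mono (leq_maxr _ _) mp).
by lra.
Qed.

Definition radius (n : nat) : R := 1 - n.+2%:R^-1.

Lemma radius_near m n : (m <= n)%N -> near_one m (radius n).
Proof.
move=> mn; apply: (near_one_mono mn); apply/andP; split; last by rewrite gtrBl invr_gt0.
by rewrite ltrD2l ltrN2 ltf_pV2 ?posrE// ltr_nat.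
Qed.

Lemma radius_unit n : 0 < radius n < 1.
Proof. exact: near_one_unit (radius_near (leqnn n)). Qed.

Lemma radial_limit_seq t l : radial_limit t l -> forall e : R, 0 < e ->
  exists N, forall n, (N <= n)%N -> cabs (radial t (radius n) - l) <= e.
Proof.
by move=> rl e e0; have [m mP] := rl e e0; exists m => n mn; exact/mP/radius_near.
Qed.

Lemma measurable_radial_cauchy : measurable ([set t | radial_cauchy t] : set (measurableTypeR R)).
Proof.
pose S k m i j : set (measurableTypeR R) := [set t | near_one m (rat_pt i) -> near_one m (rat_pt j) ->
  cabs (radial t (rat_pt i) - radial t (rat_pt j)) <= k.+1%:R^-1].
have -> : [set t | radial_cauchy t] = \bigcap_k \bigcup_m \bigcap_i \bigcap_j S k m i j.
  apply/seteqP; split => t /= rc k.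
    by move=> _; have [m mP] := rc k; exists m => // i _ j _; exact: mP.
  by have [m _ mP] := rc k I; exists m => i j; exact: (mP i I j I).
apply: bigcapT_measurable => k; apply: bigcupT_measurable => m.
apply: bigcapT_measurable => i; apply: bigcapT_measurable => j.
have [mi|nmi] := pselect (near_one m (rat_pt i)); last first.
  by have -> : S k m i j = setT; [apply/seteqP; split => t //= _ /nmi|exact: measurableT].
have [mj|nmj] := pselect (near_one m (rat_pt j)); last first.
  by have -> : S k m i j = setT; [apply/seteqP; split => t //= _ _ /nmj|exact: measurableT].
have unit01 p : near_one m p -> 0 <= p < 1 by move=> /near_one_unit/andP[/ltW -> ->].
have [ci1 ci2] := holo_circle_cont holo_theta (unit01 _ mi).
have [cj1 cj2] := holo_circle_cont holo_theta (unit01 _ mj).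
pose u t := (rpart (fun z => theta ((rat_pt i)%:C * z)) t - rpart (fun z => theta ((rat_pt j)%:C * z)) t) ^+ 2 +
  (ipart (fun z => theta ((rat_pt i)%:C * z)) t - ipart (fun z => theta ((rat_pt j)%:C * z)) t) ^+ 2.
have mu_ : measurable_fun setT u.
  apply: measurable_funD; apply: measurable_funX; apply: measurable_funB; exact: continuous_measurable_fun.
have -> : S k m i j = setT `&` u @^-1` `]-oo, (k.+1%:R^-1) ^+ 2].
  rewrite setTI; apply/seteqP; split => t; rewrite /S /= in_itv /=.
    move=> /(_ mi mj) h.
    rewrite [u t](_ : _ = cabs (radial t (rat_pt i) - radial t (rat_pt j)) ^+ 2); last first.
      by rewrite cabs_sqr /abssq ReD ImD ReN ImN.
    by apply: lerXn2r => //; rewrite nnegrE ?cabs_ge0// invr_ge0.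
  rewrite [u t](_ : _ = cabs (radial t (rat_pt i) - radial t (rat_pt j)) ^+ 2); last first.
    by rewrite cabs_sqr /abssq ReD ImD ReN ImN.
  by move=> h _ _; rewrite -ler_sqr ?nnegrE ?cabs_ge0// invr_ge0.
exact: mu_.
Qed.

(** The value of lim is one fixed default point wherever the limit does not
    exist. *)
Lemma bdry_dvg : exists c : C, forall t, ~ radial_cauchy t -> bdry theta (cis t) = c.
Proof.
eexists => t rc; rewrite /bdry dvgP//.
move=> /cvg_ex[l /radial_limitP rl].
by apply: rc; apply/radial_cauchyP; exists l.
Qed.

(** A pointwise limit of continuous functions on the Borel set where it exists,
    and a constant off that set. *)
Lemma measurable_bdry : measurable_circle (bdry theta).
Proof.
set E := [set t | radial_cauchy t].
have [c cP] := bdry_dvg.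
have part (P : C -> R) : (forall x y, `|P x - P y| <= cabs (x - y)) ->
    (forall n, measurable_fun arc (fun t => P (radial t (radius n)))) ->
    measurable_fun arc (fun t => P (bdry theta (cis t))).
  move=> PP mP.
  apply: (@measurable_fun_cvg _ _ _ arc
    (fun n t => \1_E t * (P (radial t (radius n)) - P c) + P c)) => [n|t At].
    apply: measurable_funD; last exact: measurable_cst.
    apply: measurable_funM; first by apply: measurable_indic; exact: measurable_radial_cauchy.
    by apply: measurable_funB; [exact: mP|exact: measurable_cst].
  have [Et|Et] := pselect (E t).
    have [l rl] := (radial_cauchyP t).1 Et.
    rewrite (bdry_radial_limit rl) indicE mem_set//.
    apply/cvgrPdist_le => e e0; have [N NP] := radial_limit_seq rl e0.
    exists N => // n /= Nn; rewrite mul1r subrK distrC.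
    exact: le_trans (PP _ _) (NP n Nn).
  rewrite (cP t Et) indicE memNset//.
  by under eq_fun do rewrite mul0r add0r; exact: cvg_cst.
have r01 n : 0 <= radius n < 1 by have /andP[/ltW -> ->] := radius_unit n.
split.
  apply: (part (@complex.Re R)) => [x y|n]; first by rewrite -ReN -ReD; exact: Re_le_cabs.
  by have [] := holo_circle_measurable holo_theta (r01 n).
apply: (part (@complex.Im R)) => [x y|n]; first by rewrite -ImN -ImD; exact: Im_le_cabs.
by have [] := holo_circle_measurable holo_theta (r01 n).
Qed.

End Boundary.

(** * The boundary function of an inner function *)

Section Inner.
Variable R : realType.
Local Notation mu := (@lebesgue_measure R).
Local Notation arc := (@Defs.arc R).
Local Notation C := (R[i]).
Variable theta : C -> C.
Hypothesis inner_theta : inner_function theta.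

Lemma inner_holo : holo theta. Proof. by case: inner_theta. Qed.

Lemma inner_bound : exists B : R, forall z, cabs z < 1 -> cabs (theta z) <= B.
Proof.
have [_ [B BP] _] := inner_theta; exists B => z z1.
by have := BP z; rewrite !cabsE -[1]/(1%:C) ltcR lecR; apply.
Qed.

Lemma bdry_unimodular : \forall t \ae mu, arc t ->
  bdry theta (cis t) * Num.conj (bdry theta (cis t)) = 1.
Proof.
have [_ _ ae1] := inner_theta; apply: ae_imp ae1 => t h At.
by have [_ e] := h At; rewrite -normCK e expr1n.
Qed.

Lemma bdry_Linfty : Linfty (bdry theta).
Proof.
split; first exact: measurable_bdry inner_holo.
exists 1; have [_ _ ae1] := inner_theta; apply: ae_imp ae1 => t h At.
by have [_ ->] := h At.
Qed.

(** For the dilates theta (r z) this is [circle_int_dilate]; they are bounded and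
    tend to the boundary function almost everywhere as r tends to 1. *)
Lemma circle_int_bdry h : L2 h ->
  (forall k : nat, (0 < k)%N -> circle_int (fun w => h w * w ^+ k) = 0) ->
  circle_int (fun w => bdry theta w * h w) = theta 0 * circle_int h.
Proof.
move=> h2 hk; have [B BP] := inner_bound.
have hJ := L2J h2.
have dotE f : dot f (fun z => Num.conj (h z)) = circle_int (fun w => f w * h w).
  by apply: eq_circle_int => t _; rewrite conjCK.
rewrite -dotE.
apply: (@dot_lim_const _ (fun n z => theta ((radius R n)%:C * z)) (bdry theta) _ B) => //.
- by move=> n; exact: (dilate_L2 inner_holo BP (radius_unit R n)).
- exact: Linfty_L2 bdry_Linfty.
- by move=> n t _; exact: (dilate_le BP (radius_unit R n)).
- have [_ _ ae1] := inner_theta; apply: ae_imp ae1 => t h1 At e e0.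
  have [/cvg_ex[l cl] _] := h1 At.
  have rl : radial_limit theta t l by exact/radial_limitP.
  rewrite (bdry_radial_limit rl); exact: (radial_limit_seq rl e0).
by move=> n; rewrite dotE; exact: (circle_int_dilate inner_holo BP (radius_unit R n)).
Qed.

End Inner.

(** * The Hardy space, its complement and the two shifts *)

Section HardySpace.
Variable R : realType.
Local Notation arc := (@Defs.arc R).
Local Notation C := (R[i]).
Local Notation fct := (C -> C).
Implicit Types (f g h w : fct).

Definition zmul f : fct := fun z => z * f z.
Definition zbar f : fct := fun z => Num.conj z * f z.
Definition mean f : C := circle_int f.
(** The backward shift (f - f 0) / z, the mean of f in H^2 being f 0. *)
Definition backward f : fct := fun z => Num.conj z * (f z - mean f).

Lemma L2_zmul f : L2 f -> L2 (zmul f).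
Proof. exact/L2_mul/Linfty_id. Qed.

Lemma L2_zbar f : L2 f -> L2 (zbar f).
Proof. exact/L2_mul/LinftyJ/Linfty_id. Qed.

Lemma L2_ext f g : (forall t, arc t -> f (cis t) = g (cis t)) -> L2 f -> L2 g.
Proof.
move=> fg /L2E[[mr ir] [mi ii]].
have e1 t : arc t -> rpart f t = rpart g t by move=> At; rewrite /rpart fg.
have e2 t : arc t -> ipart f t = ipart g t by move=> At; rewrite /ipart fg.
apply/L2E; split; split.
- by apply: eq_measurable_fun mr => t /set_mem; exact: e1.
- apply: (eq_integrable (@measurable_arc R) _ _ _ ir) => t /set_mem At /=.
  by rewrite e1.
- by apply: eq_measurable_fun mi => t /set_mem; exact: e2.
- apply: (eq_integrable (@measurable_arc R) _ _ _ ii) => t /set_mem At /=.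
  by rewrite e2.
Qed.

Lemma dot_zmul f g : dot (zmul f) g = dot f (zbar g).
Proof. exact: (dot_mul (fun z => z) f g). Qed.

Lemma dot_zbar f g : dot (zbar f) g = dot f (zmul g).
Proof.
rewrite (dot_mul (fun z => Num.conj z)); apply: eq_circle_int => t _ /=.
by rewrite /zmul conjCK.
Qed.

Lemma dot_zmul2 f g : dot (zmul f) (zmul g) = dot f g.
Proof.
rewrite dot_zmul; apply: eq_circle_int => t _.
by rewrite /zbar /zmul mulrA [_ * cis t]mulrC cis_norm mul1r.
Qed.

Lemma dot_zbar2 f g : dot (zbar f) (zbar g) = dot f g.
Proof.
rewrite dot_zbar; apply: eq_circle_int => t _.
by rewrite /zbar /zmul mulrA cis_norm mul1r.
Qed.

Lemma dot_cst1 f : dot f (cst 1) = mean f.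
Proof. by apply: eq_circle_int => t _; rewrite /cst rmorph1 mulr1. Qed.

Lemma citg_L2 f : L2 f -> citg f.
Proof.
move=> f2; have := citgM f2 (L2_cst 1).
by have -> : f \* cst 1 = f by apply/funext => z /=; rewrite mulr1.
Qed.

Lemma dot_conj f g : dot f (fun z => Num.conj (g z)) = mean (f \* g).
Proof. by apply: eq_circle_int => t _; rewrite conjCK. Qed.

(** The powers of z of negative exponent, whose orthogonal complement H^2 is;
    this makes the lemmas on orthogonal complements available for H^2. *)
Definition neg_exp (k : nat) : fct := fun z => Num.conj z ^+ k.+1.

Lemma L2_neg_exp k : L2 (neg_exp k).
Proof.
have := L2_monomial R 0 k.+1.
by congr L2; apply/funext => z; rewrite /neg_exp expr0 mul1r.
Qed.

Lemma dot_neg_exp f k : dot f (neg_exp k) = circle_int (fun z => f z * z ^+ k.+1).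
Proof. by apply: eq_circle_int => t _; rewrite /neg_exp rmorphXn/= conjCK. Qed.

Lemma H2E : @H2 R = orth (range neg_exp).
Proof.
apply/seteqP; split => f [f2 fn]; split=> //.
  move=> _ [k _ <-]; rewrite dot_neg_exp.
  by rewrite -[RHS](fn (Negz k)).
case=> // k _; rewrite -[RHS](fn (neg_exp k)); last by exists k.
by rewrite dot_neg_exp.
Qed.

Lemma H2_L2 f : H2 f -> L2 f. Proof. by case. Qed.

Lemma H2P f : L2 f -> (forall k, circle_int (fun z => f z * z ^+ k.+1) = 0) -> H2 f.
Proof. by move=> f2 fk; rewrite H2E; split=> // _ [k _ <-]; rewrite dot_neg_exp. Qed.

Lemma H2_coef f k : H2 f -> circle_int (fun z => f z * z ^+ k.+1) = 0.
Proof. by rewrite H2E => -[_ fk]; rewrite -dot_neg_exp; apply: fk; exists k. Qed.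

Lemma range_neg_exp_L2 : range neg_exp `<=` @L2 R.
Proof. by move=> _ [k _ <-]; exact: L2_neg_exp. Qed.

Lemma H2B f g : H2 f -> H2 g -> H2 (f \- g).
Proof. by rewrite H2E; exact: (orthB range_neg_exp_L2). Qed.

Lemma H2Z (c : C) f : H2 f -> H2 (c \*o f).
Proof. by rewrite H2E; exact: (orthZ range_neg_exp_L2). Qed.

Lemma H2_cst (c : C) : H2 (cst c).
Proof.
apply: H2P => [|k]; first exact: L2_cst.
have := circle_int_exp R k.+1 => /= e.
rewrite (circle_intZ c (f := fun z => z ^+ k.+1)) ?e ?mulr0//.
apply: citg_L2; have := L2_monomial R k.+1 0.
by congr L2; apply/funext => z; rewrite expr0 mulr1.
Qed.

Lemma H2_zmul f : H2 f -> H2 (zmul f).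
Proof.
move=> Hf; apply: H2P => [|k]; first exact/L2_zmul/H2_L2.
rewrite -(H2_coef k.+1 Hf); apply: eq_circle_int => t _.
by rewrite /zmul [in RHS]exprS; ring.
Qed.

Lemma mean_zmul f : H2 f -> mean (zmul f) = 0.
Proof.
move=> Hf; rewrite -(H2_coef 0 Hf); apply: eq_circle_int => t _.
by rewrite /zmul expr1 mulrC.
Qed.

Lemma mean_cst (c : C) : mean (cst c) = c.
Proof. exact: circle_int_cst. Qed.

Lemma meanZ (c : C) f : L2 f -> mean (c \*o f) = c * mean f.
Proof. by move=> f2; apply: circle_intZ; exact: citg_L2. Qed.

Lemma meanB f g : L2 f -> L2 g -> mean (f \- g) = mean f - mean g.
Proof.
move=> f2 g2; rewrite -!dot_cst1 dotBl//; exact: L2_cst.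
Qed.

Lemma meanJ f : L2 f -> mean (fun z => Num.conj (f z)) = Num.conj (mean f).
Proof. by move=> f2; apply: circle_intJ; exact: citg_L2. Qed.

Lemma dot_cst (c : C) f : L2 f -> dot (cst c) f = c * Num.conj (mean f).
Proof. by move=> f2; rewrite -meanJ// -meanZ//; exact: L2J. Qed.

Lemma dot_cstr (c : C) f : L2 f -> dot f (cst c) = Num.conj c * mean f.
Proof.
by move=> f2; rewrite -meanZ//; apply: eq_circle_int => t _; rewrite mulrC.
Qed.

Lemma backwardE f : backward f = zbar (f \- cst (mean f)).
Proof. by []. Qed.

Lemma L2_backward f : L2 f -> L2 (backward f).
Proof. by move=> f2; rewrite backwardE; apply/L2_zbar/L2B => //; exact: L2_cst. Qed.

Lemma H2_backward f : H2 f -> H2 (backward f).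
Proof.
move=> Hf; have f2 := H2_L2 Hf; have c2 := @L2_cst R (mean f).
have Hg : H2 (f \- cst (mean f)) by apply: H2B => //; exact: H2_cst.
apply: H2P => [|k]; first exact: L2_backward.
rewrite (@eq_circle_int _ _ (fun z => (f \- cst (mean f)) z * z ^+ k)); last first.
  move=> t _; rewrite /backward exprS mulrACA -[RHS]mul1r -(cis_norm t) /=; ring.
case: k => [|k]; last exact: H2_coef.
rewrite (@eq_circle_int _ _ (f \- cst (mean f))); last by move=> t _; rewrite expr0 mulr1.
by rewrite [LHS](meanB f2 c2) mean_cst subrr.
Qed.

Lemma zmul_backward f t : zmul (backward f) (cis t) = f (cis t) - mean f.
Proof. by rewrite /zmul /backward mulrA cis_norm mul1r. Qed.

Lemma dot_zbar1_H2 f : H2 f -> dot (zbar (cst 1)) f = 0.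
Proof.
move=> Hf; have f2 := H2_L2 Hf.
by rewrite dot_zbar dot_cst ?mean_zmul ?rmorph0 ?mulr0//; exact: L2_zmul.
Qed.

Lemma H2minus_L2 f : H2minus f -> L2 f. Proof. by case. Qed.

Lemma neg_exp_H2minus k : H2minus (@neg_exp k).
Proof.
split=> [|h Hh]; first exact: L2_neg_exp.
rewrite (dotC (H2_L2 Hh) (L2_neg_exp k)) dot_neg_exp H2_coef// rmorph0 //.
Qed.

Lemma H2_sub_L2 : @H2 R `<=` @L2 R. Proof. by move=> f []. Qed.

Local Notation PM := (Defs.proj (@H2minus R)).

Lemma PM_in f : L2 f -> H2minus (PM f).
Proof. by move=> f2; have [] := projP H2_sub_L2 f2. Qed.

Lemma PM_L2 f : L2 f -> L2 (PM f). Proof. by move=> /PM_in/H2minus_L2. Qed.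

Lemma PM_dot f g : L2 f -> H2minus g -> dot (PM f) g = dot f g.
Proof.
move=> f2 Hg; have [_ [_ h]] := projP H2_sub_L2 f2; have g2 := H2minus_L2 Hg.
by apply/esym/subr0_eq; rewrite -dotBl ?h//; exact: PM_L2.
Qed.

Lemma PM_sym f g : L2 f -> L2 g -> dot (PM f) g = dot f (PM g).
Proof.
move=> f2 g2; rewrite -(PM_dot f2 (PM_in g2)).
rewrite (dotC (PM_L2 g2) (PM_L2 f2)) (PM_dot g2 (PM_in f2)).
by rewrite -dotC//; exact: PM_L2.
Qed.

(** Multiplication by z sends H^2_- into H^2_- plus the constants, the constant
    coming from the coefficient of 1 / z.  The difference of the two sides
    lies both in H^2_- and in H^2. *)
Lemma zmul_PM f : L2 f ->
  eqm (zmul (PM f)) (PM (zmul f) \+ cst (dot (PM f) (zbar (cst 1)))).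
Proof.
move=> f2; set n := PM f; set c := dot n _.
have n2 : L2 n by exact: PM_L2.
have zf2 := L2_zmul f2; have zn2 := L2_zmul n2.
have Pzf2 := PM_L2 zf2; have c2 := @L2_cst R c.
have s2 := L2D Pzf2 c2.
apply: eqm_dot => //.
set D := zmul n \- _; have D2 : L2 D by exact: L2B.
have DM : forall h, H2 h -> dot D h = 0.
  move=> h Hh; have h2 := H2_L2 Hh.
  rewrite dotBl// dotDl// dot_zmul (dot_cst c h2).
  have [_ ->//] := PM_in zf2; rewrite add0r.
  have hb2 := L2_backward h2.
  have m2 : L2 (zbar (cst (mean h))) by apply/L2_zbar/L2_cst.
  have -> : zbar h = backward h \+ zbar (cst (mean h)).
    by apply/funext => z; rewrite /zbar /backward /= -mulrDr subrK.
  rewrite dotDr//; have [_ ->] := PM_in f2; last exact: H2_backward.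
  have -> : zbar (cst (mean h)) = mean h \*o zbar (cst 1).
    by apply/funext => z; rewrite /zbar /= mulr1 mulrC.
  rewrite dotZr//; last by apply/L2_zbar/L2_cst.
  by rewrite -/c add0r mulrC subrr.
have DH : H2 D.
  rewrite H2E; split=> // _ [k _ <-]; have e2 := L2_neg_exp k.
  rewrite dotBl// dotDl// (dot_cst c e2) (PM_dot zf2 (neg_exp_H2minus k)).
  have ze : zbar (neg_exp k) = neg_exp k.+1.
    by apply/funext => z; rewrite /zbar /neg_exp [RHS]exprS.
  rewrite !dot_zmul ze (PM_dot f2 (neg_exp_H2minus k.+1)).
  have -> : mean (neg_exp k) = 0.
    transitivity (circle_int (fun w : C => w ^+ 0 * Num.conj w ^+ k.+1)).
      2: by rewrite circle_int_ortho.
    by apply: eq_circle_int => t _; rewrite expr0 mul1r.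
  by rewrite rmorph0 mulr0 addr0 subrr.
exact: DM.
Qed.

Lemma zbar_flipJ f : flipJ (zmul f) = zbar (flipJ f).
Proof. by apply/funext => z; rewrite /flipJ /zmul /zbar. Qed.

Lemma flipJ_cst (c : C) : flipJ (cst c) = zbar (cst c).
Proof. by []. Qed.

End HardySpace.

(** * The model space and the compressed shift *)

Section Model.
Variable R : realType.
Local Notation C := (R[i]).
Local Notation fct := (C -> C).
Implicit Types (f g h w x y : fct).
Variable theta : fct.
Hypothesis inner_theta : inner_function theta.

Local Notation b := (bdry theta).
Local Notation Kt := (model_space theta).
Local Notation k := (k0 theta).
Local Notation kt := (k0t theta).
Local Notation PK := (Defs.proj Kt).
Local Notation S := (cshift theta).
Local Notation Ss := (cshift_adj theta).
Local Notation t0 := (theta 0).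

Let b_Linfty := bdry_Linfty inner_theta.
Let b2 : L2 b := Linfty_L2 b_Linfty.

Lemma L2_bdryM f : L2 f -> L2 (b \* f).
Proof. exact: L2_mul. Qed.

(** In terms of boundary values: (theta h) 0 = theta 0 * h 0. *)
Lemma mean_bdry h : H2 h -> mean (b \* h) = t0 * mean h.
Proof.
move=> Hh; apply: (circle_int_bdry inner_theta (H2_L2 Hh)) => -[|j] // _.
exact: H2_coef.
Qed.

Lemma H2_bdry : H2 b.
Proof.
apply: H2P => // j.
have Hz : H2 (fun z : C => z ^+ j.+1).
  elim: j => [|j IH]; first by have := H2_zmul (@H2_cst R 1); congr H2; apply/funext => z; rewrite /zmul mulr1 expr1.
  by have := H2_zmul IH; congr H2; apply/funext => z; rewrite [RHS]exprS.
by rewrite [LHS](mean_bdry Hz) /mean circle_int_exp mulr0.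
Qed.

Lemma mean_bdry1 : mean b = t0.
Proof.
have := mean_bdry (@H2_cst R 1); rewrite mean_cst mulr1 => <-.
by apply: eq_circle_int => t _ /=; rewrite mulr1.
Qed.

Lemma dot_bdryM2 f g : L2 f -> L2 g -> dot (b \* f) (b \* g) = dot f g.
Proof.
move=> f2 g2; apply: eqm_circle_int.
- by apply/citg_measurable/citg_dot; exact: L2_bdryM.
- exact/citg_measurable/citg_dot.
apply: ae_imp (bdry_unimodular inner_theta) => t h At /=.
by rewrite conjM mulrACA h// mul1r.
Qed.

Lemma dot_bdry_bdryM h : L2 h -> dot b (b \* h) = Num.conj (mean h).
Proof.
move=> h2; rewrite -[RHS]mul1r -(dot_cst _ h2) -(dot_bdryM2 (@L2_cst R 1) h2).
by apply: eq_circle_int => t _ /=; rewrite mulr1.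
Qed.

(** A set with orthogonal complement the model space, so that [projP] applies to
    the latter. *)
Definition model_perp : set fct := range (@neg_exp R) `|` [set b \* h | h in @H2 R].

Lemma model_perp_L2 : model_perp `<=` @L2 R.
Proof. by move=> _ [[j _ <-]|[h /H2_L2 h2 <-]]; [exact: L2_neg_exp|exact: L2_bdryM]. Qed.

Lemma modelE : Kt = orth model_perp.
Proof.
apply/seteqP; split => f.
  move=> [Hf [f2 fb]]; split=> // g [Ng|Bg]; last exact: fb.
  by move: Hf; rewrite H2E => -[_]; apply.
move=> [f2 fN]; split; first by rewrite H2E; split=> // g Ng; apply: fN; left.
by split=> // g Bg; apply: fN; right.
Qed.

Lemma K_H2 f : Kt f -> H2 f. Proof. by case. Qed.
Lemma K_L2 f : Kt f -> L2 f. Proof. by move=> /K_H2/H2_L2. Qed.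

Lemma K_intro f : H2 f -> (forall h, H2 h -> dot f (b \* h) = 0) -> Kt f.
Proof. by move=> Hf fb; split=> //; split=> [|_ [h Hh <-]]; [exact: H2_L2|exact: fb]. Qed.

Lemma K_orth f h : Kt f -> H2 h -> dot f (b \* h) = 0.
Proof. by move=> [_ [_ fb]] Hh; apply: fb; exists h. Qed.

Lemma K_D f g : Kt f -> Kt g -> Kt (f \+ g).
Proof. by rewrite modelE; exact: (orthD model_perp_L2). Qed.

Lemma K_B f g : Kt f -> Kt g -> Kt (f \- g).
Proof. by rewrite modelE; exact: (orthB model_perp_L2). Qed.

Lemma K_Z (c : C) f : Kt f -> Kt (c \*o f).
Proof. by rewrite modelE; exact: (orthZ model_perp_L2). Qed.

Lemma PK_in f : L2 f -> Kt (PK f).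
Proof. by move=> f2; have [] := projP model_perp_L2 f2; rewrite -modelE. Qed.

Lemma PK_dot f g : L2 f -> Kt g -> dot (PK f) g = dot f g.
Proof.
move=> f2 Kg; have := projP model_perp_L2 f2; rewrite -modelE => -[_ [_ h]].
by apply/esym/subr0_eq; rewrite -dotBl ?h//; [exact/K_L2/PK_in|exact: K_L2].
Qed.

Lemma PK_dotr f g : L2 f -> Kt g -> dot g (PK f) = dot g f.
Proof.
move=> f2 Kg; have g2 := K_L2 Kg.
by rewrite (dotC (K_L2 (PK_in f2)) g2) PK_dot// -dotC.
Qed.

Lemma K_eqm x y : Kt x -> Kt y -> (forall g, Kt g -> dot x g = dot y g) -> eqm x y.
Proof.
move=> Kx Ky xy; apply: eqm_dot; [exact: K_L2|exact: K_L2|].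
have x2 := K_L2 Kx; have y2 := K_L2 Ky; have KB := K_B Kx Ky.
by rewrite (dotBl x2 y2 (K_L2 KB)) xy// subrr.
Qed.

Lemma dot_K_bdry f : Kt f -> dot f b = 0.
Proof.
move=> Kf; rewrite -[RHS](K_orth Kf (@H2_cst R 1)).
by apply: eq_circle_int => t _ /=; rewrite mulr1.
Qed.

Lemma dot_bdry_K f : Kt f -> dot b f = 0.
Proof. by move=> Kf; rewrite (dotC (K_L2 Kf) b2) dot_K_bdry// rmorph0. Qed.

(** k is the projection of 1: mean (b h) = theta 0 * mean h makes it orthogonal
    to b h. *)
Lemma K_k0 : Kt k.
Proof.
have e : k = cst 1 \- (Num.conj t0 \*o b) by [].
have c2 := @L2_cst R 1; have tb2 := L2Z (Num.conj t0) b2.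
rewrite e; apply: K_intro => [|h Hh].
  by apply: H2B; [exact: H2_cst|exact/H2Z/H2_bdry].
have h2 := H2_L2 Hh; have bh2 := L2_bdryM h2.
rewrite dotBl// dotZl// dot_bdry_bdryM// dot_cst// mul1r mean_bdry//.
by rewrite conjM subrr.
Qed.

(** k reproduces the value at 0. *)
Lemma dot_k0 f : Kt f -> dot f k = mean f.
Proof.
move=> Kf; have f2 := K_L2 Kf; have c2 := @L2_cst R 1; have tb2 := L2Z (Num.conj t0) b2.
have -> : dot f k = dot f (cst 1 \- (Num.conj t0 \*o b)) by [].
by rewrite dotBr// dotZr// dot_K_bdry// mulr0 subr0 dot_cst1.
Qed.

Lemma k0t_circle t : kt (cis t) = zbar (b \- cst t0) (cis t).
Proof. by rewrite /k0t /zbar cisV mulrC. Qed.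

Lemma k0t_L2 : L2 kt.
Proof.
apply: (@L2_ext _ (zbar (b \- cst t0))) => [t _|]; first by rewrite k0t_circle.
by apply/L2_zbar/L2B => //; exact: L2_cst.
Qed.

Lemma dot_k0t_zmulr f : dot f kt = dot (zmul f) (b \- cst t0).
Proof. by rewrite dot_zmul; apply: eq_circle_int => t _; rewrite k0t_circle. Qed.

Lemma dot_k0t_zmull f : dot kt f = dot (b \- cst t0) (zmul f).
Proof. by rewrite -dot_zbar; apply: eq_circle_int => t _; rewrite k0t_circle. Qed.

Lemma K_k0t : Kt kt.
Proof.
have c2 := @L2_cst R t0; have k2 := k0t_L2.
apply: K_intro => [|h Hh].
  apply: H2P => // j.
  have Hb : H2 (b \- cst t0) by apply: H2B; [exact: H2_bdry|exact: H2_cst].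
  rewrite (@eq_circle_int _ _ (fun z => (b \- cst t0) z * z ^+ j)); last first.
    move=> t _; rewrite k0t_circle /zbar exprS mulrACA.
    by rewrite [Num.conj _ * _]mulrC cis_norm mul1r.
  case: j => [|j]; last exact: H2_coef.
  rewrite (@eq_circle_int _ _ (b \- cst t0)); last by move=> t _; rewrite expr0 mulr1.
  by rewrite [LHS](meanB b2 c2) mean_bdry1 mean_cst subrr.
have Hz := H2_zmul Hh; have z2 := H2_L2 Hz; have bz2 := L2_bdryM z2.
rewrite dot_k0t_zmull.
have -> : zmul (b \* h) = b \* zmul h by apply/funext => z; rewrite /zmul /= mulrCA.
by rewrite dotBl// dot_bdry_bdryM// dot_cst// mean_bdry// mean_zmul// mulr0 rmorph0 mulr0 subrr.
Qed.

Lemma dot_k0t f : Kt f -> dot f kt = dot (zmul f) b.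
Proof.
move=> Kf; have f2 := K_L2 Kf; have c2 := @L2_cst R t0; have z2 := L2_zmul f2.
by rewrite dot_k0t_zmulr dotBr// dot_cstr// mean_zmul ?mulr0 ?subr0//; exact: K_H2.
Qed.

(** Since z f is orthogonal to z b h for h in H^2, its component outside the
    model space is the one along b. *)
Definition explicit_shift f : fct := zmul f \- (dot (zmul f) b \*o b).

Lemma K_explicit_shift f : Kt f -> Kt (explicit_shift f).
Proof.
move=> Kf; have Hf := K_H2 Kf; have f2 := K_L2 Kf; have z2 := L2_zmul f2.
set c := dot (zmul f) b; have cb2 := L2Z c b2.
apply: K_intro => [|h Hh]; first by apply: H2B; [exact: H2_zmul|exact/H2Z/H2_bdry].
have h2 := H2_L2 Hh; have bh2 := L2_bdryM h2.
have Hh' := H2_backward Hh; have h'2 := H2_L2 Hh'; have zh'2 := L2_zmul h'2.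
have cb'2 := L2Z (mean h) b2; have bzh2 := L2_bdryM zh'2.
rewrite (dotBl z2 cb2 bh2) (dotZl c b2 bh2) (dot_bdry_bdryM h2).
have -> : dot (zmul f) (b \* h) = dot (zmul f) ((mean h \*o b) \+ (b \* zmul (backward h))).
  by apply: eq_circle_int => t _ /=; rewrite zmul_backward; congr (_ * Num.conj _); ring.
rewrite dotDr// dotZr// -/c.
have -> : b \* zmul (backward h) = zmul (b \* backward h).
  by apply/funext => z; rewrite /zmul /= mulrCA.
by rewrite dot_zmul2 K_orth// addr0 mulrC subrr.
Qed.

Lemma K_cshift f : Kt f -> Kt (S f).
Proof. by move=> Kf; apply/PK_in/L2_zmul/K_L2. Qed.

Lemma dot_cshift f g : Kt f -> Kt g -> dot (S f) g = dot (zmul f) g.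
Proof. by move=> Kf Kg; apply: PK_dot => //; exact/L2_zmul/K_L2. Qed.

Lemma cshift_eqm f : Kt f -> eqm (S f) (explicit_shift f).
Proof.
move=> Kf; apply: K_eqm => [||g Kg]; [exact: K_cshift|exact: K_explicit_shift|].
have f2 := K_L2 Kf; have z2 := L2_zmul f2; have g2 := K_L2 Kg.
set c := dot (zmul f) b; have cb2 := L2Z c b2.
by rewrite dot_cshift// dotBl// dotZl// dot_bdry_K// mulr0 subr0.
Qed.

Lemma K_backward f : Kt f -> Kt (backward f).
Proof.
move=> Kf; have Hf := K_H2 Kf; have f2 := K_L2 Kf; have c2 := @L2_cst R (mean f).
apply: K_intro => [|h Hh]; first exact: H2_backward.
have Hz := H2_zmul Hh; have z2 := H2_L2 Hz; have bz2 := L2_bdryM z2.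
rewrite backwardE dot_zbar.
have -> : zmul (b \* h) = b \* zmul h by apply/funext => z; rewrite /zmul /= mulrCA.
by rewrite dotBl// K_orth// dot_cst// mean_bdry// mean_zmul// mulr0 rmorph0 mulr0 subrr.
Qed.

Lemma adjointP (X : fct -> fct) g h : Kt h -> (forall f, Kt f -> dot (X f) g = dot f h) ->
  Kt (adjoint Kt X g) /\ forall f, Kt f -> dot (X f) g = dot f (adjoint Kt X g).
Proof.
move=> Kh Xh; rewrite /adjoint.
by case: xgetP => [y _ //|no]; case: (no h).
Qed.

Lemma cshift_adjP g : Kt g -> Kt (Ss g) /\ forall f, Kt f -> dot (S f) g = dot f (Ss g).
Proof.
move=> Kg; have zg2 := L2_zbar (K_L2 Kg).
apply: (@adjointP _ _ (PK (zbar g))); first exact: PK_in.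
by move=> f Kf; rewrite dot_cshift// dot_zmul PK_dotr.
Qed.

Lemma K_cshift_adj g : Kt g -> Kt (Ss g).
Proof. by move=> /cshift_adjP[]. Qed.

Lemma dot_shift_adj f g : Kt f -> Kt g -> dot (S f) g = dot f (Ss g).
Proof. by move=> Kf /cshift_adjP[_]; apply. Qed.

Lemma dot_adj_shift f g : Kt f -> Kt g -> dot (Ss f) g = dot f (S g).
Proof.
move=> Kf Kg.
have KS := K_cshift Kg; have KSs := K_cshift_adj Kf.
rewrite (dotC (K_L2 Kg) (K_L2 KSs)) -dot_shift_adj//.
by rewrite -dotC//; exact: K_L2.
Qed.

(** The model space is stable under the backward shift, which is the adjoint of
    multiplication by z on H^2. *)
Lemma cshift_adj_eqm f : Kt f -> eqm (Ss f) (backward f).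
Proof.
move=> Kf; have KSs := K_cshift_adj Kf; have Kb := K_backward Kf.
apply: K_eqm => // g Kg.
have f2 := K_L2 Kf; have g2 := K_L2 Kg; have zg2 := L2_zmul g2; have c2 := @L2_cst R (mean f).
rewrite dot_adj_shift// (dotC (K_L2 (K_cshift Kg)) f2) dot_cshift// -dotC//.
by rewrite backwardE dot_zbar dotBl// dot_cst// mean_zmul ?rmorph0 ?mulr0 ?subr0//; exact: K_H2.
Qed.

(** S S^* = 1 - k0 (x) k0, because |S^* f|^2 = |f - mean f|^2 on the circle and
    mean f = <f, k0>. *)
Lemma dot_adj_adj f g : Kt f -> Kt g ->
  dot (Ss f) (Ss g) = dot f g - dot f k * dot k g.
Proof.
move=> Kf Kg; have f2 := K_L2 Kf; have g2 := K_L2 Kg.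
have cf2 := @L2_cst R (mean f); have cg2 := @L2_cst R (mean g).
rewrite (dot_eqm (K_L2 (K_cshift_adj Kf)) (K_L2 (K_backward Kf)) (K_L2 (K_cshift_adj Kg))
  (K_L2 (K_backward Kg)) (cshift_adj_eqm Kf) (cshift_adj_eqm Kg)).
have k2 := K_L2 K_k0; have fB2 := L2B f2 cf2; have gB2 := L2B g2 cg2.
rewrite !backwardE dot_zbar2 (dotC g2 k2) !dot_k0// dotBr// !dotBl// !dot_cstr//.
by rewrite dot_cst// mean_cst; ring.
Qed.

(** S^* S = 1 - k0t (x) k0t, because multiplication by z is isometric and
    S f differs from z f by <z f, b> b = <f, k0t> b. *)
Lemma dot_shift_shift f g : Kt f -> Kt g ->
  dot (S f) (S g) = dot f g - dot f kt * dot kt g.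
Proof.
move=> Kf Kg; have f2 := K_L2 Kf; have g2 := K_L2 Kg.
have zf2 := L2_zmul f2; have zg2 := L2_zmul g2; have k2 := K_L2 K_k0t.
have KSg := K_cshift Kg; have KFg := K_explicit_shift Kg.
rewrite dot_cshift// (dot_eqm zf2 zf2 (K_L2 KSg) (K_L2 KFg) (eqm_refl _) (cshift_eqm Kg)).
have cb2 := L2Z (dot (zmul g) b) b2.
rewrite /explicit_shift dotBr// dotZr// dot_zmul2 (dotC g2 k2) !dot_k0t//.
by rewrite mulrC.
Qed.

(** S^* k0 = - (theta 0)^* k0t. *)
Lemma dot_k0_shift g : Kt g -> dot k (S g) = - Num.conj t0 * dot kt g.
Proof.
move=> Kg; have g2 := K_L2 Kg; have zg2 := L2_zmul g2; have k2 := K_L2 K_k0t.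
have kk2 := K_L2 K_k0; have c2 := @L2_cst R 1; have tb2 := L2Z (Num.conj t0) b2.
rewrite (dotC (K_L2 (K_cshift Kg)) kk2) (dot_cshift Kg K_k0) -(dotC zg2 kk2).
have -> : dot k (zmul g) = dot (cst 1 \- (Num.conj t0 \*o b)) (zmul g) by [].
rewrite dotBl// dotZl// dot_cst// mean_zmul; last exact: K_H2.
rewrite rmorph0 mulr0 sub0r mulNr; congr (- (_ * _)).
by rewrite (dotC zg2 b2) (dotC g2 k2) dot_k0t.
Qed.

(** S k0t = - theta 0 k0. *)
Lemma dot_k0t_adj g : Kt g -> dot kt (Ss g) = - t0 * dot k g.
Proof.
move=> Kg; have g2 := K_L2 Kg; have k2 := K_L2 K_k0t; have kk2 := K_L2 K_k0.
have KSs := K_cshift_adj Kg; have Kb := K_backward Kg.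
rewrite (dot_eqm k2 k2 (K_L2 KSs) (K_L2 Kb) (eqm_refl _) (cshift_adj_eqm Kg)).
have c2 := @L2_cst R t0; have cg2 := @L2_cst R (mean g); have gB2 := L2B g2 cg2.
have zb2 := L2_zmul (K_L2 Kb).
rewrite dot_k0t_zmull.
have -> : dot (b \- cst t0) (zmul (backward g)) = dot (b \- cst t0) (g \- cst (mean g)).
  by apply: eq_circle_int => t _; rewrite zmul_backward.
rewrite dotBl// !dotBr// dot_bdry_K// dot_cstr// mean_bdry1 !dot_cst// mean_cst.
by rewrite (dotC g2 kk2) dot_k0//; ring.
Qed.

End Model.

(** * Sums of tensors *)

Section FiniteRank.
Variable R : realType.
Local Notation C := (R[i]).
Local Notation fct := (C -> C).
Implicit Types (f g h w x y : fct) (p q : nat -> fct).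

(** Families indexed by nat rather than by 'I_n let induction on n proceed
    without reindexing. *)
Definition tensor_sum n p q f : fct := fun z => \sum_(j < n) dot f (q j) * p j z.

Lemma tensor_sumS n p q f : tensor_sum n.+1 p q f =
  tensor_sum n p q f \+ (dot f (q n) \*o p n).
Proof. by apply/funext => z; rewrite /tensor_sum big_ord_recr. Qed.

Lemma L2_tensor_sum n p q f : (forall j, L2 (p j)) -> L2 (tensor_sum n p q f).
Proof.
move=> p2; elim: n => [|n IH]; last by rewrite tensor_sumS; apply: L2D => //; exact: L2Z.
have -> : tensor_sum 0 p q f = \0 by apply/funext => z; rewrite /tensor_sum big_ord0.
exact: L2_0.
Qed.

Lemma tensor_sum_bounded n p q : (forall j, L2 (p j)) -> (forall j, L2 (q j)) ->
  exists2 M, 0 <= M & forall f, L2 f -> normsq (tensor_sum n p q f) <= M * normsq f.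
Proof.
move=> p2 q2; elim: n => [|n [M M0 MP]].
  exists 0 => // f f2; rewrite mul0r.
  have -> : tensor_sum 0 p q f = \0 by apply/funext => z; rewrite /tensor_sum big_ord0.
  by rewrite /normsq dot0l//; exact: L2_0.
have qp : 0 <= (normsq (q n) + 1) * normsq (p n).
  by rewrite mulr_ge0 ?addr_ge0 ?normsq_ge0.
exists (2 * M + 2 * ((normsq (q n) + 1) * normsq (p n))) => [|f f2].
  by rewrite addr_ge0// mulr_ge0.
rewrite tensor_sumS; apply: le_trans (normsqD_le (L2_tensor_sum n q f p2) (L2Z _ (p2 n))) _.
rewrite (normsqZ _ (p2 n)); have := MP f f2.
have := ler_wpM2r (normsq_ge0 (p2 n)) (cauchy_schwarz_weak f2 (q2 n)).
move: (normsq _) (normsq f) (normsq (p n)) (normsq (q n)) (abssq _) => a c d e r; lra.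
Qed.

Lemma tensor_sum_lin n p q (a : C) f g : (forall j, L2 (q j)) -> L2 f -> L2 g ->
  tensor_sum n p q ((a \*o f) \+ g) = (a \*o tensor_sum n p q f) \+ tensor_sum n p q g.
Proof.
move=> q2 f2 g2; have af2 := L2Z a f2.
apply/funext => z; rewrite /tensor_sum /= mulr_sumr -big_split; apply: eq_bigr => j _ /=.
by rewrite dotDl// dotZl//; ring.
Qed.

Lemma eqm_sum (I : Type) (s : seq I) (F G : I -> fct) : (forall i, eqm (F i) (G i)) ->
  eqm (fun z => \sum_(i <- s) F i z) (fun z => \sum_(i <- s) G i z).
Proof.
move=> FG; elim: s => [|i s IH].
  by apply: eq_eqm => t _; rewrite !big_nil.
apply: (eqm_trans (g := F i \+ (fun z => \sum_(i <- s) F i z))).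
  by apply: eq_eqm => t _; rewrite big_cons.
apply: (eqm_trans (eqmD (FG i) IH)).
by apply: eq_eqm => t _; rewrite big_cons.
Qed.

Variable M : set fct.
Hypothesis M2 : M `<=` @L2 R.

(** Given n.+1 vectors g i, the n.+1 rows of coefficients (dot (g i) (q j))_j
    have length n, hence satisfy a linear relation. *)
Lemma finite_rank n p q (X : fct -> fct) :
  (forall j, L2 (p j)) -> (forall j, L2 (q j)) ->
  (forall f, M f -> M (X f)) ->
  (forall f g, M f -> M g -> M (f \+ g)) -> (forall (a : C) f, M f -> M (a \*o f)) ->
  (forall f, M f -> eqm (X f) (tensor_sum n p q f)) ->
  bounded_op M X /\ rank_le n M X.
Proof.
move=> p2 q2 MX MD MZ Xpq; split.
  split=> //.
  - move=> f g Mf Mg fg; apply: (eqm_trans (Xpq f Mf)); apply: eqm_sym.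
    apply: (eqm_trans (Xpq g Mg)); apply: eq_eqm => t _.
    apply: eq_bigr => j _; congr (_ * _); apply: dot_eqm => //; try exact: M2.
      exact: eqm_sym.
    exact: eqm_refl.
  - move=> a f g Mf Mg; have Mfg := MD _ _ (MZ a _ Mf) Mg.
    apply: (eqm_trans (Xpq _ Mfg)); rewrite tensor_sum_lin//; try exact: M2.
    apply: eqmD; last exact/eqm_sym/Xpq.
    exact: (eqmM (eqm_refl (cst a)) (eqm_sym (Xpq f Mf))).
  have [B B0 BP] := tensor_sum_bounded n p2 q2.
  exists (Num.sqrt B) => f Mf; rewrite /norm2 -sqrtrM//.
  apply: ler_wsqrtr.
  have e := Xpq f Mf; have X2 := M2 (MX _ Mf); have t2 := L2_tensor_sum n q f p2.
  rewrite (dot_eqm X2 t2 X2 t2 e e).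
  exact: (BP f (M2 Mf)).
move=> g Mg.
(* A nonzero row vector in the left kernel gives the relation. *)
pose A : 'M[C]_(n.+1, n) := \matrix_(i, j) dot (g i) (q j).
have kA : kermx A != 0.
  rewrite -mxrank_eq0 mxrank_ker -lt0n subn_gt0.
  by rewrite ltnS rank_leq_col.
have /rowV0Pn[v /sub_kermxP vA v0] := kA.
exists (fun i => v 0 i).
  by have /rV0Pn[i vi] := v0; exists i.
apply: (eqm_trans (g := fun z => \sum_i v 0 i * tensor_sum n p q (g i) z)).
  apply: eqm_sum => i; exact: (eqmM (eqm_refl (cst (v 0 i))) (Xpq _ (Mg i))).
apply: eq_eqm => t _; rewrite /tensor_sum /=.
under eq_bigr do rewrite mulr_sumr.
rewrite exchange_big /= big1// => j _.
have := congr1 (fun N : 'rV[C]_n => N 0 j) vA; rewrite !mxE => e.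
transitivity ((\sum_i v 0 i * A i j) * p j (cis t)); last by rewrite e mul0r.
by rewrite mulr_suml; apply: eq_bigr => i _; rewrite mxE mulrA.
Qed.

End FiniteRank.

(** * Truncated Toeplitz and Hankel operators *)

Section Operators.
Variable R : realType.
Local Notation C := (R[i]).
Local Notation fct := (C -> C).
Implicit Types (f g h w x y : fct).
Variables theta phi psi : fct.
Hypothesis inner_theta : inner_function theta.
Hypothesis phi_bounded : Linfty phi.
Hypothesis psi_bounded : Linfty psi.

Local Notation b := (bdry theta).
Local Notation Kt := (model_space theta).
Local Notation k := (k0 theta).
Local Notation kt := (k0t theta).
Local Notation PK := (Defs.proj Kt).
Local Notation PM := (Defs.proj (@H2minus R)).
Local Notation S := (cshift theta).
Local Notation Ss := (cshift_adj theta).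
Local Notation t0 := (theta 0).
Local Notation A := (toeplitz theta phi).
Local Notation B := (hankel theta psi).
Local Notation Bstar := (adjoint Kt B).
Local Notation conjf f := (fun z => Num.conj (f z)).

Let Kk := K_k0 inner_theta.
Let Kkt := K_k0t inner_theta.
Let KS f (Kf : Kt f) := K_cshift inner_theta Kf.
Let KSs f (Kf : Kt f) := K_cshift_adj inner_theta Kf.
Let b2 : L2 b := Linfty_L2 (bdry_Linfty inner_theta).

Lemma K_toeplitz f : Kt f -> Kt (A f).
Proof. by move=> Kf; apply: (PK_in inner_theta); exact: L2_mul (K_L2 Kf). Qed.

Lemma dot_toeplitz f g : Kt f -> Kt g -> dot (A f) g = dot (phi \* f) g.
Proof. by move=> Kf Kg; apply: (PK_dot inner_theta) => //; exact: L2_mul (K_L2 Kf). Qed.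

Let L2_hankel f : L2 f -> L2 (flipJ (PM (psi \* f))).
Proof. by move=> f2; apply/L2_flipJ/PM_L2/L2_mul. Qed.

Lemma K_hankel f : Kt f -> Kt (B f).
Proof. by move=> Kf; apply: (PK_in inner_theta); exact: L2_hankel (K_L2 Kf). Qed.

Lemma dot_hankel_flip f g : Kt f -> Kt g -> dot (B f) g = dot (flipJ (PM (psi \* f))) g.
Proof. by move=> Kf Kg; exact: (PK_dot inner_theta (L2_hankel (K_L2 Kf)) Kg). Qed.

Lemma dot_hankel f g : Kt f -> Kt g -> dot (B f) g = dot (psi \* f) (PM (flipJ g)).
Proof.
move=> Kf Kg; have f2 := K_L2 Kf; have g2 := K_L2 Kg.
have pf2 := L2_mul psi_bounded f2; have J2 := L2_flipJ g2; have P2 := PM_L2 pf2.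
rewrite (dot_hankel_flip Kf Kg) (dot_flipJ P2 g2).
exact: PM_sym.
Qed.

(** B^* g = PK (conjf psi * PM (J g)), since J and the projections are
    self-adjoint. *)
Lemma hankel_adjP g : Kt g -> Kt (Bstar g) /\ forall f, Kt f -> dot (B f) g = dot f (Bstar g).
Proof.
move=> Kg; have P2 : L2 (conjf psi \* PM (flipJ g)).
  by apply: L2_mul; [exact: LinftyJ|exact/PM_L2/L2_flipJ/(K_L2 Kg)].
apply: (@adjointP _ _ _ _ (PK (conjf psi \* PM (flipJ g)))); first exact: PK_in.
by move=> f Kf; rewrite (dot_hankel Kf Kg) (PK_dotr inner_theta P2 Kf) dot_mul.
Qed.

Section DisplacementIdentities.
Variable X : fct -> fct.
Hypothesis KX : forall f, Kt f -> Kt (X f).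

Lemma K_DT f : Kt f -> Kt (DT theta X f).
Proof. by move=> Kf; apply: (K_B inner_theta); [exact: KX|exact/KS/KX/KSs]. Qed.

Lemma K_DH f : Kt f -> Kt (DH theta X f).
Proof. by move=> Kf; apply: (K_B inner_theta); [exact: KX|exact/KSs/KX/KSs]. Qed.

Lemma dot_DT f g : Kt f -> Kt g ->
  dot (DT theta X f) g = dot (X f) g - dot (X (Ss f)) (Ss g).
Proof.
move=> Kf Kg; have x2 := K_L2 (KX Kf); have KXS := KX (KSs Kf).
by rewrite (dotBl x2 (K_L2 (KS KXS)) (K_L2 Kg)) dot_shift_adj.
Qed.

Lemma dot_DH f g : Kt f -> Kt g ->
  dot (DH theta X f) g = dot (X f) g - dot (X (Ss f)) (S g).
Proof.
move=> Kf Kg; have x2 := K_L2 (KX Kf); have KXS := KX (KSs Kf).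
by rewrite (dotBl x2 (K_L2 (KSs KXS)) (K_L2 Kg)) dot_adj_shift.
Qed.
End DisplacementIdentities.

Lemma dot_tensor p q f g : Kt p -> Kt g -> dot (tensor p q f) g = dot f q * dot p g.
Proof. by move=> Kp Kg; apply: dotZl; [exact: (K_L2 Kp)|exact: (K_L2 Kg)]. Qed.

Lemma K_tensor p q f : Kt p -> Kt (tensor p q f).
Proof. exact: (K_Z inner_theta). Qed.

Lemma dot_tensor2 p1 q1 p2 q2 f g : Kt p1 -> Kt p2 -> Kt g ->
  dot ((tensor p1 q1 \+ tensor p2 q2) f) g = dot f q1 * dot p1 g + dot f q2 * dot p2 g.
Proof.
move=> K1 K2 Kg.
by rewrite -!dot_tensor// -(dotDl (K_L2 (K_tensor q1 f K1)) (K_L2 (K_tensor q2 f K2)) (K_L2 Kg)).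
Qed.

(** Sarason's theorem.  On the circle S^* f and S^* g are (f - mean f) / z and
    (g - mean g) / z; in <phi S^* f, S^* g> the factors 1 / z cancel, and what
    is left besides <phi f, g> has a factor mean f = <f, k0> or
    (mean g)^* = <k0, g>.  The vector v is PK phi^*; the term with both factors
    is absorbed in u. *)
Lemma toeplitz_displacement : exists u v, [/\ Kt u, Kt v &
  eqop Kt (DT theta A) (tensor u k \+ tensor k v)].
Proof.
have phi2 := Linfty_L2 phi_bounded; have cphi2 := L2J phi2.
have KP := PK_in inner_theta phi2; have KPc := PK_in inner_theta cphi2.
pose m := mean phi; have Kmk := K_Z inner_theta m Kk.
exists (PK phi \- (m \*o k)), (PK (conjf phi)).
have Ku : Kt (PK phi \- (m \*o k)) by exact: K_B.
split=> // f Kf; apply: (K_eqm inner_theta).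
- exact: (K_DT K_toeplitz Kf).
- exact: (K_D inner_theta (K_tensor _ _ Ku) (K_tensor _ _ Kk)).
move=> g Kg; rewrite (dot_DT K_toeplitz Kf Kg).
have f2 := K_L2 Kf; have g2 := K_L2 Kg.
have Kf' := KSs Kf; have Kg' := KSs Kg.
have Kbf := K_backward inner_theta Kf; have Kbg := K_backward inner_theta Kg.
have cf2 := @L2_cst R (mean f); have cg2 := @L2_cst R (mean g).
rewrite (dot_toeplitz Kf Kg) (dot_toeplitz Kf' Kg').
have -> : dot (phi \* Ss f) (Ss g) = dot (phi \* backward f) (backward g).
  apply: (dot_eqm (L2_mul phi_bounded (K_L2 Kf')) (L2_mul phi_bounded (K_L2 Kbf))
    (K_L2 Kg') (K_L2 Kbg) _ (cshift_adj_eqm inner_theta Kg)).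
  exact: (eqmM (eqm_refl phi) (cshift_adj_eqm inner_theta Kf)).
have pf2 := L2_mul phi_bounded f2; have mp2 := L2Z (mean f) phi2.
have -> : dot (phi \* backward f) (backward g) = dot ((phi \* f) \- (mean f \*o phi)) (g \- cst (mean g)).
  rewrite -[RHS]dot_zbar2; apply: eq_circle_int => t _; congr (_ * _).
  by rewrite /backward /zbar /=; ring.
have pB2 := L2B pf2 mp2; have k2 := K_L2 Kk.
rewrite (dot_tensor2 _ _ _ Ku Kk Kg) (PK_dotr inner_theta cphi2 Kf).
have mk2 := L2Z m k2; have P2 := K_L2 KP.
rewrite (dotBl P2 mk2 g2) (dotZl m k2 g2) (PK_dot inner_theta phi2 Kg) (dotC g2 k2) (dot_k0 inner_theta Kf) (dot_k0 inner_theta Kg).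
rewrite (dotBr pB2 g2 cg2) (dotBl pf2 mp2 g2) (dotBl pf2 mp2 cg2) (dotZl _ phi2 g2) (dotZl _ phi2 cg2).
rewrite (dot_cstr _ pf2) (dot_cstr _ phi2) dot_conj.
have -> : mean (f \* phi) = mean (phi \* f).
  by apply: eq_circle_int => t _ /=; rewrite mulrC.
by rewrite -/m; ring.
Qed.

(** The theorem of Gu and Ma.  Replacing S g by z g costs a multiple of
    <k0t, g>; then z can be moved through J and PM ([zmul_PM]) onto
    psi S^* f, where z S^* f = f - <f, k0> leaves a multiple of <f, k0>. *)
Lemma hankel_displacement : exists u v, [/\ Kt u, Kt v &
  eqop Kt (DH theta B) (tensor u k \+ tensor kt v)].
Proof.
have psi2 := Linfty_L2 psi_bounded.
have JP2 : L2 (flipJ (PM psi)) by apply/L2_flipJ/PM_L2.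
have Jb2 := L2_flipJ b2; have PJb2 := PM_L2 Jb2.
have W2 : L2 (conjf psi \* PM (flipJ b)) by apply: L2_mul => //; exact: LinftyJ.
have KW := PK_in inner_theta W2.
have Ku := PK_in inner_theta JP2; have Kv := KS KW.
exists (PK (flipJ (PM psi))), (S (PK (conjf psi \* PM (flipJ b)))); split=> // f Kf.
apply: (K_eqm inner_theta).
- exact: (K_DH K_hankel Kf).
- exact: (K_D inner_theta (K_tensor _ _ Ku) (K_tensor _ _ Kkt)).
move=> g Kg; rewrite (dot_DH K_hankel Kf Kg).
have f2 := K_L2 Kf; have g2 := K_L2 Kg; have Kf' := KSs Kf; have f'2 := K_L2 Kf'.
have pf2 := L2_mul psi_bounded f2; have pf'2 := L2_mul psi_bounded f'2.
have Jg2 := L2_flipJ g2; have PJg2 := PM_L2 Jg2.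
have P2 := PM_L2 pf'2; have JP'2 := L2_flipJ P2; have zg2 := L2_zmul g2.
set n := PM (psi \* Ss f) in P2 JP'2.
rewrite (dot_tensor2 _ _ _ Ku Kkt Kg).
have E1 : dot (B (Ss f)) (S g) = dot (flipJ n) (explicit_shift theta g).
  rewrite (dot_hankel_flip Kf' (KS Kg)) -/n.
  exact: (dot_eqm JP'2 JP'2 (K_L2 (KS Kg)) (K_L2 (K_explicit_shift inner_theta Kg))
    (eqm_refl _) (cshift_eqm inner_theta Kg)).
have cb2 := L2Z (dot (zmul g) b) b2.
have E2 : dot (flipJ n) (explicit_shift theta g) = dot (flipJ n) (zmul g) - dot kt g * dot (flipJ n) b.
  rewrite /explicit_shift (dotBr JP'2 zg2 cb2) (dotZr _ JP'2 b2) -(dot_k0t inner_theta Kg).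
  by rewrite -(dotC g2 (K_L2 Kkt)).
have E3 : dot f (S (PK (conjf psi \* PM (flipJ b)))) = dot (flipJ n) b.
  rewrite -(dot_adj_shift inner_theta Kf KW) (PK_dotr inner_theta W2 Kf').
  by rewrite (dot_flipJ P2 b2) (PM_sym pf'2 Jb2) dot_mul.
have zpf'2 := L2_zmul pf'2; have Pz2 := PM_L2 zpf'2.
pose c := dot n (zbar (cst 1)); have c2 := @L2_cst R c.
have zn2 := L2_zmul P2; have Pzc2 := L2D Pz2 c2.
have mp2 := L2Z (mean f) psi2; have zc2 := L2_zbar c2.
have E4 : dot (flipJ n) (zmul g) = dot (psi \* f) (PM (flipJ g)) - mean f * dot psi (PM (flipJ g)).
  rewrite -dot_zbar -zbar_flipJ (dot_flipJ zn2 g2).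
  rewrite (dot_eqm zn2 Pzc2 Jg2 Jg2 (zmul_PM pf'2) (eqm_refl _)).
  rewrite (dotDl Pz2 c2 Jg2) -(dot_flipJ c2 g2) flipJ_cst.
  have E0 : dot (zbar (cst c)) g = 0.
    have z12 := L2_zbar (@L2_cst R 1).
    have -> : zbar (cst c) = c \*o zbar (cst 1).
      by apply/funext => z; rewrite /zbar /= mulr1 mulrC.
    by rewrite (dotZl c z12 g2) dot_zbar1_H2 ?mulr0//; exact: K_H2 Kg.
  rewrite E0 addr0 (PM_sym zpf'2 Jg2) -(dotZl _ psi2 PJg2) -(dotBl pf2 mp2 PJg2).
  have B2 := L2B pf2 mp2.
  apply: dot_eqm => //; last exact: eqm_refl.
  have Kbf := K_backward inner_theta Kf.
  apply: (eqm_trans (g := zmul (psi \* backward f))).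
    by apply: (eqmM (eqm_refl (fun z => z))); apply: (eqmM (eqm_refl psi)); exact: (cshift_adj_eqm inner_theta Kf).
  apply: eq_eqm => t _ /=; rewrite /zmul /= mulrCA -[cis t * _]/(zmul (backward f) (cis t)).
  by rewrite zmul_backward; ring.
have E5 : dot (PK (flipJ (PM psi))) g = dot psi (PM (flipJ g)).
  by rewrite (PK_dot inner_theta JP2 Kg) (dot_flipJ (PM_L2 psi2) g2) (PM_sym psi2 Jg2).
have alg (a a' x x' m m' u u' w w' d : C) : a = a' -> x = x' - d * w' ->
    x' = a' - m' * u' -> m = m' -> u = u' -> w = w' -> a - x = m * u + w * d.
  by move=> -> -> -> -> -> ->; ring.
exact: (alg _ _ _ _ _ _ _ _ _ _ _ (dot_hankel Kf Kg) (etrans E1 E2) E4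
  (dot_k0 inner_theta Kf) E5 E3).
Qed.

Local Notation T := (A \+ B).
Local Notation DHDT := (DH theta (DT theta T)).

Lemma K_T f : Kt f -> Kt (T f).
Proof. by move=> Kf; apply: (K_D inner_theta); [exact: K_toeplitz|exact: K_hankel]. Qed.

Lemma dot_T f g : Kt f -> Kt g -> dot (T f) g = dot (A f) g + dot (B f) g.
Proof.
move=> Kf Kg; exact: (dotDl (K_L2 (K_toeplitz Kf)) (K_L2 (K_hankel Kf)) (K_L2 Kg)).
Qed.

Section Formula.
Variables u1 v1 u2 v2 : fct.
Hypothesis Ku1 : Kt u1.
Hypothesis Kv1 : Kt v1.
Hypothesis Ku2 : Kt u2.
Hypothesis Kv2 : Kt v2.
Hypothesis DTA : eqop Kt (DT theta A) (tensor u1 k \+ tensor k v1).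
Hypothesis DHB : eqop Kt (DH theta B) (tensor u2 k \+ tensor kt v2).

Lemma toeplitz_identity f g : Kt f -> Kt g ->
  dot (A f) g = dot (A (Ss f)) (Ss g) + (dot f k * dot u1 g + dot f v1 * dot k g).
Proof.
move=> Kf Kg; have KD := K_DT K_toeplitz Kf.
have Kt2 := K_D inner_theta (K_tensor k f Ku1) (K_tensor v1 f Kk).
rewrite -(dot_tensor2 _ _ _ Ku1 Kk Kg) -(dot_eqm (K_L2 KD) (K_L2 Kt2) (K_L2 Kg) (K_L2 Kg) (DTA Kf) (eqm_refl g)).
by rewrite (dot_DT K_toeplitz Kf Kg) addrC subrK.
Qed.

Lemma hankel_identity f g : Kt f -> Kt g ->
  dot (B f) g = dot (B (Ss f)) (S g) + (dot f k * dot u2 g + dot f v2 * dot kt g).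
Proof.
move=> Kf Kg; have KD := K_DH K_hankel Kf.
have Kt2 := K_D inner_theta (K_tensor k f Ku2) (K_tensor v2 f Kkt).
rewrite -(dot_tensor2 _ _ _ Ku2 Kkt Kg) -(dot_eqm (K_L2 KD) (K_L2 Kt2) (K_L2 Kg) (K_L2 Kg) (DHB Kf) (eqm_refl g)).
by rewrite (dot_DH K_hankel Kf Kg) addrC subrK.
Qed.

(** In the displacement of T, co_v is the factor paired with v, for v = k0, k0t
    and S k0. *)
Definition co_k0 : fct := v1 \+ (Num.conj t0 \*o S v2) \+ S (S (Bstar k)).
Definition co_k0t : fct := (t0 \*o S v1) \+ v2 \- S (S (Bstar kt)).
Definition co_Sk0 : fct := Ss u1 \+ S u2.

Lemma K_co_k0 : Kt co_k0.
Proof.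
apply: (K_D inner_theta); last by apply/KS/KS; have [] := hankel_adjP Kk.
by apply: (K_D inner_theta) => //; apply: (K_Z inner_theta); exact: KS.
Qed.

Lemma K_co_k0t : Kt co_k0t.
Proof.
apply: (K_B inner_theta); last by apply/KS/KS; have [] := hankel_adjP Kkt.
by apply: (K_D inner_theta) => //; apply: (K_Z inner_theta); exact: KS.
Qed.

Lemma K_co_Sk0 : Kt co_Sk0.
Proof. by apply: (K_D inner_theta); [exact: KSs|exact: KS]. Qed.

Lemma dot_co_k0 f : Kt f -> dot f co_k0 = dot f v1 + t0 * dot (Ss f) v2 + dot (B (Ss (Ss f))) k.
Proof.
move=> Kf; have [KBk Bk] := hankel_adjP Kk.
have f2 := K_L2 Kf; have v12 := K_L2 Kv1; have Sv2 := K_L2 (KS Kv2).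
have cSv2 := L2Z (Num.conj t0) Sv2; have SSB := KS (KS KBk).
rewrite (dotDr f2 (L2D v12 cSv2) (K_L2 SSB)) (dotDr f2 v12 cSv2) (dotZr _ f2 Sv2) conjCK.
rewrite Bk; last by apply/KSs/KSs.
rewrite (dot_adj_shift inner_theta (KSs Kf) KBk) (dot_adj_shift inner_theta Kf (KS KBk)).
by rewrite (dot_adj_shift inner_theta Kf Kv2).
Qed.

Lemma dot_co_k0t f : Kt f -> dot f co_k0t =
  Num.conj t0 * dot (Ss f) v1 + dot f v2 - dot (B (Ss (Ss f))) kt.
Proof.
move=> Kf; have [KBk Bk] := hankel_adjP Kkt.
have f2 := K_L2 Kf; have v22 := K_L2 Kv2; have Sv1 := K_L2 (KS Kv1).
have cSv1 := L2Z t0 Sv1; have SSB := KS (KS KBk).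
rewrite (dotBr f2 (L2D cSv1 v22) (K_L2 SSB)) (dotDr f2 cSv1 v22) (dotZr _ f2 Sv1).
rewrite Bk; last by apply/KSs/KSs.
rewrite (dot_adj_shift inner_theta (KSs Kf) KBk) (dot_adj_shift inner_theta Kf (KS KBk)).
by rewrite (dot_adj_shift inner_theta Kf Kv1).
Qed.

Definition displacement f : fct :=
  (tensor k co_k0 f \+ tensor kt co_k0t f \+ tensor (u1 \+ u2) k f) \- tensor co_Sk0 (S k) f.

Lemma K_displacement f : Kt (displacement f).
Proof.
apply: (K_B inner_theta); last exact/K_tensor/K_co_Sk0.
apply: (K_D inner_theta); last exact/K_tensor/(K_D inner_theta Ku1 Ku2).
by apply: (K_D inner_theta); exact: K_tensor.
Qed.

(** The displacement identities are used at (f, g), at (S^* f, S g) for A and at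
    (S^* f, S^* g) for B; the doubly displaced terms <B S^*^2 f, S S^* g> and
    <B S^*^2 f, S^* S g> reduce to <B S^*^2 f, g> up to rank-one terms. *)
Lemma displacement_formula f : Kt f -> eqm (DHDT f) (displacement f).
Proof.
move=> Kf; have KD := K_DT K_T; apply: (K_eqm inner_theta).
- exact: (K_DH KD Kf).
- exact: K_displacement.
move=> g Kg; have f2 := K_L2 Kf; have g2 := K_L2 Kg.
have Kf' := KSs Kf; have Kf'' := KSs Kf'; have KSg := KS Kg; have Ksg := KSs Kg.
have KSsS := KSs KSg; have KSSs := KS Ksg.
have KB'' := K_hankel Kf''.
have e1 : dot (B (Ss (Ss f))) (S (Ss g)) =
    dot (B (Ss (Ss f))) g - dot (B (Ss (Ss f))) k * dot k g.
  exact: (etrans (esym (dot_adj_shift inner_theta KB'' Ksg)) (dot_adj_adj inner_theta KB'' Kg)).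
have e2 : dot (B (Ss (Ss f))) (Ss (S g)) =
    dot (B (Ss (Ss f))) g - dot (B (Ss (Ss f))) kt * dot kt g.
  exact: (etrans (esym (dot_shift_adj inner_theta KB'' KSg)) (dot_shift_shift inner_theta KB'' Kg)).
have L t : Kt t -> L2 t := @K_L2 _ theta t.
have Ku12 := K_D inner_theta Ku1 Ku2.
have T1 := L _ (K_tensor co_k0 f Kk); have T2 := L _ (K_tensor co_k0t f Kkt).
have T3 := L _ (K_tensor k f Ku12); have T4 := L _ (K_tensor (S k) f K_co_Sk0).
have r1 : dot (displacement f) g = dot f co_k0 * dot k g + dot f co_k0t * dot kt g +
    dot f k * dot (u1 \+ u2) g - dot f (S k) * dot co_Sk0 g.
  rewrite /displacement (dotBl (L2D (L2D T1 T2) T3) T4 g2) (dotDl (L2D T1 T2) T3 g2) (dotDl T1 T2 g2).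
  by rewrite (dot_tensor co_k0 f Kk Kg) (dot_tensor co_k0t f Kkt Kg) (dot_tensor k f Ku12 Kg) (dot_tensor (S k) f K_co_Sk0 Kg).
have r2 := dotDl (L _ Ku1) (L _ Ku2) g2.
have r3 : dot co_Sk0 g = dot u1 (S g) + dot u2 (Ss g).
  rewrite (dotDl (L _ (KSs Ku1)) (L _ (KS Ku2)) g2).
  by rewrite (dot_adj_shift inner_theta Ku1 Kg) (dot_shift_adj inner_theta Ku2 Kg).
have r4 := dot_adj_shift inner_theta Kf Kk.
have alg (l D1 D2 s1 s2 s3 s4 a1 a2 a3 a4 c1 c2 c3 c4 e x xk xt kg ktg kSg ktsg fk fv1 fv2
    hk hv1 hv2 u1g u2g u1s u2s fq1 fq2 fS u12 p4g r : C) :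
  l = D1 - D2 -> D1 = s1 - s2 -> D2 = s3 - s4 ->
  s1 = a1 + c1 -> s2 = a2 + c2 -> s3 = a3 + c3 -> s4 = a4 + c4 ->
  a1 = a2 + (fk * u1g + fv1 * kg) -> a3 = a4 + (hk * u1s + hv1 * kSg) ->
  c1 = c3 + (fk * u2g + fv2 * ktg) -> c2 = e + (hk * u2s + hv2 * ktsg) ->
  e = x - xk * kg -> c4 = x - xt * ktg ->
  kSg = - Num.conj t0 * ktg -> ktsg = - t0 * kg ->
  r = fq1 * kg + fq2 * ktg + fk * u12 - fS * p4g ->
  fq1 = fv1 + t0 * hv2 + xk -> fq2 = Num.conj t0 * hv1 + fv2 - xt ->
  u12 = u1g + u2g -> p4g = u1s + u2s -> hk = fS -> l = r.
  by do 21 move=> ->; ring.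
exact: (alg _ _ _ _ _ _ _ _ _ _ _ _ _ _ _ _ _ _ _ _ _ _ _ _ _ _ _ _ _ _ _ _ _ _ _ _ _ _ _
  (dot_DH KD Kf Kg) (dot_DT K_T Kf Kg) (dot_DT K_T Kf' KSg)
  (dot_T Kf Kg) (dot_T Kf' Ksg) (dot_T Kf' KSg) (dot_T Kf'' KSsS)
  (toeplitz_identity Kf Kg) (toeplitz_identity Kf' KSg)
  (hankel_identity Kf Kg) (hankel_identity Kf' Ksg) e1 e2
  (dot_k0_shift inner_theta Kg) (dot_k0t_adj inner_theta Kg)
  r1 (dot_co_k0 Kf) (dot_co_k0t Kf) r2 r3 r4).
Qed.

Lemma displacement_rank : bounded_op Kt DHDT /\ rank_le 4 Kt DHDT.
Proof.
pose p (j : nat) := nth \0 [:: k; kt; u1 \+ u2; (-1 : C) \*o co_Sk0] j.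
pose q (j : nat) := nth \0 [:: co_k0; co_k0t; k; S k] j.
have Ku12 := K_D inner_theta Ku1 Ku2.
have Lp j : L2 (p j).
  case: j => [|[|[|[|j]]]]; rewrite /p /=; last by rewrite nth_nil; exact: L2_0.
  - exact: K_L2 Kk.
  - exact: K_L2 Kkt.
  - exact: K_L2 Ku12.
  - exact: (L2Z _ (K_L2 K_co_Sk0)).
have Lq j : L2 (q j).
  case: j => [|[|[|[|j]]]]; rewrite /q /=; last by rewrite nth_nil; exact: L2_0.
  - exact: K_L2 K_co_k0.
  - exact: K_L2 K_co_k0t.
  - exact: K_L2 Kk.
  - exact: K_L2 (KS Kk).
have KL2 : Kt `<=` @L2 R by move=> f; exact: K_L2.
apply: (finite_rank KL2 Lp Lq (fun f Kf => K_DH (K_DT K_T) Kf)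
  (fun f g => @K_D _ _ inner_theta f g) (fun a f => @K_Z _ _ inner_theta a f)).
move=> f Kf; apply: (eqm_trans (displacement_formula Kf)); apply: eq_eqm => t _.
rewrite /tensor_sum !big_ord_recl big_ord0 /displacement /tensor /p /q /=.
by rewrite mulN1r mulrN addr0 !addrA.
Qed.

End Formula.

End Operators.

Theorem proposition5p5 (R : realType) (theta phi psi : R[i] -> R[i])
    (inner_theta : inner_function theta) (theta_nc : nonconstant theta)
    (phi_bounded : Linfty phi) (psi_bounded : Linfty psi) :
  let Kt := model_space theta in
  let St := cshift theta in
  let k := k0 theta in
  let kt := k0t theta in
  let Bpsi := hankel theta psi in
  let Bstar := adjoint Kt Bpsi in
  let T := toeplitz theta phi \+ Bpsi in
  let DHDT := DH theta (DT theta T) in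
  (bounded_op Kt DHDT /\ rank_le 4 Kt DHDT) /\
  forall u1 v1 u2 v2 : R[i] -> R[i],
    Kt u1 -> Kt v1 -> Kt u2 -> Kt v2 ->
    eqop Kt (DT theta (toeplitz theta phi)) (tensor u1 k \+ tensor k v1) ->
    eqop Kt (DH theta Bpsi) (tensor u2 k \+ tensor kt v2) ->
    eqop Kt DHDT
      (tensor k (v1 \+ ((theta 0)^* \*o St v2) \+ St (St (Bstar k)))
       \+ tensor kt ((theta 0 \*o St v1) \+ v2 \- St (St (Bstar kt)))
       \+ tensor (u1 \+ u2) k
       \- tensor (cshift_adj theta u1 \+ St u2) (St k)).
Proof.
move=> Kt St k kt Bpsi Bstar T DHDT; split.
  have [u1 [v1 [Ku1 Kv1 DTA]]] := toeplitz_displacement inner_theta phi_bounded.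
  have [u2 [v2 [Ku2 Kv2 DHB]]] := hankel_displacement inner_theta psi_bounded.
  exact: (displacement_rank inner_theta phi_bounded psi_bounded Ku1 Kv1 Ku2 Kv2 DTA DHB).
move=> u1 v1 u2 v2 Ku1 Kv1 Ku2 Kv2 DTA DHB f Kf.
exact: (displacement_formula inner_theta phi_bounded psi_bounded Ku1 Kv1 Ku2 Kv2 DTA DHB Kf).
Qed.
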